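(* (Two boundary controls.) Let $g>0$, $l_1>0$, $(K,\gamma)\in(0,+\infty)\times(0,1)$, and let $H_1^*,V_1^*$ be real numbers with $H_1^*>0$ and $0<V_1^*<\sqrt{gH_1^*}$. Let $c>0$ be any number such that $\sqrt{gH_1^*}-V_1^*>2c$. Then there exist a number $\delta_0>0$ and a function $t^*=t^*(H_1^*,V_1^*,c,\delta,K,\gamma)$ with $\lim_{\delta\to0}t^*=0$ such that, for every $\delta\in(0,\delta_0]$ and all $(H_{1,0},V_{1,0})\in\mathrm{Lip}([0,l_1])^2$ with $$\max\big(\|H_{1,0}-H_1^*\|_{W^{1,\infty}(0,l_1)},\|V_{1,0}-V_1^*\|_{W^{1,\infty}(0,l_1)}\big)<\delta,$$ the following holds. For any $T>0$ there exists a unique solution $(H_1,V_1)\in\mathrm{Lip}([0,T]\times[0,l_1])^2$ of $$\partial_tH_1+\partial_x(H_1V_1)=0,\qquad \partial_tV_1+\partial_x\Big(\frac{V_1^2}{2}+gH_1\Big)=0,\qquad 0<x<l_1,$$ $$H_1(0,x)=H_{1,0}(x),\qquad V_1(0,x)=V_{1,0}(x),$$ with the feedback boundary conditions $$H_1(t,l_1)V_1(t,l_1)=H_1(t,l_1)\Big(v_1(t,l_1)+2\sqrt{gH_1(t,l_1)}+V_1^*-2\sqrt{gH_1^*}\Big),$$ $$H_1(t,0)V_1(t,0)=H_1(t,0)\Big(u_1(t,0)-2\sqrt{gH_1(t,0)}+V_1^*+2\sqrt{gH_1^*}\Big),$$ where the control states $v_1(\cdot,l_1)$ and $u_1(\cdot,0)$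 solve $$\frac{d}{dt}v_1(t,l_1)=-K\,\mathrm{sgn}(v_1(t,l_1))|v_1(t,l_1)|^\gamma,\qquad v_1(0,l_1)=V_{1,0}(l_1)-2\sqrt{gH_{1,0}(l_1)}-V_1^*+2\sqrt{gH_1^*},$$ $$\frac{d}{dt}u_1(t,0)=-K\,\mathrm{sgn}(u_1(t,0))|u_1(t,0)|^\gamma,\qquad u_1(0,0)=V_{1,0}(0)+2\sqrt{gH_{1,0}(0)}-V_1^*-2\sqrt{gH_1^*}.$$ Furthermore, $$H_1(t,x)=H_1^*,\quad V_1(t,x)=V_1^*\qquad\text{for all } t\ge\frac{l_1}{c}+t^*,\ x\in(0,l_1).$$ Finally, the equilibrium point $(H_1^*,V_1^* )$ is stable in $\mathrm{Lip}([0,l_1])^2$ for this closed-loop system.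
   Context: $\mathrm{Lip}([0,l_1])=W^{1,\infty}(0,l_1)$ denotes the Lipschitz continuous functions on $[0,l_1]$ with norm $\|u\|_\infty+\|u'\|_\infty$. Here $H_1$ is the water depth, $V_1$ the water velocity in a channel $[0,l_1]$, and $g$ the gravitation constant. A solution is a pair of Lipschitz functions satisfying the partial differential equations in the distributional sense on $(0,T)\times(0,l_1)$, and the initial and boundary conditions pointwise. Stability of $(H_1^*,V_1^* )$ in $\mathrm{Lip}([0,l_1])^2$ means: $\|(H_1-H_1^*,V_1-V_1^* )\|_{L^\infty(\mathbb R^+;\mathrm{Lip}([0,l_1])^2)}\to0$ as $\|(H_{1,0}-H_1^*,V_{1,0}-V_1^* )\|_{\mathrm{Lip}([0,l_1])^2}\to0$. *)

(* Defs.v *)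
(* MathComp-Analysis; the real numbers are an abstract [R : realType]. *)
From mathcomp Require Import all_boot all_order all_algebra.
From mathcomp Require Import all_classical all_reals all_analysis.

Set Implicit Arguments.
Unset Strict Implicit.
Unset Printing Implicit Defensive.

Import Order.TTheory GRing.Theory Num.Theory.
Import numFieldNormedType.Exports.

Local Open Scope classical_set_scope.
Local Open Scope ring_scope.

(* Functions of one or two real variables are total; a function "on [0, l]" or
   "on [0, T] x [0, l]" is a total function of which only the values on that
   set matter. The first variable of a function of two variables is t. *)

Section FunctionSpaces.
Context {R : realType}.
Local Notation mu := (@lebesgue_measure R).

(* The W^{1,oo}(0, l) norm of a Lipschitz function u. The derivative is taken
   pointwise: u is differentiable almost everywhere, and the default value of
   [derive1 u] at the exceptional points does not affect the essential supremum. *)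
Definition W1oo_norm (l : R) (u : R -> R) : \bar R :=
  ('N[mu]_+oo[EFin \o (u \_ `]0%R, l[%classic)]
   + 'N[mu]_+oo[EFin \o (derive1 u \_ `]0%R, l[%classic)])%E.

Definition pair_norm (l : R) (u v : R -> R) : \bar R :=
  Order.max (W1oo_norm l u) (W1oo_norm l v).

(* The norm of L^oo(R^+; Lip([0, l])^2). *)
Definition Loo_pair_norm (l : R) (u v : R -> R -> R) : \bar R :=
  'N[mu]_+oo[(fun t => pair_norm l (u t) (v t)) \_ `]0%R, +oo[%classic]%E.

Definition Lip_interval (l : R) (u : R -> R) : Prop :=
  [lipschitz u x | x in `[0, l]].

Definition Lip_rect (T l : R) (u : R -> R -> R) : Prop :=
  [lipschitz u p.1 p.2 | p in `[0, T] `*` `[0, l]].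

(* C^oo: every iterated directional derivative is Frechet differentiable. *)
Definition smooth (phi : R * R -> R) : Prop :=
  forall (s : seq (R * R)) (p : R * R),
    differentiable (foldr (fun v f => fun q => derive f q v) phi s) p.

Definition test_function (T l : R) (phi : R * R -> R) : Prop :=
  [/\ smooth phi,
      compact (closure [set p | phi p != 0]) &
      closure [set p | phi p != 0] `<=` `]0, T[ `*` `]0, l[].

(* d_t u + d_x f = 0 in the sense of distributions on (0, T) x (0, l). *)
Definition conservation_law (T l : R) (u f : R -> R -> R) : Prop :=
  forall phi, test_function T l phi ->
  (\int[(mu \x mu)%E]_(p in `]0%R, T[ `*` `]0%R, l[)
     (u p.1 p.2 * derive phi p (1, 0)
      + f p.1 p.2 * derive phi p (0, 1))%R%:E)%E = 0%E.

End FunctionSpaces.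

Section ClosedLoop.
Context {R : realType}.

Definition control_state (K gamma T y0 : R) (y : R -> R) : Prop :=
  [/\ {within `[0, T], continuous y},
      y 0 = y0 &
      forall t, 0 < t < T ->
        is_derive t (1 : R) y (- K * Num.sg (y t) * `|y t| `^ gamma)].

(* The nonnegativity of H at the two ends makes the square roots in the
   boundary conditions meaningful: [Num.sqrt] is 0 on negative numbers. *)
Definition boundary_conditions
    (g l K gamma Hs Vs : R) (H0 V0 : R -> R) (T : R) (H V : R -> R -> R) : Prop :=
  exists v u : R -> R,
  [/\ control_state K gamma T
        (V0 l - 2 * Num.sqrt (g * H0 l) - Vs + 2 * Num.sqrt (g * Hs)) v,
      control_state K gamma T
        (V0 0 + 2 * Num.sqrt (g * H0 0) - Vs - 2 * Num.sqrt (g * Hs)) u,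
      forall t, 0 <= t <= T ->
        0 <= H t l /\
        H t l * V t l =
          H t l * (v t + 2 * Num.sqrt (g * H t l) + Vs - 2 * Num.sqrt (g * Hs)) &
      forall t, 0 <= t <= T ->
        0 <= H t 0 /\
        H t 0 * V t 0 =
          H t 0 * (u t - 2 * Num.sqrt (g * H t 0) + Vs + 2 * Num.sqrt (g * Hs))].

Definition closed_loop_solution
    (g l K gamma Hs Vs : R) (H0 V0 : R -> R) (T : R) (H V : R -> R -> R) : Prop :=
  [/\ Lip_rect T l H /\ Lip_rect T l V,
      conservation_law T l H (fun t x => H t x * V t x),
      conservation_law T l V (fun t x => V t x ^+ 2 / 2 + g * H t x),
      (forall x, 0 <= x <= l -> H 0 x = H0 x /\ V 0 x = V0 x) &
      boundary_conditions g l K gamma Hs Vs H0 V0 T H V].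

Definition global_solution
    (g l K gamma Hs Vs : R) (H0 V0 : R -> R) (H V : R -> R -> R) : Prop :=
  forall T, 0 < T -> closed_loop_solution g l K gamma Hs Vs H0 V0 T H V.

Definition stable_equilibrium (g l K gamma Hs Vs : R) : Prop :=
  forall eps : R, 0 < eps -> exists2 eta : R, 0 < eta &
  forall H0 V0 : R -> R, Lip_interval l H0 -> Lip_interval l V0 ->
    (pair_norm l (fun x => H0 x - Hs)%R (fun x => V0 x - Vs)%R < eta%:E)%E ->
    (exists H V, global_solution g l K gamma Hs Vs H0 V0 H V) /\
    (forall H V, global_solution g l K gamma Hs Vs H0 V0 H V ->
      (Loo_pair_norm l (fun t x => H t x - Hs)%R (fun t x => V t x - Vs)%R
         <= eps%:E)%E).

End ClosedLoop.

(* Main.v *)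
From HB Require Import structures.
Require Import Defs.
From mathcomp Require Import all_boot all_order all_algebra.
From mathcomp Require Import all_classical all_reals all_analysis.
From mathcomp Require Import measurable_realfun ess_sup_inf ring lra.
Import Order.TTheory GRing.Theory Num.Theory.
Import numFieldNormedType.Exports.
Local Open Scope classical_set_scope.
Local Open Scope ring_scope.

Set Implicit Arguments.
Unset Strict Implicit.
Unset Printing Implicit Defensive.

(** Write a and b for the Riemann invariants V + 2 sqrt(gH) and V - 2 sqrt(gH)
    minus their equilibrium values. For smooth flows they are transported with
    the speeds V + sqrt(gH) and V - sqrt(gH); near a subcritical equilibrium the
    first is positive and the second negative, both of modulus at least c. So a
    enters the channel at x = 0 and b at x = l, and the two boundary conditions
    say exactly that the entering values are the control states. Those solve
    y' = - K sgn(y) |y|^gamma and vanish after the time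
    |y(0)|^(1 - gamma) / (K (1 - gamma)), which tends to 0 with the data
    ([decay], [decay_extinct]); a further time l/c carries the value 0 across the
    whole channel. Steepening cannot destroy the Lipschitz bound before that
    moment when the data are small, and afterwards the flow is at rest: this is
    why the solution is global and stays close to the equilibrium.

    Reflecting the second family, w true (t, x) = a(t, x) and
    w false (t, x) = - b(t, l - x) both travel to the right and enter at x = 0,
    so both families are treated by one argument, at the price of a coupling of
    x with l - x ([cspeed]).

    For merely Lipschitz flows the equations are replaced throughout by an
    inequality on straight segments, the characteristic estimate ([char_on]):
      |w(t, x) - w(t - s, x - s sigma)| <= C s (|lambda - sigma| + s),
    where lambda is the speed at (t, x) and sigma is any slope. No
    characteristic curve is ever constructed.

    - Every Lipschitz weak solution satisfies it ([weak_char]). Testing with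
      smoothed indicators of rectangles gives the balance law on rectangles
      ([weak_rect]), hence a potential whose x-derivative is the density and
      whose t-derivative is minus the flux; comparing potentials along a thin
      strip around a segment shows that a density is transported with slope
      sigma up to the mismatch between sigma times its increments and the
      increments of its flux ([line_transport]). This is applied to q H + V, the
      linearisation of the invariant at the end point, for which the mismatch is
      the one in the estimate ([linearised_flux]).
    - It determines w from the initial and boundary values, by a discrete
      Gronwall argument ([char_uniqueness]).
    - Conversely, solutions of the estimate are limits of a semi-Lagrangian
      scheme, whose bounds do not depend on the step ([char_existence]); taking
      sigma = lambda shows that they satisfy the transport equations almost
      everywhere, and therefore the conservation laws weakly
      ([invariants_weak]).

    Derivatives of Lipschitz functions enter only through the fundamental
    theorem of calculus ([lipschitz_FTC]). *)

(** * The fundamental theorem of calculus for Lipschitz functions *)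

Section LipschitzFTC.
Context {R : realType}.
Local Notation mu := (@lebesgue_measure R).

#[global] Instance ae_lebesgue_filter : Filter (almost_everywhere mu) :=
  ae_filter_ringOfSetsType mu.

Lemma lipschitz_continuous (u : R -> R) (k : R) :
  (forall x y, `|u x - u y| <= k * `|x - y|) -> continuous u.
Proof.
move=> uk x; apply/cvgrPdist_le => e e0.
have k0 : 0 <= k.
  by have := uk 1 0; rewrite subr0 normr1 mulr1; apply: le_trans.
near=> y; rewrite (le_trans (uk _ _))//.
have : `|x - y| <= e / (k + 1).
  near: y; apply: cvgr_dist_le; [exact: cvg_id|by rewrite divr_gt0// ltr_wpDl].
rewrite ler_pdivlMr ?ltr_wpDl// mulrC => h; apply: le_trans h.
by rewrite ler_wpM2r// lerDl.
Unshelve. all: by end_near. Qed.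

Lemma LS_itv_oc (F : cumulative R R) (x y : R) : x <= y ->
  lebesgue_stieltjes_measure F `]x, y] = (F y - F x)%:E.
Proof.
move=> xy; rewrite /lebesgue_stieltjes_measure /measure_extension/=.
rewrite measurable_mu_extE/=; last exact: is_ocitv.
by rewrite wlength_itv_bnd.
Qed.

(** Radon-Nikodym needs a finite measure on one side, so the Stieltjes measure
    is cut off to ]a, b]. *)
Definition LS_restr (F : cumulative R R) (a b : R) :=
  mrestr (lebesgue_stieltjes_measure F)
    (measurable_itv (Interval (BRight a) (BRight b))).
HB.instance Definition _ (F : cumulative R R) (a b : R) :=
  Measure.on (LS_restr F a b).
Let LS_restr_fin F a b : fin_num_fun (LS_restr F a b).
Proof.
apply: lty_fin_num_fun; rewrite /= /LS_restr /mrestr setTI.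
have [ab|ba] := leP a b; first by rewrite LS_itv_oc// ltry.
by rewrite set_itv_ge ?measure0// bnd_simp -leNgt ltW.
Qed.
HB.instance Definition _ F a b :=
  Measure_isFinite.Build _ _ _ (LS_restr F a b) (@LS_restr_fin F a b).

(** The functions u + k x and k x - u are both nondecreasing, and their Stieltjes
    measures add up to 2 k times the Lebesgue measure; each is therefore
    dominated by it. *)
Lemma LS_lipschitz_dominated (u : R -> R) (k : R) (F : cumulative R R) (a b : R) :
  0 < k -> (forall x y, `|u x - u y| <= k * `|x - y|) ->
  (forall x, F x = u x + k * x) -> LS_restr F a b `<< mu.
Proof.
move=> k0 uk FE.
have cu := lipschitz_continuous uk.
pose G x := k * x - u x.
have ndG : {homo G : x y / x <= y}.
  move=> x y xy; rewrite /G.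
  have := uk y x; rewrite [`|y - x|]ger0_norm ?subr_ge0// => h.
  have := le_trans (ler_norm _) h; lra.
have rcG : right_continuous G.
  move=> x; apply: cvg_at_right_filter; apply: cvgB; last exact: cu.
  by apply: cvgM; [exact: cvg_cst|exact: cvg_id].
pose Gc : cumulative R R := HB.pack G (isCumulative.Build _ _ _ G ndG rcG).
have ki0 : 0 <= (2 * k)^-1 by rewrite invr_ge0 mulr_ge0// ltW.
pose m3 := mscale (NngNum ki0)
  (measure_add (lebesgue_stieltjes_measure F) (lebesgue_stieltjes_measure Gc)).
have m3v A : m3 A = ((2 * k)^-1%:E * (lebesgue_stieltjes_measure F A +
    lebesgue_stieltjes_measure Gc A))%E.
  by rewrite -measure_addE.
have m3E A : measurable A -> mu A = m3 A.
  apply: lebesgue_stieltjes_measure_unique => X /ocitvP[->|[[x y] /= /ltW xy ->]].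
    by rewrite !measure0.
  rewrite LS_itv_oc// [RHS]m3v !LS_itv_oc// -EFinD -EFinM.
  congr EFin; rewrite !FE /Gc/= /G.
  by field; rewrite gt_eqF.
move=> N N0 A mA AN.
have : m3 A = 0%E by rewrite -m3E//; exact: N0.
rewrite m3v => /eqP.
rewrite mule_eq0 eqe invr_eq0 mulf_eq0 pnatr_eq0/= gt_eqF//= => /eqP.
move=> h; rewrite /LS_restr /mrestr.
apply/eqP; rewrite eq_le measure_ge0 andbT.
have -> : (0 = lebesgue_stieltjes_measure F A)%E.
  apply/eqP; rewrite eq_le measure_ge0/= -h.
  by apply: leeDl.
by apply: le_measure; rewrite ?inE//; exact: measurableI.
Qed.

(** The density of the Stieltjes measure of u + k x, minus k, integrates to u,
    and Lebesgue's differentiation theorem identifies it with the derivative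
    almost everywhere. *)
Lemma lipschitz_FTC (u : R -> R) (k a b : R) : a < b ->
  (forall x y, `|u x - u y| <= k * `|x - y|) ->
  exists g : R -> R, [/\ mu.-integrable [set: R] (EFin \o g),
    {ae mu, forall x, a < x < b -> is_derive x (1 : R) u (g x)} &
    forall x, a <= x <= b -> (\int[mu]_(y in `[a, x]) g y)%R = u x - u a].
Proof.
move=> ab uk0.
have [k' k'0 uk] : exists2 k' : R, 0 < k' & forall x y, `|u x - u y| <= k' * `|x - y|.
  exists (`|k| + 1); first by rewrite ltr_wpDl.
  move=> x y; rewrite (le_trans (uk0 _ _))// ler_wpM2r//.
  by rewrite (le_trans (ler_norm _))// lerDl.
move: uk0 => _ {k}; rename k' into k; rename k'0 into k0.
pose F x := u x + k * x.
have cu := lipschitz_continuous uk.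
have ndF : {homo F : x y / x <= y}.
  move=> x y xy; rewrite /F.
  have := uk x y; rewrite [`|x - y|]distrC [`|y - x|]ger0_norm ?subr_ge0// => h.
  have := le_trans (ler_norm _) h; lra.
have rcF : right_continuous F.
  move=> x; apply: cvg_at_right_filter; apply: cvgD; first exact: cu.
  by apply: cvgM; [exact: cvg_cst|exact: cvg_id].
pose Fc : cumulative R R := HB.pack F (isCumulative.Build _ _ _ F ndF rcF).
have dom : LS_restr Fc a b `<< mu by apply: (LS_lipschitz_dominated _ _ k0 uk).
have [f [f0 ff fi fE]] := radon_nikodym_sigma_finite dom.
pose f1 : R -> R := fun x => fine (f x).
have f1E : EFin \o f1 = f by apply/funext => x; rewrite /= /f1 fineK.
have f1i : mu.-integrable setT (EFin \o f1) by rewrite f1E.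
have intF x : a <= x <= b -> (\int[mu]_(y in `]a, x]) f1 y)%R = F x - F a.
  move=> /andP[ax xb]; rewrite /Rintegral.
  rewrite (_ : (fun y => (f1 y)%:E) = f); last exact: f1E.
  rewrite -fE; last exact: measurable_itv.
  rewrite [X in fine X](_ : _ = lebesgue_stieltjes_measure Fc `]a, x]%classic).
    by rewrite LS_itv_oc.
  rewrite /= /LS_restr /mrestr; congr (lebesgue_stieltjes_measure Fc _).
  apply/setIidl => y /=; rewrite !in_itv/= => /andP[-> yx]/=.
  exact: le_trans xb.
pose g := (f1 \- cst k) \_ `[a, b]%classic.
have cki : mu.-integrable `[a, b] (EFin \o cst k).
  by apply: continuous_compact_integrable; [exact: segment_compact
    |exact/continuous_subspaceT/cst_continuous].
exists g; split.
- rewrite /g -restrict_EFin -integrable_mkcond//.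
  rewrite (_ : _ \o _ = (EFin \o f1) \- (EFin \o cst k))%E; last first.
    by apply/funext => x.
  by apply: integrableB => //; apply: integrableS f1i.
- have : {ae mu, forall x, lebesgue_pt f1 x}.
    apply: lebesgue_differentiation.
    exact: (open_integrable_locally openT).
  apply: filterS.
  move=> x lx /andP[ax xb].
  have [] := @FTC1_lebesgue_pt _ f1 (BRight a) x b xb.
  + exact: integrableS f1i.
  + by [].
  + by [].
  set G := (fun _ => _) => dG G'.
  have dF : is_derive x (1 : R) (F \- cst (F a)) (f1 x).
    apply: (@near_eq_is_derive _ _ _ G).
      have xab : x \in `]a, b[ by rewrite in_itv/= ax.
      apply: (@filterS _ (nbhs x) _ _ _ _ (near_in_itvoo xab)) => y.
      by rewrite in_itv/= => /andP[ay yb]; rewrite /G intF//= !ltW.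
    by rewrite -G' derive1E; exact: DeriveDef.
  have -> : g x = f1 x - k.
    by rewrite /g patchE mem_set//= in_itv/= !ltW.
  rewrite [X in is_derive _ _ X](_ : _ =
      (F \- cst (F a)) \- (k \*: (id : R -> R)) \+ cst (F a)); last first.
    by apply/funext => y /=; rewrite /F /cst /= -[k *: y]/(k * y); ring.
  rewrite (_ : f1 x - k = f1 x - k *: (1 : R) + 0); last first.
    by rewrite addr0 -[k *: 1]/(k * 1) mulr1.
  exact: is_deriveD.
- move=> x xab; have /andP[ax xb] := xab.
  have si : `[a, x]%classic `<=` `[a, b]%classic.
    by move=> y /=; rewrite !in_itv/= => /andP[-> yx]; exact: le_trans xb.
  transitivity (\int[mu]_(y in `[a, x]) (f1 y - k))%R.
    by apply: eq_Rintegral => y; rewrite inE => /si yab; rewrite /g patchE mem_set.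
  rewrite RintegralB//; [|exact: integrableS f1i|exact: integrableS cki].
  rewrite -Rintegral_itv_obnd_cbnd; last exact: integrableS f1i.
  rewrite intF// Rintegral_cst//= lebesgue_measure_itv/= lte_fin.
  have [axs|xa] := ltP a x; first by rewrite /F/=; ring.
  have -> : x = a by apply/eqP; rewrite eq_le xa ax.
  by rewrite /F/=; ring.
Qed.

End LipschitzFTC.

(** * Lipschitz functions on a segment and the norm of W^{1,oo} *)

Section Norms.
Context {R : realType}.
Local Notation mu := (@lebesgue_measure R).

(** Composing with this 1-Lipschitz retraction of the line onto [0, l] extends a
    function Lipschitz on [0, l] to the line with the same constant. *)
Definition clamp (l x : R) : R := Num.max 0 (Num.min x l).

Lemma clamp_in (l x : R) : 0 <= l -> 0 <= clamp l x <= l.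
Proof. by rewrite /clamp => l0; rewrite le_max lexx ge_max l0 ge_min lexx orbT. Qed.

Lemma clamp_id (l x : R) : 0 <= x <= l -> clamp l x = x.
Proof. by move=> /andP[x0 xl]; rewrite /clamp min_l// max_r. Qed.

Lemma clamp_lip (l x y : R) : `|clamp l x - clamp l y| <= `|x - y|.
Proof.
have h : forall x y, x <= y -> clamp l x <= clamp l y <= clamp l x + (y - x).
  move=> {}x {}y xy; rewrite /clamp !maxEle !minEle.
  case: (leP x l) => ?; case: (leP y l) => ?; case: (leP 0 x) => ?;
    case: (leP 0 y) => ?; case: (leP 0 l) => ?; lra.
wlog xy : x y / x <= y => [hw|].
  by have [/hw//|/ltW/hw] := leP x y; rewrite distrC [`|x - y|]distrC.
have /andP[h1 h2] := h _ _ xy.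
by rewrite distrC [`|x - y|]distrC !ger0_norm ?subr_ge0//; lra.
Qed.

Definition lip_on (l k : R) (u : R -> R) :=
  forall x y, 0 <= x <= l -> 0 <= y <= l -> `|u x - u y| <= k * `|x - y|.

Lemma lip_on_ge0 (l k : R) (u : R -> R) : 0 < l -> lip_on l k u -> 0 <= k.
Proof.
move=> l0 uk; have := uk l 0; rewrite !lexx (ltW l0) subr0 (gtr0_norm l0).
by move=> /(_ isT isT) h; have := le_trans (normr_ge0 _) h; rewrite pmulr_lge0.
Qed.

Lemma lip_on_clamp (l k : R) (u : R -> R) : 0 < l -> lip_on l k u ->
  forall x y, `|u (clamp l x) - u (clamp l y)| <= k * `|x - y|.
Proof.
move=> l0 uk x y; apply: le_trans (uk _ _ _ _) _; rewrite ?clamp_in ?(ltW l0)//.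
by apply: ler_wpM2l; [exact: lip_on_ge0 uk|exact: clamp_lip].
Qed.

Lemma Lip_intervalP l (u : R -> R) : Lip_interval l u ->
  exists k, lip_on l k u.
Proof.
move=> [M [_ HM]]; exists (M + 1) => x y xl yl.
by apply: (HM (M + 1) _ (x, y)); rewrite ?ltrDl//; split; rewrite /= in_itv.
Qed.

Lemma lebesgue_measure_gt0 : (0 < mu [set: R])%E.
Proof.
apply: (@lt_le_trans _ _ (mu `[0, 1]%classic)).
  by rewrite lebesgue_measure_itv/= lte_fin ltr01 sube0 lte_fin.
by apply: le_measure; rewrite ?inE//; exact: measurable_itv.
Qed.

Lemma ae_dense (P : R -> Prop) (a b : R) : a < b -> {ae mu, forall x, P x} ->
  exists2 x, a < x < b & P x.
Proof.
move=> ab [N [mN N0 PN]].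
have /existsNP[x /not_implyP[xab Px]] : ~ (`]a, b[ `<=` N).
  move=> abN; have : (mu `]a, b[ <= mu N)%E.
    by apply: le_measure; rewrite ?inE//; exact: measurable_itv.
  by rewrite N0 lebesgue_measure_itv/= lte_fin ab -EFinB lee_fin subr_le0 leNgt ab.
exists x; first by move: xab; rewrite /= in_itv.
by apply: contrapT => nPx; apply: Px; exact: PN.
Qed.

Lemma ae_neq2 (x y : R) : {ae mu, forall z, z != x /\ z != y}.
Proof.
exists [set x; y]; split=> //.
- by apply: measurableU; exact: measurable_set1.
- apply/eqP; rewrite eq_le measure_ge0 andbT.
  rewrite -(adde0 0%E) -{1}(lebesgue_measure_set1 x) -(lebesgue_measure_set1 y).
  by apply: measureU2; exact: measurable_set1.
- move=> z /=; apply: contra_notP => /not_orP[/eqP zx /eqP zy].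
  by split.
Qed.

Lemma ae_itvoo_itvcc (P : R -> Prop) (a b : R) :
  {ae mu, forall x, a < x < b -> P x} -> {ae mu, forall x, `[a, b]%classic x -> P x}.
Proof.
move=> h; apply: filterS2 h (ae_neq2 a b) => x h [xa xb]; rewrite /= in_itv/= => /andP[ax bx].
by apply: h; rewrite lt_neqAle eq_sym xa ax/= lt_neqAle xb.
Qed.

(** A null set has a dense complement, so an almost everywhere bound on a
    continuous function holds everywhere, end points included. *)
Lemma lip_ae_le (l k : R) (u : R -> R) (d : R) : 0 < l -> lip_on l k u ->
  {ae mu, forall x, 0 < x < l -> u x <= d} -> forall x, 0 <= x <= l -> u x <= d.
Proof.
move=> l0 uk ud x /andP[x0 xl]; apply/ler_addgt0Pr => e e0.
have k0 := lip_on_ge0 l0 uk.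
pose r := e / (k + 1).
have r0 : 0 < r by rewrite divr_gt0// ltr_wpDl.
have [|y] := @ae_dense _ (Num.max 0 (x - r)) (Num.min l (x + r)) _ ud.
  by rewrite lt_min !gt_max; apply/andP; split; lra.
rewrite gt_max lt_min => /andP[/andP[y0 yr] /andP[yl yr']].
rewrite y0 yl => /(_ isT) uy.
have h : `|u x - u y| <= k * `|x - y|.
  by apply: uk; apply/andP; split=> //; exact: ltW.
have h2 : `|x - y| <= r by rewrite ler_norml; lra.
have h3 : k * `|x - y| <= e.
  apply: (@le_trans _ _ ((k + 1) * r)).
    by apply: ler_pM => //; rewrite lerDl.
  by rewrite /r mulrC divfK// gt_eqF// ltr_wpDl.
have := le_trans (ler_norm _) h; lra.
Qed.

(** The derivative is the one of the function itself rather than of its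
    extension: this is the function that [W1oo_norm] measures. *)
Lemma lip_ae_derive (l k : R) (u : R -> R) : 0 < l -> lip_on l k u ->
  {ae mu, forall x, 0 < x < l -> is_derive x (1 : R) u (derive1 u x) /\
     `|derive1 u x| <= k}.
Proof.
move=> l0 uk; have [g [_ gd _]] := lipschitz_FTC l0 (lip_on_clamp l0 uk).
move: gd; apply: filterS.
move=> x gx xl; have xl' : x \in `]0, l[ by rewrite in_itv.
have du : is_derive x (1 : R) u (g x).
  apply: near_eq_is_derive (gx xl).
  apply: (@filterS _ (nbhs x) _ _ _ _ (near_in_itvoo xl')) => y.
  by rewrite in_itv/= => /andP[y0 yl]; rewrite clamp_id// !ltW.
have gE : derive1 u x = g x by rewrite derive1E derive_val.
rewrite gE; split=> //.
have : h^-1 *: (u (h *: 1 + x) - u x) @[h --> 0^'] --> g x.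
  by rewrite -(derive_val (is_derive := du)); exact: ex_derive.
move=> /cvg_norm gl.
have d0 : 0 < Num.min x (l - x) by move/andP: xl => [? ?]; rewrite lt_min subr_gt0; apply/andP.
have <- := cvg_lim (@Rhausdorff R) gl.
apply: limr_le; first by apply/cvg_ex; exists `|g x|.
move/andP: xl => [x0 xl].
have k0 := lip_on_ge0 l0 uk.
near=> h.
have h0 : h != 0 by near: h; exact: nbhs_dnbhs_neq.
have hd : `|h| < Num.min x (l - x).
  by near: h; exact: dnbhs0_lt.
move: hd; rewrite lt_min !ltr_norml => /andP[/andP[? ?] /andP[? ?]].
rewrite normrZ normfV mulrC ler_pdivrMr ?normr_gt0//.
rewrite -[h *: 1]/(h * 1) mulr1 (le_trans (uk _ _ _ _))//; try by lra.
by rewrite addrK.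
Unshelve. all: by end_near. Qed.

(** The constant k only ensures that u is the integral of its derivative; the
    bound d on the derivative then takes its place. *)
Lemma lip_on_ae_derive_le (l k d : R) (u : R -> R) : 0 < l -> 0 <= d ->
  lip_on l k u -> {ae mu, forall x, 0 < x < l -> `|derive1 u x| <= d} ->
  lip_on l d u.
Proof.
move=> l0 d0 uk ud.
suff H x y : 0 <= x -> x < y -> y <= l -> `|u y - u x| <= d * (y - x).
  move=> x y /andP[x0 xl] /andP[y0 yl].
  have [xy|yx|->] := ltgtP x y; last by rewrite !subrr normr0 mulr0.
  - rewrite distrC [`|x - y|]distrC [`|y - x|]gtr0_norm ?subr_gt0//.
    exact: H.
  - by rewrite [`|x - y|]gtr0_norm ?subr_gt0//; exact: H.
move=> x0 xy yl.
have [g [gi gd gE]] := lipschitz_FTC xy (lip_on_clamp l0 uk).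
have xl : 0 <= x <= l by rewrite x0 (le_trans _ yl)// ltW.
have yl' : 0 <= y <= l by rewrite yl (le_trans x0)// ltW.
have := gE y; rewrite !clamp_id// lexx ltW// => <- //.
have sub : (`[x, y] `<=` [set: R])%classic by [].
have gi' : mu.-integrable `[x, y] (EFin \o g) by exact: integrableS gi.
rewrite -lee_fin EFin_normr_Rintegral//.
apply: (le_trans (le_abse_integral _ _ _)) => //; first exact: measurable_int gi'.
apply: (@le_trans _ _ (\int[mu]_(z in `[x, y]) d%:E)%E); last first.
  rewrite integral_cst//= lebesgue_measure_itv/= lte_fin xy.
  by rewrite -EFinB -EFinM.
apply: ae_ge0_le_integral => //.
- exact: measurable_int (integrable_abse gi').
- have E := ae_neq2 x y.
  apply: filterS3 gd ud E => z gz uz [zx zy]; rewrite /= in_itv/= => /andP[xz zy'].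
  have xz' : x < z by rewrite lt_neqAle eq_sym zx.
  have zy1 : z < y by rewrite lt_neqAle zy.
  have zl : 0 < z < l by rewrite (le_lt_trans x0 xz') (lt_le_trans zy1 yl).
  rewrite lee_fin; have zl' : z \in `]0, l[ by rewrite in_itv.
  have du : is_derive z (1 : R) u (g z).
    apply: near_eq_is_derive (gz _); last by rewrite xz'.
    apply: (@filterS _ (nbhs z) _ _ _ _ (near_in_itvoo zl')) => w.
    by rewrite in_itv/= => /andP[w0 wl]; rewrite clamp_id// !ltW.
  by rewrite -(derive_val (is_derive := du)) -derive1E; exact: uz.
Qed.

Lemma W1oo_norm_lt (l d : R) (u : R -> R) : 0 < l -> Lip_interval l u ->
  (W1oo_norm l u < d%:E)%E ->
  (forall x, 0 <= x <= l -> `|u x| <= d) /\ lip_on l d u.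
Proof.
move=> l0 /Lip_intervalP[k uk].
rewrite /W1oo_norm; set N1 := Lnorm _ _ _; set N2 := Lnorm _ _ _ => Nd.
have N10 : (0 <= N1)%E by exact: Lnorm_ge0.
have N20 : (0 <= N2)%E by exact: Lnorm_ge0.
have N1d : (N1 <= d%:E)%E by apply: le_trans (ltW Nd); exact: leeDl.
have N2d : (N2 <= d%:E)%E by apply: le_trans (ltW Nd); exact: leeDr.
have d0 : 0 <= d by rewrite -lee_fin (le_trans N10).
have aux (f : R -> R) : ('N[mu]_+oo[EFin \o (f \_ `]0%R, l[%classic)] <= d%:E)%E ->
    {ae mu, forall x, 0 < x < l -> `|f x| <= d}.
  rewrite unlock /= lebesgue_measure_gt0 => /ess_supP.
  apply: filterS.
  by move=> x /= + xl; rewrite patchE mem_set /= ?in_itv//= lee_fin.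
split.
- have ku : lip_on l k (fun x => `|u x|).
    move=> x y xl yl; apply: le_trans (uk _ _ xl yl).
    exact: ler_dist_dist.
  by apply: lip_ae_le ku _ => //; exact: aux.
- by apply: lip_on_ae_derive_le uk _ => //; exact: aux.
Qed.

Lemma W1oo_norm_le (l e : R) (u : R -> R) : 0 < l ->
  (forall x, 0 <= x <= l -> `|u x| <= e) -> lip_on l e u ->
  (W1oo_norm l u <= (e + e)%:E)%E.
Proof.
move=> l0 ue uk; rewrite EFinD /W1oo_norm.
have e0 : 0 <= e by rewrite (le_trans _ (ue 0 _))// lexx ltW.
apply: leeD; rewrite unlock /= lebesgue_measure_gt0; apply/ess_supP.
- apply/nearW => x /=; rewrite patchE; case: ifPn => [|_]; last by rewrite normr0 lee_fin.
  rewrite inE/= in_itv/= => /andP[x0 xl]; rewrite lee_fin; apply: ue.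
  by rewrite !ltW.
- have := lip_ae_derive l0 uk.
  apply: filterS.
  move=> x h /=; rewrite patchE; case: ifPn => [|_]; last by rewrite normr0 lee_fin.
  by rewrite inE/= in_itv/= => /h [_]; rewrite lee_fin.
Qed.
End Norms.

(** * Integrals of bounded functions over a segment *)

Section Toolkit.
Context {R : realType}.
Local Notation mu := (@lebesgue_measure R).

Local Notation Int a b h := (\int[mu]_(x in `[a, b]) h x)%R.

Lemma bounded_integrable (a b M : R) (h : R -> R) :
  measurable_fun [set: R] h -> (forall x, a <= x <= b -> `|h x| <= M) ->
  mu.-integrable `[a, b] (EFin \o h).
Proof.
move=> mh hM; apply: (@le_integrable _ _ _ mu _ _ _ (EFin \o cst M)) => //.
- by apply/measurable_EFinP; exact: measurable_funS mh.
- move=> x /=; rewrite in_itv/= => /hM h1; rewrite lee_fin (le_trans h1)//.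
  exact: ler_norm.
- by apply: continuous_compact_integrable; [exact: segment_compact
    |exact/continuous_subspaceT/cst_continuous].
Qed.

Lemma Int_bound (a b M : R) (h : R -> R) : a <= b ->
  measurable_fun [set: R] h -> (forall x, a <= x <= b -> `|h x| <= M) ->
  `|Int a b h| <= M * (b - a).
Proof.
move=> ab mh hM; have ih := bounded_integrable mh hM.
rewrite (le_trans (le_normr_Rintegral _ ih))//.
apply: (@le_trans _ _ (\int[mu]_(x in `[a, b]) cst M x)%R).
  apply: le_Rintegral => //.
  - apply: (@bounded_integrable _ _ M (fun x => `|h x|)).
      by apply: measurableT_comp.
    by move=> x xab; rewrite normr_id hM.
  - apply: (@bounded_integrable _ _ `|M|); first exact: measurable_cst.
    by [].
rewrite Rintegral_cst//= lebesgue_measure_itv/= lte_fin.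
have [//|] := ltP a b; move=> ba; have -> : a = b by apply/eqP; rewrite eq_le ab.
by rewrite subrr.
Qed.

Lemma Int_dct (a b M : R) (h_ : nat -> R -> R) (h : R -> R) :
  (forall n, measurable_fun [set: R] (h_ n)) -> measurable_fun [set: R] h ->
  (forall n x, a <= x <= b -> `|h_ n x| <= M) ->
  {ae mu, forall x, a < x < b -> h_ n x @[n --> \oo] --> h x} ->
  Int a b (h_ n) @[n --> \oo] --> Int a b h.
Proof.
move=> mh_ mh hM hh.
have ih n : mu.-integrable `[a, b] (EFin \o h_ n) by exact: bounded_integrable (hM n).
have [i1 _ cv] : [/\ mu.-integrable `[a, b] (EFin \o h),
   [sequence \int[mu]_(x in `[a, b]) `|(EFin \o h_ n) x - (EFin \o h) x|]_n @ \oo --> 0 &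
   [sequence \int[mu]_(x in `[a, b]) (EFin \o h_ n) x]_n @ \oo -->
      \int[mu]_(x in `[a, b]) (EFin \o h) x]%E.
  apply: (@dominated_convergence _ _ _ mu `[a, b]%classic _ _ _ (EFin \o cst M)) => //.
  - by move=> n; apply/measurable_EFinP; exact: measurable_funS (mh_ n).
  - by apply/measurable_EFinP; exact: measurable_funS mh.
  - apply: ae_itvoo_itvcc; move: hh.
    apply: filterS.
    by move=> x h1 /h1 h2; apply: cvg_EFin => //; exact: nearW.
  - by apply: continuous_compact_integrable; [exact: segment_compact
      |exact/continuous_subspaceT/cst_continuous].
  - by apply: aeW => x n; rewrite /= in_itv/= => xab; rewrite lee_fin hM.
rewrite /Rintegral; apply: fine_cvg; move: cv.
have -> : (\int[mu]_(x in `[a, b]) (EFin \o h) x)%E =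
    (fine (\int[mu]_(x in `[a, b]) (h x)%:E)%E)%:E.
  by rewrite fineK//; exact: integrable_fin_num.
by [].
Qed.

Lemma Int_ae (a b : R) (h1 h2 : R -> R) :
  measurable_fun [set: R] h1 -> measurable_fun [set: R] h2 ->
  {ae mu, forall x, a < x < b -> h1 x = h2 x} ->
  Int a b h1 = Int a b h2.
Proof.
move=> m1 m2 h12; rewrite /Rintegral; congr fine.
apply: ae_eq_integral => //.
- by apply/measurable_EFinP; exact: measurable_funS m1.
- by apply/measurable_EFinP; exact: measurable_funS m2.
- apply: ae_itvoo_itvcc; move: h12.
  apply: filterS.
  by move=> x h1' /h1' ->.
Qed.

Lemma is_derive_lip_le (k : R) (u : R -> R) (x d : R) :
  (forall x y, `|u x - u y| <= k * `|x - y|) ->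
  is_derive x (1 : R) u d -> `|d| <= k.
Proof.
move=> uk du.
have : h^-1 *: (u (h *: 1 + x) - u x) @[h --> 0^'] --> d.
  by rewrite -(derive_val (is_derive := du)); exact: ex_derive.
move=> /cvg_norm gl; have <- := cvg_lim (@Rhausdorff R) gl.
apply: limr_le; first by apply/cvg_ex; exists `|d|.
near=> h.
have h0 : h != 0 by near: h; exact: nbhs_dnbhs_neq.
rewrite normrZ normfV mulrC ler_pdivrMr ?normr_gt0//.
by rewrite -[h *: 1]/(h * 1) mulr1 (le_trans (uk _ _))// addrK.
Unshelve. all: by end_near. Qed.

(** Truncating the density given by [lipschitz_FTC] to [-k, k] changes it on a
    null set only, and makes it bounded everywhere. *)
Lemma lipschitz_ae_derivative (u : R -> R) (k a b : R) : a < b -> 0 <= k ->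
  (forall x y, `|u x - u y| <= k * `|x - y|) ->
  exists g : R -> R, [/\ measurable_fun [set: R] g, forall x, `|g x| <= k,
    {ae mu, forall x, a < x < b -> is_derive x (1 : R) u (g x)} &
    forall x, a <= x <= b -> Int a x g = u x - u a].
Proof.
move=> ab k0 uk; have [g0 [ig0 dg0 Ig0]] := lipschitz_FTC ab uk.
have mg0 : measurable_fun [set: R] g0 by apply/measurable_EFinP; exact: measurable_int ig0.
pose g x := Num.max (- k) (Num.min k (g0 x)).
have mg : measurable_fun [set: R] g.
  by apply: measurable_maxr => //; apply: measurable_minr.
have gE x : `|g0 x| <= k -> g x = g0 x.
  by rewrite ler_norml => /andP[? ?]; rewrite /g min_r// max_r.
have ggE : {ae mu, forall x, a < x < b -> g0 x = g x /\ is_derive x (1 : R) u (g x)}.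
  move: dg0; apply: filterS.
  by move=> x h /h du; rewrite gE//; exact: is_derive_lip_le uk du.
exists g; split=> //.
- move=> x; rewrite ler_norml /g le_max lexx/= ge_max ge_min lexx/= andbT.
  by rewrite ge0_cp.
- move: ggE; apply: filterS.
  by move=> x h /h [].
- move=> x xab; rewrite -Ig0//; apply/esym/Int_ae => //.
  move: ggE; apply: filterS.
  move=> y h /andP[ay yx]; apply: (proj1 (h _)); rewrite ay (lt_le_trans yx)//.
  by case/andP: xab.
Qed.

Lemma Int_derive (P h : R -> R) (k a b : R) : a <= b ->
  (forall x y, `|P x - P y| <= k * `|x - y|) -> measurable_fun [set: R] h ->
  {ae mu, forall x, a < x < b -> is_derive x (1 : R) P (h x)} ->
  Int a b h = P b - P a.
Proof.
move=> ab Pk mh dh.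
have k0 : 0 <= k.
  by have := Pk 1 0; rewrite subr0 normr1 mulr1; apply: le_trans.
have [eab|ab'] := eqVneq a b.
  by rewrite eab set_itv1 Rintegral_set1 subrr.
have {}ab' : a < b by rewrite lt_neqAle ab'.
have [g [mg _ dg Ig]] := lipschitz_ae_derivative ab' k0 Pk.
rewrite -Ig ?ab ?lexx//; apply: Int_ae => //.
apply: filterS2 dh dg => x h1 h2 xab.
by rewrite -(derive_val (is_derive := h1 xab)) -(derive_val (is_derive := h2 xab)).
Qed.
End Toolkit.

(** * Smooth approximations of indicator functions *)

Section Bump.
Context {R : realType}.

(** The family x^(-k) exp(-1/x), extended by 0 to x <= 0, is stable under
    derivation up to linear combinations ([is_derive_flat]); keeping the power k
    as a parameter makes smoothness an induction. *)
Definition flat (k : nat) (x : R) : R :=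
  if 0 < x then x^-1 ^+ k * expR (- x^-1) else 0.

Lemma flat_le0 k (x : R) : x <= 0 -> flat k x = 0.
Proof. by rewrite /flat leNgt => /negbTE ->. Qed.

Lemma flat_ge0 k (x : R) : 0 <= flat k x.
Proof.
rewrite /flat; case: ifP => // x0.
by rewrite mulr_ge0 ?expR_ge0// exprn_ge0// invr_ge0 ltW.
Qed.

(** The exponential series gives exp(y) >= y^(k+2) / (k+2)! at y = 1/x; hence the
    difference quotient at 0 tends to 0. *)
Lemma flat_sq k (x : R) : flat k x <= k.+2`!%:R * x ^+ 2.
Proof.
have f0 : (0 : R) < k.+2`!%:R by rewrite ltr0n fact_gt0.
have [x0|x0] := leP x 0; first by rewrite flat_le0// mulr_ge0 ?sqr_ge0// ltW.
rewrite /flat x0.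
have y0 : 0 < x^-1 by rewrite invr_gt0.
have xE : x = x^-1^-1 by rewrite invrK.
rewrite [x in _ * x ^+ 2]xE; move: (x^-1) y0 => y y0.
have h := expR_ge1Dxn k.+1 (ltW y0).
have {}h : y ^+ k.+2 / k.+2`!%:R <= expR y by apply: le_trans h; rewrite lerDr.
rewrite ler_pdivrMr// in h.
rewrite expRN exprVn ler_pdivrMr ?expR_gt0// mulrAC ler_pdivlMr ?exprn_gt0//.
rewrite -exprD addn2; move: h; rewrite mulrC; lra.
Qed.

Lemma is_derive_flat k (x : R) :
  is_derive x (1 : R) (flat k) (flat k.+2 x - k%:R * flat k.+1 x).
Proof.
have [x0|x0|->] := ltgtP x 0.
- rewrite !flat_le0 ?ltW// mulr0 subr0.
  apply: (@near_eq_is_derive _ _ _ (cst 0)).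
  near=> y; rewrite flat_le0//; near: y; exact: lt_le_nbhsl.
- rewrite /flat x0.
  apply: (@near_eq_is_derive _ _ _ ((fun y : R => y ^+ k * expR (- y)) \o (fun y : R => y^-1))).
    near=> y; have y0 : 0 < y by near: y; exact: lt_nbhsr.
    by rewrite y0.
  have xn0 : x != 0 by rewrite gt_eqF.
  have d1 : is_derive x (1 : R) (fun y : R => y^-1) (- x ^- 2).
    by apply: is_derive_eq; [exact: is_deriveV|rewrite /= -[_ *: _]/(_ * _) mulr1].
  have d2 (y : R) : is_derive y (1 : R) (fun y : R => y ^+ k * expR (- y))
      (y ^+ k * (- expR (- y)) + expR (- y) * (k%:R * y ^+ k.-1)).
    rewrite (_ : (fun _ => _) = (id ^+ k) * (expR \o -%R)); last first.
      by apply/funext => z; rewrite fctE /= exprfctE.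
    apply: is_derive_eq; rewrite exprfctE /= -![_ *: _]/(_ * _); ring.
  apply: is_derive_eq (is_derive1_comp (d2 x^-1) d1) _.
  rewrite -!exprVn; case: (k) => [|n] /=.
    by rewrite !exprS expr0; ring.
  by rewrite !exprS; ring.
- rewrite !(flat_le0 _ (lexx 0)) mulr0 subr0.
  have cv : h^-1 *: (flat k (h *: 1 + 0) - flat k 0) @[h --> 0^'] --> (0 : R).
    apply/cvgr0Pnorm_le => e e0; near=> h.
    have h0 : h != 0 by near: h; exact: nbhs_dnbhs_neq.
    rewrite addr0 -[h *: 1]/(h * 1) mulr1 (flat_le0 _ (lexx 0)) subr0 normrZ normfV.
    rewrite mulrC ler_pdivrMr ?normr_gt0// ger0_norm ?flat_ge0//.
    apply: (le_trans (flat_sq _ _)); rewrite -(ger0_norm (sqr_ge0 h)) normrX expr2.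
    rewrite mulrA ler_wpM2r// mulrC -ler_pdivlMr ?ltr0n ?fact_gt0//.
    by near: h; apply: dnbhs0_le; rewrite divr_gt0// ltr0n fact_gt0.
  apply: DeriveDef; first by apply/cvg_ex; exists 0.
  exact: cvg_lim cv.
Unshelve. all: by end_near. Qed.

(** A class of functions on the plane that is closed under directional
    derivatives and consists of differentiable functions, hence of smooth ones. *)
Inductive bump_fun : (R * R -> R) -> Prop :=
| bump_flat k (a b c : R) : bump_fun (fun p => flat k (a * p.1 + b * p.2 + c))
| bumpD f g : bump_fun f -> bump_fun g -> bump_fun (f + g)
| bumpM f g : bump_fun f -> bump_fun g -> bump_fun (f * g)
| bumpZ (c : R) f : bump_fun f -> bump_fun (c *: f).

Lemma is_diff_affine (a b c : R) (p : R * R) :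
  is_diff p (fun q : R * R => a * q.1 + b * q.2 + c)
            (fun v : R * R => a * v.1 + b * v.2).
Proof.
have d1 : is_diff p (fst : R * R -> R) (fst : R * R -> R).
  apply: DiffDef; first by apply: linear_differentiable; move=> ?; exact: cvg_fst.
  by rewrite diff_lin//; move=> ?; exact: cvg_fst.
have d2 : is_diff p (snd : R * R -> R) (snd : R * R -> R).
  apply: DiffDef; first by apply: linear_differentiable; move=> ?; exact: cvg_snd.
  by rewrite diff_lin//; move=> ?; exact: cvg_snd.
have -> : (fun q : R * R => a * q.1 + b * q.2 + c) =
    (a *: (fst : R * R -> R) + b *: (snd : R * R -> R)) + cst c by [].
have -> : (fun v : R * R => a * v.1 + b * v.2) =
    (a *: (fst : R * R -> R) + b *: (snd : R * R -> R)) + 0.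
  by rewrite addr0.
exact: is_diffD (is_diffD (is_diffZ a d1) (is_diffZ b d2)) (is_diff_cst c p).
Qed.

Lemma bump_fun_diff f : bump_fun f ->
  (forall p, differentiable f p) /\ forall v, bump_fun (fun p => derive f p v).
Proof.
elim=> {f} [k a b c|f g _ [df bf] _ [dg bg]|f g bff [df bf] bgg [dg bg]|c f _ [df bf]].
- have fd (y : R) : is_derive y (1 : R) (flat k) (flat k.+2 y - k%:R * flat k.+1 y).
    exact: is_derive_flat.
  have fdf (y : R) : differentiable (flat k : R -> R) y.
    by apply/derivable1_diffP; exact: ex_derive.
  have D p : is_diff p (fun q : R * R => a * q.1 + b * q.2 + c) _ := is_diff_affine a b c p.
  have cd (p : R * R) : differentiable (fun q : R * R => flat k (a * q.1 + b * q.2 + c)) p.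
    by apply: (@differentiable_comp _ _ _ _ (fun q : R * R => a * q.1 + b * q.2 + c) (flat k)).
  split=> // v.
  rewrite (_ : (fun p => _) = (a * v.1 + b * v.2) *:
     ((fun p => flat k.+2 (a * p.1 + b * p.2 + c)) + (- k%:R) *:
       (fun p => flat k.+1 (a * p.1 + b * p.2 + c)))).
    by apply/bumpZ/bumpD; [exact: bump_flat|exact/bumpZ/bump_flat].
  apply/funext => p; rewrite deriveE//.
  rewrite (@diff_comp _ _ _ _ (fun q : R * R => a * q.1 + b * q.2 + c) (flat k))//=.
  rewrite diff_val diff1E// derive1E derive_val.
  by rewrite !fctE /= -![_ *: _]/(_ * _); ring.
- split=> [p|v]; first exact: differentiableD.
  rewrite (_ : (fun p => _) = (fun p => derive f p v) + (fun p => derive g p v)).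
    exact: bumpD.
  by apply/funext => p; rewrite deriveD//; exact: diff_derivable.
- split=> [p|v]; first exact: differentiableM.
  rewrite (_ : (fun p => _) = f * (fun p => derive g p v) + g * (fun p => derive f p v)).
    by apply: bumpD; exact: bumpM.
  by apply/funext => p; rewrite deriveM//; exact: diff_derivable.
- split=> [p|v]; first exact: differentiableZ.
  rewrite (_ : (fun p => _) = c *: (fun p => derive f p v)); first exact: bumpZ.
  by apply/funext => p; rewrite deriveZ//; exact: diff_derivable.
Qed.

Lemma bump_fun_smooth f : bump_fun f -> smooth f.
Proof.
move=> bf s p; apply: (proj1 (bump_fun_diff _)).
by elim: s => //= v s ih; exact: (proj2 (bump_fun_diff ih)).
Qed.

(** Smooth functions increasing to the indicator of ]t1, t2[. The shifts by 1
    keep the support inside [t1 + 1/(n+1), t2 - 1/(n+1)], so that products of two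
    of them are test functions even when t1 and t2 are ends of the domain. *)
Definition chi (t1 t2 : R) (n : nat) (t : R) : R :=
  flat 0 (n.+1%:R * (t - t1) - 1) * flat 0 (n.+1%:R * (t2 - t) - 1).

End Bump.

Section Chi.
Context {R : realType}.
Local Notation mu := (@lebesgue_measure R).
Local Notation Int a b h := (\int[mu]_(x in `[a, b]) h x)%R.

Lemma flat_continuous k : continuous (flat k : R -> R).
Proof.
move=> x; apply/differentiable_continuous/derivable1_diffP.
by have h := is_derive_flat k x; exact: ex_derive.
Qed.

Lemma flat0_le1 (x : R) : flat 0 x <= 1.
Proof.
rewrite /flat; case: ifP => // x0.
by rewrite expr0 mul1r expR_le1 oppr_le0 invr_ge0 ltW.
Qed.

Lemma flat2_le2 (x : R) : flat 2 x <= 2.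
Proof.
rewrite /flat; case: ifP => // x0.
have y0 : 0 < x^-1 by rewrite invr_gt0.
have := expR_ge1Dxn 1 (ltW y0); rewrite expRN ler_pdivrMr ?expR_gt0//.
rewrite (_ : 2`! = 2)%N//; lra.
Qed.

(** The derivative of [chi t1 t2 n], written with [flat] so that its continuity
    and the bound of order n are immediate. *)
Definition dchi (t1 t2 : R) (n : nat) (t : R) : R :=
  n.+1%:R * (flat 2 (n.+1%:R * (t - t1) - 1) * flat 0 (n.+1%:R * (t2 - t) - 1)
           - flat 0 (n.+1%:R * (t - t1) - 1) * flat 2 (n.+1%:R * (t2 - t) - 1)).

Lemma chi_ge0 t1 t2 n (t : R) : 0 <= chi t1 t2 n t.
Proof. by rewrite mulr_ge0// flat_ge0. Qed.

Lemma chi_le1 t1 t2 n (t : R) : chi t1 t2 n t <= 1.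
Proof. by rewrite mulr_ile1// ?flat_ge0 ?flat0_le1. Qed.

Lemma chi_norm_le1 t1 t2 n (t : R) : `|chi t1 t2 n t| <= 1.
Proof. by rewrite ger0_norm ?chi_ge0 ?chi_le1. Qed.

Lemma chi_supp t1 t2 n (t : R) : chi t1 t2 n t != 0 ->
  t1 + n.+1%:R^-1 <= t <= t2 - n.+1%:R^-1.
Proof.
have n0 : (0 : R) < n.+1%:R by rewrite ltr0n.
apply: contraNT; rewrite negb_and -!ltNge /chi => /orP[h|h].
- rewrite flat_le0 ?mul0r// subr_le0 -ler_pdivlMl// mulr1.
  by rewrite lerBlDl ltW.
- rewrite [X in _ * X]flat_le0 ?mulr0// subr_le0 -ler_pdivlMl// mulr1.
  by rewrite lerBlDr -lerBlDl ltW.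
Qed.

Lemma is_derive_chi t1 t2 n (t : R) :
  is_derive t (1 : R) (chi t1 t2 n) (dchi t1 t2 n t).
Proof.
have d1 : is_derive t (1 : R) (fun t => n.+1%:R * (t - t1) - 1) n.+1%:R.
  rewrite (_ : (fun _ => _) = (n.+1%:R *: (id - cst t1)) - cst 1)//.
  by apply: is_derive_eq; rewrite -![_ *: _]/(_ * _); ring.
have d2 : is_derive t (1 : R) (fun t => n.+1%:R * (t2 - t) - 1) (- n.+1%:R).
  rewrite (_ : (fun _ => _) = (n.+1%:R *: (cst t2 - id)) - cst 1)//.
  by apply: is_derive_eq; rewrite -![_ *: _]/(_ * _); ring.
have D1 := @is_derive1_comp _ (flat 0) (fun t => n.+1%:R * (t - t1) - 1) t _ _ (is_derive_flat 0 (n.+1%:R * (t - t1) - 1)) d1.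
have D2 := @is_derive1_comp _ (flat 0) (fun t => n.+1%:R * (t2 - t) - 1) t _ _ (is_derive_flat 0 (n.+1%:R * (t2 - t) - 1)) d2.
have h : is_derive t (1 : R) (chi t1 t2 n) _ := is_deriveM D1 D2.
apply: (is_derive_eq h); rewrite /dchi /= -![_ *: _]/(_ * _); ring.
Qed.

Lemma dchi_continuous t1 t2 n : continuous (dchi t1 t2 n : R -> R).
Proof.
have c1 k : continuous (fun t : R => flat k (n.+1%:R * (t - t1) - 1)).
  move=> t; apply: (@continuous_comp _ _ _ (fun t : R => n.+1%:R * (t - t1) - 1)); last exact: flat_continuous.
  apply: cvgB; last exact: cvg_cst.
  by apply: cvgM; [exact: cvg_cst|apply: cvgB; [exact: cvg_id|exact: cvg_cst]].
have c2 k : continuous (fun t : R => flat k (n.+1%:R * (t2 - t) - 1)).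
  move=> t; apply: (@continuous_comp _ _ _ (fun t : R => n.+1%:R * (t2 - t) - 1)); last exact: flat_continuous.
  apply: cvgB; last exact: cvg_cst.
  by apply: cvgM; [exact: cvg_cst|apply: cvgB; [exact: cvg_cst|exact: cvg_id]].
move=> t; apply: cvgM; first exact: cvg_cst.
by apply: cvgB; apply: cvgM; [exact: c1|exact: c2|exact: c1|exact: c2].
Qed.

Lemma dchi_bound t1 t2 n (t : R) : `|dchi t1 t2 n t| <= 2 * n.+1%:R.
Proof.
rewrite /dchi normrM ger0_norm// mulrC ler_wpM2r//.
set a := flat 2 _; set b := flat 0 _; set c := flat 0 _; set d := flat 2 _.
have [a0 b0 c0 d0] : [/\ 0 <= a, 0 <= b, 0 <= c & 0 <= d] by split; exact: flat_ge0.
have [a2 d2] : a <= 2 /\ d <= 2 by split; exact: flat2_le2.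
have [b1 c1] : b <= 1 /\ c <= 1 by split; exact: flat0_le1.
have h1 : a * b <= 2 * 1 by exact: ler_pM.
have h2 : c * d <= 1 * 2 by exact: ler_pM.
have h3 : 0 <= a * b by exact: mulr_ge0.
have h4 : 0 <= c * d by exact: mulr_ge0.
rewrite ler_norml; lra.
Qed.

Lemma lipschitz_derive (f df : R -> R) (k : R) :
  (forall x, is_derive x (1 : R) f (df x)) -> (forall x, `|df x| <= k) ->
  forall x y, `|f x - f y| <= k * `|x - y|.
Proof.
move=> dfx dfk x y.
wlog xy : x y / x <= y => [hw|].
  by have [/hw//|/ltW/hw] := leP x y; rewrite distrC [`|x - y|]distrC.
have cf : {within `[x, y], continuous f}.
  apply: continuous_subspaceT => z.
  by apply/differentiable_continuous/derivable1_diffP; exact: ex_derive.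
have [z _] := MVT_segment xy (fun z _ => dfx z) cf.
by rewrite distrC [`|x - y|]distrC => ->; rewrite normrM ler_wpM2r.
Qed.

Lemma chi_lip t1 t2 n (x y : R) :
  `|chi t1 t2 n x - chi t1 t2 n y| <= 2 * n.+1%:R * `|x - y|.
Proof.
exact: (lipschitz_derive (is_derive_chi t1 t2 n) (dchi_bound t1 t2 n)).
Qed.

Lemma chi_cvg (t1 t2 t : R) : t1 < t < t2 -> chi t1 t2 n t @[n --> \oo] --> (1 : R).
Proof.
move=> /andP[t1t tt2].
have aux (d : R) : 0 < d -> flat 0 (n.+1%:R * d - 1) @[n --> \oo] --> (1 : R).
  move=> d0.
  apply/cvgrPdist_le => e e0; near=> n.
  have hn : (e^-1 + 1) / d <= n.+1%:R.
    apply: (@le_trans _ _ n%:R); last by rewrite ler_nat.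
    by near: n; exact: nbhs_infty_ger.
  rewrite ler_pdivrMr// in hn.
  have ei : 0 < e^-1 by rewrite invr_gt0.
  set z := _ - 1; have z0 : e^-1 <= z by rewrite /z; lra.
  have z0' : 0 < z by exact: lt_le_trans z0.
  rewrite ger0_norm ?subr_ge0 ?flat0_le1// /flat z0' expr0 mul1r.
  have h1 := expR_ge1Dx (- z^-1).
  have h2 : z^-1 <= e by rewrite -[e]invrK lef_pV2.
  lra.
rewrite -[X in _ --> X](mulr1 1); apply: cvgM; apply: aux; lra.
Unshelve. all: by end_near. Qed.

Lemma continuous_chi t1 t2 n : continuous (chi t1 t2 n : R -> R).
Proof. exact: lipschitz_continuous (chi_lip t1 t2 n). Qed.

Lemma Int_chi (T t1 t2 M : R) (h : R -> R) : 0 <= t1 -> t1 <= t2 -> t2 <= T ->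
  measurable_fun [set: R] h -> (forall x, `|h x| <= M) ->
  Int 0 T (fun t => chi t1 t2 n t * h t) @[n --> \oo] --> Int t1 t2 h.
Proof.
move=> t10 t12 t2T mh hM.
rewrite (_ : Int t1 t2 h = Int 0 T (h \_ `[t1, t2])); last first.
  rewrite -Rintegral_mkcondr; congr (Rintegral _ _ _).
  apply/esym/setIidr => x /=; rewrite !in_itv/= => /andP[? ?].
  by lra.
apply: (@Int_dct _ _ _ M).
- move=> n; apply: measurable_funM => //.
  by apply: continuous_measurable_fun; exact: continuous_chi.
- exact/(measurable_restrictT _ _).1/measurable_funTS.
- move=> n x _; rewrite normrM -[M]mul1r ler_pM//; exact: chi_norm_le1.
- move: (ae_neq2 t1 t2); apply: filterS => x [xt1 xt2] _.
  rewrite patchE; case: ifPn => [|xn].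
    rewrite inE/= in_itv/= => /andP[t1x xt].
    rewrite -[X in _ --> X]mul1r; apply: cvgM; last exact: cvg_cst.
    by apply: chi_cvg; rewrite !lt_neqAle t1x xt eq_sym xt1 xt2.
  apply: cvg_near_cst; apply: nearW => n.
  have -> : chi t1 t2 n x = 0; last by rewrite mul0r.
  apply: contraNeq xn => /chi_supp /andP[h1 h2]; rewrite inE/= in_itv/=.
  have : (0 : R) < n.+1%:R^-1 by rewrite invr_gt0.
  by move: (n.+1%:R^-1) h1 h2 => i h1 h2 i0; lra.
Qed.

Section ByParts.
Variables (T t1 t2 k M : R) (K : R -> R).
Hypotheses (t10 : 0 <= t1) (t12 : t1 <= t2) (t2T : t2 <= T) (T0 : 0 < T) (k0 : 0 <= k).
Hypothesis Kk : forall x y, `|K x - K y| <= k * `|x - y|.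
Hypothesis KM : forall x, `|K x| <= M.

(** The boundary terms of the integration by parts vanish since [chi] does at
    0 and T. *)
Lemma Int_dchi_parts : exists g : R -> R, [/\ measurable_fun [set: R] g,
  (forall x, `|g x| <= k),
  (forall n, Int 0 T (fun t => dchi t1 t2 n t * K t) =
     - Int 0 T (fun t => chi t1 t2 n t * g t)) & Int t1 t2 g = K t2 - K t1].
Proof.
have [g [mg gk dg _]] := lipschitz_ae_derivative T0 k0 Kk.
have mK : measurable_fun [set: R] K.
  by apply: continuous_measurable_fun; exact: lipschitz_continuous Kk.
exists g; split=> //; last first.
  apply: (Int_derive t12 Kk) => //.
  move: dg; apply: filterS => x h /andP[tx xt]; apply: h.
  by rewrite (le_lt_trans t10 tx) (lt_le_trans xt t2T).
move=> n; apply/eqP; rewrite -subr_eq0 opprK; apply/eqP.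
have mc : measurable_fun [set: R] (chi t1 t2 n : R -> R).
  by apply: continuous_measurable_fun; exact: continuous_chi.
have md : measurable_fun [set: R] (dchi t1 t2 n : R -> R).
  by apply: continuous_measurable_fun; exact: dchi_continuous.
have M0 : 0 <= M by rewrite (le_trans (normr_ge0 _) (KM 0)).
rewrite -RintegralD//; last 2 first.
- apply: (@bounded_integrable _ _ _ (2 * n.+1%:R * M)); first exact: measurable_funM.
  by move=> x _; rewrite normrM ler_pM// dchi_bound.
- apply: (@bounded_integrable _ _ _ (1 * k)); first exact: measurable_funM.
  by move=> x _; rewrite normrM ler_pM// chi_norm_le1.
have c0 : chi t1 t2 n 0 = 0.
  apply/eqP; apply: contraT => /chi_supp/andP[+ _].
  by rewrite leNgt ltr_wpDl// invr_gt0.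
have cT : chi t1 t2 n T = 0.
  apply/eqP; apply: contraT => /chi_supp/andP[_].
  by rewrite leNgt ltrBlDr ltr_pwDr// invr_gt0.
rewrite (@Int_derive _ (chi t1 t2 n * K) _ (k + 2 * n.+1%:R * M)) ?(ltW T0)//.
- by rewrite !fctE c0 cT !mul0r subrr.
- move=> x y; rewrite !fctE.
  rewrite (_ : _ - _ = chi t1 t2 n x * (K x - K y) + (chi t1 t2 n x - chi t1 t2 n y) * K y); last by ring.
  rewrite (le_trans (ler_normD _ _))// [leRHS]mulrDl (normrM (chi t1 t2 n x)) (normrM (_ - _)) lerD//.
    by rewrite -[leRHS]mul1r ler_pM ?chi_norm_le1 ?Kk.
  by rewrite mulrAC ler_pM ?chi_lip ?KM ?mulr_ge0.
- by apply: measurable_funD; exact: measurable_funM.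
- move: dg; apply: filterS => x h /h dK.
  apply: is_derive_eq (is_deriveM (is_derive_chi t1 t2 n x) dK) _.
  by rewrite -![_ *: _]/(_ * _); ring.
Qed.

(** The derivative of [chi] is of order n; only integration by parts gives a
    bound uniform in n, needed for dominated convergence in the other variable. *)
Lemma Int_dchi_bound n : `|Int 0 T (fun t => dchi t1 t2 n t * K t)| <= k * T.
Proof.
have [g [mg gk -> _]] := Int_dchi_parts.
rewrite normrN -[X in _ * X]subr0; apply: Int_bound; rewrite ?(ltW T0)//.
  apply: measurable_funM => //.
  by apply: continuous_measurable_fun; exact: continuous_chi.
by move=> x _; rewrite normrM -[k]mul1r ler_pM// chi_norm_le1.
Qed.

(** In the limit the derivative of [chi] acts as the difference of the Dirac
    masses at t1 and t2. *)
Lemma Int_dchi_cvg :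
  Int 0 T (fun t => dchi t1 t2 n t * K t) @[n --> \oo] --> K t1 - K t2.
Proof.
have [g [mg gk gE Ig]] := Int_dchi_parts.
rewrite (_ : K t1 - K t2 = - Int t1 t2 g); last by rewrite Ig opprB.
under eq_fun do rewrite gE.
by apply: cvgN; exact: Int_chi gk.
Qed.
End ByParts.

End Chi.

(** * Integrals and test functions on rectangles *)

Section Plane.
Context {R : realType}.
Local Notation mu := (@lebesgue_measure R).
Local Notation Int a b h := (\int[mu]_(x in `[a, b]) h x)%R.

(** The product sigma-algebra contains the boxes with rational centre and radius,
    and these form a countable base of the topology. *)
Lemma open_measurable2 (A : set (R * R)) : open A -> measurable (A : set (measurableTypeR R * measurableTypeR R)).
Proof.
move=> oA.
pose box (q r s : rat) : set (R * R) := ball (ratr q : R) (ratr s : R) `*` ball (ratr r : R) (ratr s : R).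
pose B q r s := if `[< box q r s `<=` A >] then box q r s else set0.
rewrite (_ : A = \bigcup_q \bigcup_r \bigcup_s B q r s).
  do 3 (apply: bigcupT_measurable_rat => ?); rewrite /B.
  case: ifPn => _; last exact: measurable0.
  by apply: measurableX; exact: measurable_ball.
apply/seteqP; split=> [[x y] Axy|[x y] [q _ [r _ [s _]]]]; last first.
  by rewrite /B; case: ifPn => // /asboolP; apply.
have /nbhs_ballP[e /= e0 eA] := open_nbhs_nbhs (conj oA Axy).
have /rat_in_itvoo[s] : e / 4 < e / 2 by lra.
rewrite in_itv/= => /andP[es se].
have /rat_in_itvoo[q] : x - e / 4 < x + e / 4 by lra.
rewrite in_itv/= => /andP[xq qx].
have /rat_in_itvoo[r] : y - e / 4 < y + e / 4 by lra.
rewrite in_itv/= => /andP[yr ry].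
exists q => //; exists r => //; exists s => //; rewrite /B.
case: ifPn => [_|/asboolPn].
  by split; rewrite /ball/= ltr_norml; lra.
case=> -[z w] []; rewrite /ball/= !ltr_norml => /andP[z1 z2] /andP[w1 w2].
by apply: eA; split; rewrite /ball/= ltr_norml; lra.
Qed.

Lemma measurable_cont2 (f : R * R -> R) : continuous f ->
  measurable_fun [set: measurableTypeR R * measurableTypeR R] f.
Proof.
move=> /continuousP cf; apply: (measurability _ (RGenOpens.measurableE R)).
move=> _ [_ [a [b ->] <-]]; rewrite setTI; apply: open_measurable2.
exact/cf/interval_open.
Qed.

Lemma EFin_Int (a b M : R) (h : R -> R) : measurable_fun [set: R] h ->
  (forall x, `|h x| <= M) ->
  (\int[mu]_(x in `[a, b]) (h x)%:E)%E = (Int a b h)%:E.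
Proof.
move=> mh hM; rewrite /Rintegral fineK//; apply: integrable_fin_num => //.
exact: bounded_integrable mh (fun x _ => hM x).
Qed.

Lemma EFin_Int_oo (a b M : R) (h : R -> R) : measurable_fun [set: R] h ->
  (forall x, `|h x| <= M) ->
  (\int[mu]_(x in `]a, b[) (h x)%:E)%E = (Int a b h)%:E.
Proof.
move=> mh hM; rewrite -(EFin_Int _ _ mh hM).
have me (i : interval R) : measurable_fun [set` i] (fun x => (h x)%:E).
  by apply/measurable_EFinP; exact: measurable_funTS.
rewrite (integral_itv_bndo_bndc (me (Interval (BRight a) (BLeft b)))).
exact: (integral_itv_obnd_cbnd (me (Interval (BRight a) (BRight b)))).
Qed.

(** Tonelli's theorem gives measurability for nonnegative integrands, whence the
    shift by the bound M. *)
Lemma measurable_Int2 (l M : R) (f : R * R -> R) : 0 < l -> continuous f ->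
  (forall p, `|f p| <= M) ->
  measurable_fun [set: R] (fun t => Int 0 l (fun x => f (t, x))).
Proof.
move=> l0 cf fM; have mf := measurable_cont2 cf.
have mft t : measurable_fun [set: R] (fun x => f (t, x)).
  exact: (measurableT_comp mf (measurable_pair1 t)).
pose h (p : measurableTypeR R * measurableTypeR R) := (EFin \o (f \+ cst M)) p.
pose D : set (measurableTypeR R * measurableTypeR R) := setT `*` `[0, l]%classic.
have mD : measurable D by apply: measurableX.
have mh : measurable_fun setT (h \_ D).
  apply: (measurable_restrictT _ mD).1; apply: measurable_funTS.
  by apply/measurable_EFinP; exact: measurable_funD.
have h0 p : (0 <= (h \_ D) p)%E.
  rewrite patchE; case: ifPn => // _; rewrite /h lee_fin /= .
  by have := fM p; rewrite ler_norml => /andP[? _]; rewrite -lerBlDr sub0r.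
have mF := @measurable_fun_fubini_tonelli_F _ _ _ _ _ mu _ mh h0.
rewrite (_ : (fun t => _) = (fun t => fine (fubini_F mu (h \_ D) t) - M * l)).
  apply: measurable_funB; last exact: measurable_cst.
  exact: measurableT_comp mF.
apply/funext => t.
have -> : fubini_F mu (h \_ D) t = (Int 0 l ((fun y => f (t, y)) \+ cst M))%:E.
  rewrite -(@EFin_Int _ _ (M + `|M|)); last 2 first.
  - exact: measurable_funD.
  - by move=> x /=; rewrite (le_trans (ler_normD _ _))// lerD.
  rewrite /fubini_F [RHS]integral_mkcond; apply: eq_integral => y _.
  rewrite !patchE /D; congr (if _ then _ else _).
  by apply/idP/idP; rewrite !inE /=; [case|].
rewrite /= RintegralD//; last 2 first.
- exact: bounded_integrable (mft t) (fun x _ => fM _).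
- by apply: (@bounded_integrable _ _ _ `|M|); [exact: measurable_cst|].
by rewrite Rintegral_cst//= lebesgue_measure_itv/= lte_fin l0/= subr0 addrK.
Qed.

Lemma Fubini_rect (T l M : R) (f : R * R -> R) : 0 < T -> 0 < l -> continuous f ->
  (forall p, `|f p| <= M) ->
  (\int[(mu \x mu)%E]_(p in `]0%R, T[ `*` `]0%R, l[) (f p)%:E)%E =
  (Int 0 T (fun t => Int 0 l (fun x => f (t, x))))%:E.
Proof.
move=> T0 l0 cf fM; have mk := measurable_Int2 l0 cf fM.
have mf := measurable_cont2 cf.
pose D : set (measurableTypeR R * measurableTypeR R) := `]0, T[%classic `*` `]0, l[%classic.
have mD : measurable D by apply: measurableX.
rewrite -/D integral_mkcond.
have iD : ((mu \x mu)%E).-integrable D (EFin \o f).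
  apply: measurable_bounded_integrable => //.
  - rewrite [X in (X < _)%E](_ : _ = (mu `]0%R, T[%classic * mu `]0%R, l[%classic)%E); last first.
      exact: product_measure1E.
    rewrite !lebesgue_measure_itv/= !lte_fin T0 l0.
    by rewrite -!EFinB -EFinM ltry.
  - exact: measurable_funTS.
  - exists M; split; first by rewrite num_real.
    by move=> M' MM' p _; exact: le_trans (fM p) (ltW MM').
have iF : ((mu \x mu)%E).-integrable setT ((EFin \o f) \_ D).
  by rewrite -integrable_mkcond.
rewrite -(integral12_prod_meas1 iF) /fubini_F.
have mft t : measurable_fun [set: R] (fun x => f (t, x)).
  exact: (measurableT_comp mf (measurable_pair1 t)).
have M0 : 0 <= M by rewrite (le_trans (normr_ge0 _) (fM (0, 0))).
rewrite -(@EFin_Int_oo _ _ (M * l)) //; last first.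
  by move=> t; rewrite -[X in _ * X]subr0; apply: Int_bound; rewrite ?(ltW l0).
rewrite [RHS]integral_mkcond; apply: eq_integral => t _.
rewrite [RHS]patchE; case: ifPn => tT.
- rewrite -(EFin_Int_oo _ _ (mft t) (fun x => fM (t, x))) [RHS]integral_mkcond.
  apply: eq_integral => y _; rewrite !patchE /D; congr (if _ then _ else _).
  by apply/idP/idP; rewrite !inE /=; [case|have := set_mem tT].
- apply: integral0_eq => y _; rewrite patchE /D.
  case: ifPn => // /set_mem[/= h _]; exfalso.
  by move/negP: tT; apply; apply: mem_set.
Qed.

Lemma test_chi (T l t1 t2 x1 x2 : R) n m :
  0 <= t1 -> t2 <= T -> 0 <= x1 -> x2 <= l ->
  test_function T l (fun p => chi t1 t2 n p.1 * chi x1 x2 m p.2).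
Proof.
move=> t10 t2T x10 x2l.
have n0 : (0 : R) < n.+1%:R^-1 by rewrite invr_gt0.
have m0 : (0 : R) < m.+1%:R^-1 by rewrite invr_gt0.
pose K : set (R * R) := `[t1 + n.+1%:R^-1, t2 - n.+1%:R^-1] `*` `[x1 + m.+1%:R^-1, x2 - m.+1%:R^-1].
have cK : compact K by apply: compact_setX; exact: segment_compact.
have sK : [set p : R * R | chi t1 t2 n p.1 * chi x1 x2 m p.2 != 0] `<=` K.
  move=> [t x] /=; rewrite mulf_eq0 negb_or => /andP[/chi_supp h1 /chi_supp h2].
  by split; rewrite /= in_itv.
have cl : closed K by apply: compact_closed => //; exact: norm_hausdorff.
have sK2 : closure [set p : R * R | chi t1 t2 n p.1 * chi x1 x2 m p.2 != 0] `<=` K.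
  by rewrite [X in _ `<=` X](closure_id K).1//; exact: closure_subset.
split.
- apply: bump_fun_smooth.
  rewrite (_ : (fun _ => _) = ((fun p : R * R => flat 0 (n.+1%:R * p.1 + 0 * p.2 + (- n.+1%:R * t1 - 1))) *
      (fun p : R * R => flat 0 ((- n.+1%:R) * p.1 + 0 * p.2 + (n.+1%:R * t2 - 1)))) *
    ((fun p : R * R => flat 0 (0 * p.1 + m.+1%:R * p.2 + (- m.+1%:R * x1 - 1))) *
      (fun p : R * R => flat 0 (0 * p.1 + (- m.+1%:R) * p.2 + (m.+1%:R * x2 - 1))))).
    by apply: bumpM; apply: bumpM; exact: bump_flat.
  apply/funext => p; rewrite !fctE /chi; congr ((flat 0 _ * flat 0 _) * (flat 0 _ * flat 0 _)); ring.
- by apply: subclosed_compact sK2; [exact: closed_closure|].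
- move=> p /sK2 []; rewrite /= !in_itv/= => /andP[h1 h2] /andP[h3 h4].
  split; apply/andP; split.
  + by apply: lt_le_trans h1; rewrite ltr_wpDl.
  + by apply: (le_lt_trans h2); rewrite ltrBlDr ltr_pwDr.
  + by apply: lt_le_trans h3; rewrite ltr_wpDl.
  + by apply: (le_lt_trans h4); rewrite ltrBlDr ltr_pwDr.
Qed.

Lemma is_derive_partial (phi : R * R -> R) (t x : R) : differentiable phi (t, x) ->
  is_derive t (1 : R) (fun t => phi (t, x)) (derive phi (t, x) (1, 0)) /\
  is_derive x (1 : R) (fun x => phi (t, x)) (derive phi (t, x) (0, 1)).
Proof.
move=> dphi.
have e1 : (fun h : R => h^-1 *: (phi (h *: (1, 0) + (t, x)) - phi (t, x))) =
    (fun h : R => h^-1 *: (phi (h *: 1 + t, x) - phi (t, x))).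
  apply/funext => h; congr (_ *: (phi _ - _)).
  by congr pair; rewrite /= -[h *: 0]/(h * 0) mulr0 add0r.
have e2 : (fun h : R => h^-1 *: (phi (h *: (0, 1) + (t, x)) - phi (t, x))) =
    (fun h : R => h^-1 *: (phi (t, h *: 1 + x) - phi (t, x))).
  apply/funext => h; congr (_ *: (phi _ - _)).
  by congr pair; rewrite /= -[h *: 0]/(h * 0) mulr0 add0r.
split; apply: DeriveDef; rewrite /derivable /derive.
- by move: (@diff_derivable R _ _ phi (t, x) (1, 0) dphi); rewrite /derivable /= e1.
- by rewrite /= e1.
- by move: (@diff_derivable R _ _ phi (t, x) (0, 1) dphi); rewrite /derivable /= e2.
- by rewrite /= e2.
Qed.

Lemma derive_chi2 (t1 t2 x1 x2 : R) n m (p : R * R) :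
  derive (fun p => chi t1 t2 n p.1 * chi x1 x2 m p.2) p (1, 0) = dchi t1 t2 n p.1 * chi x1 x2 m p.2 /\
  derive (fun p => chi t1 t2 n p.1 * chi x1 x2 m p.2) p (0, 1) = chi t1 t2 n p.1 * dchi x1 x2 m p.2.
Proof.
case: p => t x /=.
have chid (a b : R) k (r : R) : differentiable (chi a b k : R -> R) r.
  by apply/derivable1_diffP; have h := is_derive_chi a b k r; exact: ex_derive.
have dprod : differentiable (fun p : R * R => chi t1 t2 n p.1 * chi x1 x2 m p.2) (t, x).
  apply: (@differentiableM _ _ (chi t1 t2 n \o (fst : R * R -> R)) (chi x1 x2 m \o snd)).
    apply: differentiable_comp => //.
    by apply: linear_differentiable => ?; exact: cvg_fst.
  apply: differentiable_comp => //.
  by apply: linear_differentiable => ?; exact: cvg_snd.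
have [dt dx] := is_derive_partial dprod; split.
- rewrite -(derive_val (is_derive := dt)).
  have h := is_deriveZ (chi x1 x2 m x) (is_derive_chi t1 t2 n t).
  rewrite (_ : (fun t => _) = chi x1 x2 m x *: chi t1 t2 n).
    by rewrite (derive_val (is_derive := h)) mulrC.
  by apply/funext => r; rewrite mulrC.
- rewrite -(derive_val (is_derive := dx)).
  have h := is_deriveZ (chi t1 t2 n t) (is_derive_chi x1 x2 m x).
  rewrite (_ : (fun x => _) = chi t1 t2 n t *: chi x1 x2 m)//.
  by rewrite (derive_val (is_derive := h)).
Qed.
End Plane.

(** * Balance laws on rectangles *)

Section WeakRect.
Context {R : realType}.
Local Notation mu := (@lebesgue_measure R).
Local Notation Int a b h := (\int[mu]_(x in `[a, b]) h x)%R.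

Definition lip2 (k : R) (u : R -> R -> R) :=
  forall t x s y, `|u t x - u s y| <= k * (`|t - s| + `|x - y|).

Lemma lip2_continuous k u : 0 <= k -> lip2 k u -> continuous (fun p : R * R => u p.1 p.2).
Proof.
move=> k0 uk p; apply/cvgrPdist_le => e e0.
have e1 : 0 < e / (2 * (k + 1)) by rewrite divr_gt0// mulr_gt0// ltr_wpDl.
have c1 : fst q @[q --> p] --> p.1 by exact: cvg_fst.
have c2 : snd q @[q --> p] --> p.2 by exact: cvg_snd.
near=> q; apply: (le_trans (uk _ _ _ _)).
have h1 : `|p.1 - q.1| <= e / (2 * (k + 1)) by near: q; apply: cvgr_dist_le.
have h2 : `|p.2 - q.2| <= e / (2 * (k + 1)) by near: q; apply: cvgr_dist_le.
apply: (@le_trans _ _ ((k + 1) * (e / (2 * (k + 1)) + e / (2 * (k + 1))))).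
  by apply: ler_pM; rewrite ?addr_ge0// ?lerDl// lerD.
rewrite le_eqVlt; apply/orP; left; apply/eqP; field.
by rewrite gt_eqF// ltr_wpDl.
Unshelve. all: by end_near. Qed.

Lemma lip2_measurable_x k u t : lip2 k u -> measurable_fun [set: R] (u t).
Proof.
move=> uk; apply: continuous_measurable_fun; apply: (@lipschitz_continuous _ _ k) => x y.
by have := uk t x t y; rewrite subrr normr0 add0r.
Qed.

Lemma lip2_measurable_t k u x : lip2 k u -> measurable_fun [set: R] (u ^~ x).
Proof.
move=> uk; apply: continuous_measurable_fun; apply: (@lipschitz_continuous _ _ k) => t s.
by have := uk t x s x; rewrite subrr normr0 addr0.
Qed.

Lemma Int_param_lip (l c M : R) (h : R -> R -> R) : 0 < l ->
  (forall t, measurable_fun [set: R] (h t)) -> (forall t x, `|h t x| <= M) ->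
  (forall t s x, `|h t x - h s x| <= c * `|t - s|) ->
  forall t s, `|Int 0 l (h t) - Int 0 l (h s)| <= c * l * `|t - s|.
Proof.
move=> l0 mh hM hc t s.
rewrite -RintegralB//; try by apply: bounded_integrable (mh _) (fun x _ => hM _ x).
rewrite mulrAC -[X in _ * X]subr0; apply: Int_bound; first exact: ltW.
  exact: measurable_funB.
by move=> x _; exact: hc.
Qed.

Section Weak.
Variables (T l k M : R) (u f : R -> R -> R).
Hypotheses (T0 : 0 < T) (l0 : 0 < l) (k0 : 0 <= k) (uk : lip2 k u) (fk : lip2 k f).
Hypotheses (uM : forall t x, `|u t x| <= M) (fM : forall t x, `|f t x| <= M).
Hypothesis (uf : conservation_law T l u f).
Variables (t1 t2 x1 x2 : R).
Hypotheses (t10 : 0 <= t1) (t12 : t1 <= t2) (t2T : t2 <= T).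
Hypotheses (x10 : 0 <= x1) (x12 : x1 <= x2) (x2l : x2 <= l).

Let K m t := Int 0 l (fun x => chi x1 x2 m x * u t x).
Let j m t := Int 0 l (fun x => dchi x1 x2 m x * f t x).

Let M0 : 0 <= M. Proof. by rewrite (le_trans (normr_ge0 _) (uM 0 0)). Qed.

Let mchi a b m : measurable_fun [set: R] (chi a b m : R -> R).
Proof. by apply: continuous_measurable_fun; exact: continuous_chi. Qed.
Let mdchi a b m : measurable_fun [set: R] (dchi a b m : R -> R).
Proof. by apply: continuous_measurable_fun; exact: dchi_continuous. Qed.

Let mK1 m t : measurable_fun [set: R] (fun x => chi x1 x2 m x * u t x).
Proof. by apply: measurable_funM => //; exact: lip2_measurable_x uk. Qed.
Let mj1 m t : measurable_fun [set: R] (fun x => dchi x1 x2 m x * f t x).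
Proof. by apply: measurable_funM => //; exact: lip2_measurable_x fk. Qed.
Let bK1 m t x : `|chi x1 x2 m x * u t x| <= M.
Proof. by rewrite normrM -[M]mul1r ler_pM ?chi_norm_le1. Qed.
Let bj1 m t x : `|dchi x1 x2 m x * f t x| <= 2 * m.+1%:R * M.
Proof. by rewrite normrM ler_pM ?dchi_bound. Qed.

Let Klip m t s : `|K m t - K m s| <= k * l * `|t - s|.
Proof.
apply: (@Int_param_lip l k M (fun t x => chi x1 x2 m x * u t x)) => // {}t {}s x.
rewrite -mulrBr normrM -[leRHS]mul1r ler_pM ?chi_norm_le1//.
by have := uk t x s x; rewrite subrr normr0 addr0.
Qed.

Let jlip m t s : `|j m t - j m s| <= (2 * m.+1%:R * k) * l * `|t - s|.
Proof.
apply: (@Int_param_lip l (2 * m.+1%:R * k) (2 * m.+1%:R * M) (fun t x => dchi x1 x2 m x * f t x)) => // {}t {}s x.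
rewrite -mulrBr normrM -[leRHS]mulrA ler_pM ?dchi_bound//.
by have := fk t x s x; rewrite subrr normr0 addr0.
Qed.

Let Kbound m t : `|K m t| <= M * l.
Proof. by rewrite -[X in _ * X]subr0; apply: Int_bound; rewrite ?(ltW l0). Qed.

Let jbound m t : `|j m t| <= k * l.
Proof.
have h x y : `|f t x - f t y| <= k * `|x - y|.
  by have := fk t x t y; rewrite subrr normr0 add0r.
exact: (Int_dchi_bound x10 x12 x2l l0 k0 h (fM t) m).
Qed.

Let mj m : measurable_fun [set: R] (j m).
Proof. by apply: continuous_measurable_fun; exact: lipschitz_continuous (jlip m). Qed.
Let mK m : measurable_fun [set: R] (K m).
Proof. by apply: continuous_measurable_fun; exact: lipschitz_continuous (Klip m). Qed.

Let step1 n m : Int 0 T (fun t => dchi t1 t2 n t * K m t) +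
  Int 0 T (fun t => chi t1 t2 n t * j m t) = 0.
Proof.
have := uf (test_chi n m t10 t2T x10 x2l).
pose F (p : R * R) := u p.1 p.2 * (dchi t1 t2 n p.1 * chi x1 x2 m p.2) +
  f p.1 p.2 * (chi t1 t2 n p.1 * dchi x1 x2 m p.2).
rewrite (_ : (fun p => _) = EFin \o F); last first.
  by apply/funext => p; have [-> ->] := derive_chi2 t1 t2 x1 x2 n m p.
have cF : continuous F.
  have c1 (h : R -> R) : continuous h -> continuous (fun p : R * R => h p.1).
    by move=> ch p; apply: (@continuous_comp _ _ _ (fst : R * R -> R) h); [exact: cvg_fst|exact: ch].
  have c2 (h : R -> R) : continuous h -> continuous (fun p : R * R => h p.2).
    by move=> ch p; apply: (@continuous_comp _ _ _ (snd : R * R -> R) h); [exact: cvg_snd|exact: ch].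
  move=> p; apply: cvgD; apply: cvgM.
  - exact: (lip2_continuous k0 uk).
  - by apply: cvgM; [exact: (c1 _ (@dchi_continuous R t1 t2 n) p)
                    |exact: (c2 _ (@continuous_chi R x1 x2 m) p)].
  - exact: (lip2_continuous k0 fk).
  - by apply: cvgM; [exact: (c1 _ (@continuous_chi R t1 t2 n) p)
                    |exact: (c2 _ (@dchi_continuous R x1 x2 m) p)].
rewrite (@Fubini_rect _ _ _ (M * (2 * n.+1%:R * 1) + M * (1 * (2 * m.+1%:R))))//; last first.
  move=> p; rewrite (le_trans (ler_normD _ _))// (normrM (u _ _)) (normrM (f _ _)).
  rewrite (normrM (dchi _ _ _ _)) (normrM (chi _ _ _ _)) lerD// ler_pM ?mulr_ge0//.
    by rewrite ler_pM ?dchi_bound ?chi_norm_le1.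
  by rewrite ler_pM ?dchi_bound ?chi_norm_le1.
move=> [] h; rewrite -RintegralD//; last 2 first.
- apply: (@bounded_integrable _ _ _ (2 * n.+1%:R * (M * l))); first exact: measurable_funM.
  by move=> x _; rewrite normrM ler_pM// dchi_bound.
- apply: (@bounded_integrable _ _ _ (1 * (k * l))); first exact: measurable_funM.
  by move=> x _; rewrite normrM ler_pM// chi_norm_le1.
rewrite -[RHS]h; apply: eq_Rintegral => t _; rewrite /K /j.
rewrite -!RintegralZl//; try by
  [exact: bounded_integrable (mK1 _ _) (fun x _ => bK1 _ _ x)
  |exact: bounded_integrable (mj1 _ _) (fun x _ => bj1 _ _ x)].
rewrite -RintegralD//; last 2 first.
- apply: (@bounded_integrable _ _ _ (2 * n.+1%:R * M)).
    by apply: measurable_funM => //; exact: measurable_cst.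
  by move=> x _; rewrite (normrM (dchi _ _ _ _)) ler_pM// dchi_bound.
- apply: (@bounded_integrable _ _ _ (1 * (2 * m.+1%:R * M))).
    by apply: measurable_funM => //; exact: measurable_cst.
  by move=> x _; rewrite (normrM (chi _ _ _ _)) ler_pM// chi_norm_le1.
by apply: eq_Rintegral => x _; rewrite /F/=; ring.
Qed.

Let step2 m : K m t1 - K m t2 + Int t1 t2 (j m) = 0.
Proof.
have kl0 : 0 <= k * l by rewrite mulr_ge0// ltW.
have c1 := @Int_dchi_cvg _ T t1 t2 _ _ _ t10 t12 t2T T0 kl0 (Klip m) (Kbound m).
have c2 := @Int_chi _ T t1 t2 _ _ t10 t12 t2T (mj m) (jbound m).
have c := cvgD c1 c2.
have -> : K m t1 - K m t2 + Int t1 t2 (j m) = lim ((fun n => Int 0 T (fun t => dchi t1 t2 n t * K m t) +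
  Int 0 T (fun t => chi t1 t2 n t * j m t)) @ \oo).
  by apply/esym/cvg_lim => //; exact: c.
rewrite (_ : (fun n => _) = cst 0); first exact: lim_cst.
by apply/funext => n; rewrite step1.
Qed.

(** The conservation law is tested with chi(t) chi(x) and the two approximation
    parameters are sent to infinity one after the other: first the one in time
    ([step2]), with the smoothed space integrals K and j fixed, then the one in
    space. *)
Lemma weak_rect : Int x1 x2 (u t2) - Int x1 x2 (u t1) =
  - (Int t1 t2 (f ^~ x2) - Int t1 t2 (f ^~ x1)).
Proof.
have cK t : K m t @[m --> \oo] --> Int x1 x2 (u t).
  exact: (@Int_chi _ l x1 x2 M (u t) x10 x12 x2l (lip2_measurable_x _ uk) (uM t)).
have cj t : j m t @[m --> \oo] --> f t x1 - f t x2.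
  have h x y : `|f t x - f t y| <= k * `|x - y|.
    by have := fk t x t y; rewrite subrr normr0 add0r.
  exact: (Int_dchi_cvg x10 x12 x2l l0 k0 h (fM t)).
have mf x : measurable_fun [set: R] (f ^~ x) by exact: lip2_measurable_t fk.
have cI : Int t1 t2 (j m) @[m --> \oo] --> Int t1 t2 (fun t => f t x1 - f t x2).
  apply: (@Int_dct _ _ _ (k * l)) => //; first exact: measurable_funB.
  exact: aeW.
have c := cvgD (cvgB (cK t1) (cK t2)) cI.
have : lim ((fun m => K m t1 - K m t2 + Int t1 t2 (j m)) @ \oo) =
   Int x1 x2 (u t1) - Int x1 x2 (u t2) + Int t1 t2 (fun t => f t x1 - f t x2).
  by apply: cvg_lim => //; exact: c.
have -> : (fun m => K m t1 - K m t2 + Int t1 t2 (j m)) = cst 0.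
  by apply/funext => m; exact: step2.
rewrite lim_cst// RintegralB//; try by apply: bounded_integrable (mf _) (fun t _ => fM t _).
lra.
Qed.
End Weak.
End WeakRect.

(** * Transport along a segment *)

Section Transport.
Context {R : realType}.
Local Notation mu := (@lebesgue_measure R).
Local Notation Int a b h := (\int[mu]_(x in `[a, b]) h x)%R.

Lemma Int_split (M : R) (h : R -> R) (x y : R) : 0 <= x -> x <= y ->
  measurable_fun [set: R] h -> (forall z, `|h z| <= M) ->
  Int 0 y h - Int 0 x h = Int x y h.
Proof.
move=> x0 xy mh hM.
have := @Rintegral_itvB R h (BLeft 0) (BRight y) x.
rewrite Rintegral_itv_obnd_cbnd; last first.
  apply: integrableS (bounded_integrable mh (fun z (_ : x <= z <= y) => hM z)) => //.
  by move=> z /=; rewrite !in_itv/= => /andP[/ltW-> ->].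
by apply; rewrite ?bnd_simp//; exact: bounded_integrable mh (fun z _ => hM z).
Qed.

Lemma Int_quadratic (k M : R) (h : R -> R) (x y : R) : 0 <= x -> 0 <= y ->
  (forall z w, `|h z - h w| <= k * `|z - w|) -> (forall z, `|h z| <= M) ->
  `|Int 0 y h - Int 0 x h - (y - x) * h x| <= k * (y - x) ^+ 2.
Proof.
move=> x0 y0 hk hM.
have k0 : 0 <= k.
  by have := hk 1 0; rewrite subr0 normr1 mulr1; apply: le_trans.
have mh : measurable_fun [set: R] h.
  by apply: continuous_measurable_fun; exact: lipschitz_continuous hk.
have key (a b p : R) : 0 <= a -> a <= b -> a <= p <= b ->
    `|Int a b h - (b - a) * h p| <= k * (b - a) ^+ 2.
  move=> a0 ab /andP[ap pb].
  have -> : Int a b h - (b - a) * h p = Int a b (h \- cst (h p)).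
    rewrite RintegralB//.
    - rewrite Rintegral_cst//= lebesgue_measure_itv/= lte_fin.
      have [//|ba] := ltP a b; first by rewrite mulrC.
      by have -> : a = b; [apply/eqP; rewrite eq_le ab|rewrite subrr mul0r mulr0].
    - exact: bounded_integrable mh (fun z _ => hM z).
    - by apply: (@bounded_integrable _ _ _ `|h p|); [exact: measurable_cst|].
  rewrite expr2 mulrA; apply: Int_bound => //.
    by apply: measurable_funB => //; exact: measurable_cst.
  move=> z /andP[az zb]; apply: (le_trans (hk _ _)); rewrite ler_wpM2l//.
  by rewrite ler_norml; lra.
have [xy|/ltW yx] := leP x y.
  by rewrite (Int_split x0 xy mh hM); apply: key => //; rewrite lexx.
have -> : Int 0 y h - Int 0 x h - (y - x) * h x =
    - (Int 0 x h - Int 0 y h - (x - y) * h x) by ring.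
rewrite normrN.
rewrite (_ : (y - x) ^+ 2 = (x - y) ^+ 2); last by ring.
by rewrite (Int_split y0 yx mh hM); apply: key => //; rewrite lexx yx.
Qed.

(** Cutting [a, b] into n pieces divides the total quadratic error by n. *)
Lemma small_increments (G : R -> R) (a b A C : R) : a <= b -> 0 <= C ->
  (forall t d, 0 <= d -> a <= t -> t + d <= b ->
     `|G (t + d) - G t| <= A * d + C * d ^+ 2) ->
  `|G b - G a| <= A * (b - a).
Proof.
move=> ab C0 GC; apply/ler_addgt0Pr => e e0.
pose D := b - a; have D0 : 0 <= D by rewrite subr_ge0.
have [n nE] : exists n : nat, C * D ^+ 2 / e <= n.+1%:R.
  exists (Num.bound (C * D ^+ 2 / e)).
  apply: ltW; apply: (lt_le_trans (archi_boundP _)).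
    by rewrite divr_ge0 ?mulr_ge0 ?sqr_ge0// ltW.
  by rewrite ler_nat.
have n0 : (0 : R) < n.+1%:R by rewrite ltr0n.
pose d := D / n.+1%:R; have d0 : 0 <= d by rewrite divr_ge0// ltW.
have nd : n.+1%:R * d = D by rewrite /d mulrC divfK// gt_eqF.
have step (m : nat) : (m <= n.+1)%N ->
    `|G (a + m%:R * d) - G a| <= m%:R * (A * d + C * d ^+ 2).
  elim: m => [_|m ih mn]; first by rewrite !mul0r addr0 subrr normr0.
  have {ih} := ih (ltnW mn).
  have := GC (a + m%:R * d) d d0.
  rewrite lerDl mulr_ge0// => /(_ isT).
  have -> : a + m%:R * d + d = a + m.+1%:R * d by rewrite -natr1; ring.
  have -> : a + m.+1%:R * d <= b.
    rewrite -lerBrDl -/D -nd ler_wpM2r// ler_nat//.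
  move=> /(_ isT) h1 h2.
  have -> : G (a + m.+1%:R * d) - G a =
      (G (a + m.+1%:R * d) - G (a + m%:R * d)) + (G (a + m%:R * d) - G a) by ring.
  apply: (le_trans (ler_normD _ _)).
  have -> : m.+1%:R * (A * d + C * d ^+ 2) =
      A * d + C * d ^+ 2 + m%:R * (A * d + C * d ^+ 2) by rewrite -natr1; ring.
  exact: lerD.
have := step n.+1 (leqnn _); rewrite nd (_ : a + D = b); last by rewrite /D; ring.
move=> /le_trans; apply; rewrite mulrDr mulrCA nd lerD2l.
have -> : n.+1%:R * (C * d ^+ 2) = C * D ^+ 2 / n.+1%:R.
  by rewrite /d; field; rewrite gt_eqF.
by move: nE; rewrite !ler_pdivrMr// [e * _]mulrC.
Qed.

Section Line.
Variables (T l k M : R) (u f : R -> R -> R).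
Hypotheses (k0 : 0 <= k) (uk : lip2 k u) (fk : lip2 k f).
Hypotheses (uM : forall t x, `|u t x| <= M) (fM : forall t x, `|f t x| <= M).
Hypothesis rect : forall t x, 0 <= t <= T -> 0 <= x <= l ->
  Int 0 x (u t) - Int 0 x (u 0) = - (Int 0 t (f ^~ x) - Int 0 t (f ^~ 0)).

(* A potential: its x-derivative is u and its t-derivative is -f, with quadratic
   remainders because u and f are Lipschitz. *)
Let Phi t x := Int 0 x (u t) - Int 0 t (f ^~ 0).

Let Phix t x y : 0 <= x <= l -> 0 <= y <= l ->
  `|Phi t y - Phi t x - (y - x) * u t x| <= k * (y - x) ^+ 2.
Proof.
move=> /andP[x0 _] /andP[y0 _].
rewrite (_ : _ - _ - _ = Int 0 y (u t) - Int 0 x (u t) - (y - x) * u t x); last first.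
  by rewrite /Phi; ring.
apply: (@Int_quadratic _ M) => // z w.
by have := uk t z t w; rewrite subrr normr0 add0r.
Qed.

Let Phit t s x : 0 <= t <= T -> 0 <= s <= T -> 0 <= x <= l ->
  `|Phi s x - Phi t x + (s - t) * f t x| <= k * (s - t) ^+ 2.
Proof.
move=> tT sT xl.
have E r : 0 <= r <= T -> Phi r x = Int 0 x (u 0) - Int 0 r (f ^~ x).
  by move=> rT; have := rect rT xl; rewrite /Phi; lra.
rewrite (E _ tT) (E _ sT).
have -> : Int 0 x (u 0) - Int 0 s (f ^~ x) - (Int 0 x (u 0) - Int 0 t (f ^~ x)) +
    (s - t) * f t x = - (Int 0 s (f ^~ x) - Int 0 t (f ^~ x) - (s - t) * f t x) by ring.
rewrite normrN.
move: tT sT => /andP[? _] /andP[? _].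
apply: (@Int_quadratic _ M) => // z w.
by have := fk z x w x; rewrite subrr normr0 addr0.
Qed.

(** Let y(tau) = x - (t - tau) sigma run along the segment. The mass
    Q(tau) = Phi(tau, y + e r) - Phi(tau, y) of the strip of width r beside it has
    derivative sigma (u(y + e r) - u(y)) - (f(y + e r) - f(y)), at most A r in
    modulus, while Q(tau) = e r u(tau, y) + O(r^2). Integrating over the length s,
    dividing by r and letting r tend to 0 gives the claim. The sign e chooses the
    side of the segment, since the strip must stay inside the channel. *)
Lemma line_transport (t s x sg A r0 e : R) : 0 <= t - s -> 0 <= s -> t <= T ->
  0 < r0 -> `|e| = 1 -> 0 <= x <= l -> 0 <= x - s * sg <= l ->
  0 <= x + e * r0 <= l -> 0 <= x - s * sg + e * r0 <= l ->
  (forall tau r, t - s <= tau <= t -> 0 < r <= r0 ->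
    let y := x - (t - tau) * sg in 0 <= y <= l -> 0 <= y + e * r <= l ->
    `|sg * (u tau (y + e * r) - u tau y) - (f tau (y + e * r) - f tau y)| <= A * r) ->
  `|u t x - u (t - s) (x - s * sg)| <= A * s.
Proof.
move=> ts0 s0 tT r00 e1 /andP[x0 xl] /andP[z0 zl] /andP[x0' xl'] /andP[z0' zl'] HA.
have k0' := k0.
pose y tau := x - (t - tau) * sg.
have yin tau r : t - s <= tau <= t -> 0 <= r <= r0 ->
    0 <= y tau <= l /\ 0 <= y tau + e * r <= l.
  move=> /andP[h1 h2] /andP[h3 h4]; rewrite /y.
  have ex : 0 <= x + e * r <= l /\ 0 <= x - s * sg + e * r <= l.
    have [ee|ee] := eqVneq e 1.
      rewrite ee mul1r in x0' xl' z0' zl' *.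
      by split; lra.
    have {}ee : e = - 1.
      move: e1; case: (leP 0 e) => e0; first by rewrite ger0_norm// => /eqP; rewrite (negbTE ee).
      by rewrite ltr0_norm// => <-; rewrite opprK.
    rewrite ee mulN1r in x0' xl' z0' zl' *.
    by split; lra.
  move: ex => [/andP[? ?] /andP[? ?]].
  have [sg0|sg0] := leP 0 sg.
  - have b1 : 0 <= (t - tau) * sg by rewrite mulr_ge0// subr_ge0.
    have b2 : (t - tau) * sg <= s * sg by rewrite ler_wpM2r// lerBlDr -lerBlDl.
    by split; lra.
  - have b1 : (t - tau) * sg <= 0 by rewrite mulr_ge0_le0 ?subr_ge0// ltW.
    have b2 : s * sg <= (t - tau) * sg.
      by rewrite ler_wnM2r ?(ltW sg0)// lerBlDr -lerBlDl.
    by split; lra.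
pose E := k * (sg ^+ 2 + `|sg| + 1).
have E0 : 0 <= E by rewrite mulr_ge0// !addr_ge0 ?sqr_ge0.
have inc tau d r : 0 <= d -> t - s <= tau -> tau + d <= t -> 0 <= r <= r0 ->
    `|Phi (tau + d) (y (tau + d) + e * r) - Phi tau (y tau + e * r) -
      d * (sg * u tau (y tau + e * r) - f tau (y tau + e * r))| <= E * d ^+ 2.
  move=> d0 h1 h2 hr.
  have in1 : t - s <= tau <= t by lra.
  have in2 : t - s <= tau + d <= t by lra.
  have [_ a2] := yin _ _ in1 hr; have [_ b2] := yin _ _ in2 hr.
  have yE : y (tau + d) = y tau + d * sg by rewrite /y; ring.
  set Y := y tau + e * r in a2 *.
  have Y'E : y (tau + d) + e * r = Y + d * sg by rewrite yE /Y; ring.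
  rewrite Y'E in b2 *.
  have T1 : 0 <= tau <= T by lra.
  have T2 : 0 <= tau + d <= T by lra.
  have p1 := Phix (tau + d) a2 b2; have p2 := Phit T1 T2 a2.
  rewrite (_ : Y + d * sg - Y = d * sg) in p1; last by ring.
  rewrite (_ : tau + d - tau = d) in p2; last by ring.
  have p3 : `|d * sg * (u (tau + d) Y - u tau Y)| <= k * `|sg| * d ^+ 2.
    rewrite !normrM (ger0_norm d0) (_ : k * _ * _ = d * `|sg| * (k * d)); last by ring.
    rewrite ler_wpM2l ?mulr_ge0//; apply: (le_trans (uk _ _ _ _)).
    by rewrite subrr normr0 addr0 (_ : tau + d - tau = d) ?ger0_norm//; ring.
  rewrite /E.
  have -> : k * (sg ^+ 2 + `|sg| + 1) * d ^+ 2 =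
     k * (d * sg) ^+ 2 + k * d ^+ 2 + k * `|sg| * d ^+ 2 by ring.
  move: p1 p2 p3; rewrite !ler_norml; lra.
have width r : 0 < r <= r0 ->
    `|u t x - u (t - s) (x - s * sg)| * r <= A * r * s + 2 * k * r ^+ 2.
  move=> /andP[rr0 rrm]; have r0r : 0 <= r <= r0 by rewrite ltW.
  have r00' : 0 <= (0 : R) <= r0 by apply/andP; split; [|exact: ltW].
  pose Q tau := Phi tau (y tau + e * r) - Phi tau (y tau).
  have Qb : `|Q t - Q (t - s)| <= A * r * s.
    have := @small_increments Q (t - s) t (A * r) (2 * E).
    rewrite (_ : t - (t - s) = s); last by ring.
    apply; [lra|by rewrite mulr_ge0|].
    move=> tau d d0 h1 h2.
    have i1 := inc tau d r d0 h1 h2 r0r.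
    have := inc tau d 0 d0 h1 h2 r00'; rewrite mulr0 !addr0 => i2.
    have in1 : t - s <= tau <= t by lra.
    have [a1 a2] := yin _ _ in1 r0r.
    have i3 : `|sg * (u tau (y tau + e * r) - u tau (y tau)) -
        (f tau (y tau + e * r) - f tau (y tau))| <= A * r.
      by apply: HA => //; rewrite rr0.
    have i4 : `|d * (sg * (u tau (y tau + e * r) - u tau (y tau)) -
        (f tau (y tau + e * r) - f tau (y tau)))| <= A * r * d.
      by rewrite normrM (ger0_norm d0) mulrC ler_wpM2r.
    rewrite /Q; move: i1 i2 i4; rewrite !ler_norml; lra.
  have y_t : y t = x by rewrite /y subrr mul0r subr0.
  have y_s : y (t - s) = x - s * sg by rewrite /y; congr (_ - _ * _); ring.
  have t1 : t - s <= t <= t by lra.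
  have t2 : t - s <= t - s <= t by lra.
  have [i1 i2] := yin _ _ t1 r0r; have [i3 i4] := yin _ _ t2 r0r.
  move: i1 i2 i3 i4 Qb; rewrite /Q y_t y_s => i1 i2 i3 i4 Qb.
  have := @Phix t x (x + e * r) i1 i2.
  have := @Phix (t - s) (x - s * sg) (x - s * sg + e * r) i3 i4.
  set X := x - s * sg in z0 zl i3 i4 Qb *.
  rewrite (_ : X + e * r - X = e * r); last by ring.
  rewrite (_ : x + e * r - x = e * r); last by ring.
  have -> : (e * r) ^+ 2 = r ^+ 2 by rewrite exprMn -real_normK ?num_real// e1 expr1n mul1r.
  have -> : `|u t x - u (t - s) X| * r = `|e * r * u t x - e * r * u (t - s) X|.
    by rewrite -mulrBr !normrM e1 mul1r (gtr0_norm rr0) mulrC.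
  move: Qb; rewrite !ler_norml; lra.
apply/ler_addgt0Pr => ep ep0.
pose r := Num.min r0 (ep / (2 * k + 1)).
have k1 : 0 < 2 * k + 1 by lra.
have rr0 : 0 < r by rewrite lt_min r00 divr_gt0.
have re : (2 * k + 1) * r <= ep.
  by rewrite mulrC -ler_pdivlMr// /r ge_min lexx orbT.
have rle : r <= r0 by rewrite /r ge_min lexx.
have := width r; rewrite rr0 rle => /(_ isT).
rewrite expr2 mulrA => h.
have : `|u t x - u (t - s) (x - s * sg)| * r <= (A * s + 2 * k * r) * r.
  by move: h; lra.
rewrite ler_pM2r// => h2; lra.
Qed.
End Line.
End Transport.

(** * The characteristic estimate for weak solutions *)

Section WeakChar.
Context {R : realType}.
Local Notation mu := (@lebesgue_measure R).
Local Notation Int a b h := (\int[mu]_(x in `[a, b]) h x)%R.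

Lemma lip2_ge0 k u : lip2 k u -> (0 : R) <= k.
Proof.
move=> uk; have := uk 1 0 0 0; rewrite subrr normr0 addr0 subr0 normr1 mulr1.
exact: le_trans.
Qed.

Lemma lip2W k k' u : k <= k' :> R -> lip2 k u -> lip2 k' u.
Proof.
by move=> kk uk t x s y; rewrite (le_trans (uk _ _ _ _))// ler_wpM2r// addr_ge0.
Qed.

Lemma lip2D k k' (u v : R -> R -> R) : lip2 k u -> lip2 k' v ->
  lip2 (k + k') (fun t x => u t x + v t x).
Proof.
move=> uk vk t x s y.
rewrite (_ : _ - _ = (u t x - u s y) + (v t x - v s y)); last by ring.
by rewrite (le_trans (ler_normD _ _))// mulrDl lerD.
Qed.

Lemma lip2Z k (q : R) (u : R -> R -> R) : lip2 k u ->
  lip2 (`|q| * k) (fun t x => q * u t x).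
Proof. by move=> uk t x s y; rewrite -mulrBr normrM -mulrA ler_wpM2l. Qed.

Lemma lip2M k k' M (u v : R -> R -> R) : lip2 k u -> lip2 k' v ->
  (forall t x, `|u t x| <= M) -> (forall t x, `|v t x| <= M) ->
  lip2 (M * (k + k')) (fun t x => u t x * v t x).
Proof.
move=> uk vk uM vM t x s y.
rewrite (_ : _ - _ = u t x * (v t x - v s y) + v s y * (u t x - u s y)); last by ring.
apply: (le_trans (ler_normD _ _)); rewrite !normrM.
rewrite (_ : M * _ * _ = M * (k' * (`|t - s| + `|x - y|)) + M * (k * (`|t - s| + `|x - y|))).
  by apply: lerD; apply: ler_pM.
by ring.
Qed.

Section Combination.
Variables (T l k M q : R) (u1 f1 u2 f2 : R -> R -> R).
Hypotheses (T0 : 0 < T) (l0 : 0 < l).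
Hypotheses (u1k : lip2 k u1) (f1k : lip2 k f1) (u2k : lip2 k u2) (f2k : lip2 k f2).
Hypotheses (u1M : forall t x, `|u1 t x| <= M) (f1M : forall t x, `|f1 t x| <= M).
Hypotheses (u2M : forall t x, `|u2 t x| <= M) (f2M : forall t x, `|f2 t x| <= M).
Hypotheses (uf1 : conservation_law T l u1 f1) (uf2 : conservation_law T l u2 f2).

(** The balance law on rectangles is linear in the pair of density and flux, so
    it passes to the combination q u1 + u2 with a constant q. *)
Lemma combined_transport (t s x sg A r0 e : R) : 0 <= t - s -> 0 <= s -> t <= T ->
  0 < r0 -> `|e| = 1 -> 0 <= x <= l -> 0 <= x - s * sg <= l ->
  0 <= x + e * r0 <= l -> 0 <= x - s * sg + e * r0 <= l ->
  let u t x := q * u1 t x + u2 t x in let f t x := q * f1 t x + f2 t x in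
  (forall tau r, t - s <= tau <= t -> 0 < r <= r0 ->
    let y := x - (t - tau) * sg in 0 <= y <= l -> 0 <= y + e * r <= l ->
    `|sg * (u tau (y + e * r) - u tau y) - (f tau (y + e * r) - f tau y)| <= A * r) ->
  `|u t x - u (t - s) (x - s * sg)| <= A * s.
Proof.
move=> ts0 s0 tT r00 e1 xl zl xl' zl' u f HA.
have k0 := lip2_ge0 u1k.
have uk : lip2 (`|q| * k + k) u by apply: lip2D => //; exact: lip2Z.
have fk : lip2 (`|q| * k + k) f by apply: lip2D => //; exact: lip2Z.
have bnd (h1 h2 : R -> R -> R) : (forall t x, `|h1 t x| <= M) -> (forall t x, `|h2 t x| <= M) ->
    forall t x, `|q * h1 t x + h2 t x| <= `|q| * M + M.
  move=> b1 b2 t' x'; rewrite (le_trans (ler_normD _ _))// lerD// normrM.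
  by rewrite ler_wpM2l.
have lin (h1 h2 : R -> R) a b : measurable_fun [set: R] h1 -> measurable_fun [set: R] h2 ->
    (forall z, `|h1 z| <= M) -> (forall z, `|h2 z| <= M) ->
    Int a b (fun z => q * h1 z + h2 z) = q * Int a b h1 + Int a b h2.
  move=> m1 m2 b1 b2.
  have i1 := bounded_integrable m1 (fun z (_ : a <= z <= b) => b1 z).
  have i2 := bounded_integrable m2 (fun z (_ : a <= z <= b) => b2 z).
  rewrite RintegralD//; first by rewrite RintegralZl.
  apply: (@bounded_integrable _ _ _ (`|q| * M)).
    by apply: measurable_funM => //; exact: measurable_cst.
  by move=> z _; rewrite normrM ler_wpM2l.
apply: (line_transport (T := T) (l := l) (k := `|q| * k + k) (M := `|q| * M + M)
  (u := u) (f := f) _ uk fk _ _ _ ts0 s0 tT r00 e1 xl zl xl' zl' HA).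
- by rewrite addr_ge0// mulr_ge0.
- exact: bnd.
- exact: bnd.
- move=> t' x' /andP[t0 t'T] /andP[x0 x'l].
  rewrite /u /f !lin//; try exact: lip2_measurable_x; try exact: lip2_measurable_t.
  have w1 := weak_rect T0 l0 k0 u1k f1k u1M f1M uf1 (lexx 0) t0 t'T (lexx 0) x0 x'l.
  have w2 := weak_rect T0 l0 k0 u2k f2k u2M f2M uf2 (lexx 0) t0 t'T (lexx 0) x0 x'l.
  have := congr1 ( *%R q) w1; move: w2; lra.
Qed.
End Combination.

(** With q = e sqrt(g / H0), q H + V is the linearisation at (H0, V0) of the
    Riemann invariant, a left eigenvector of the flux matrix for the eigenvalue
    V0 + q H0. What is left besides (sigma - V0 - q H0) times the increment is
    quadratic in the differences of the states. *)
Lemma linearised_flux (q g H0 V0 H1 V1 H2 V2 sg : R) : q ^+ 2 * H0 = g ->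
  sg * ((q * H2 + V2) - (q * H1 + V1)) -
    ((q * (H2 * V2) + (V2 ^+ 2 / 2 + g * H2)) - (q * (H1 * V1) + (V1 ^+ 2 / 2 + g * H1))) =
  (sg - (V0 + q * H0)) * (q * (H2 - H1) + (V2 - V1)) + q * (H2 - H1) * (V0 - V1)
  + (V2 - V1) * ((V0 - V1) + q * (H0 - H1)) - q * (H2 - H1) * (V2 - V1)
  - (V2 - V1) ^+ 2 / 2.
Proof. by move=> <-; field. Qed.

Lemma flux_bound (q dl dH dV eV eH Q D B d : R) : `|q| <= Q -> `|dH| <= D ->
  `|dV| <= D -> `|eV| <= B -> `|eH| <= B -> `|d| <= dl ->
  `|d * (q * dH + dV) + q * dH * eV + dV * (eV + q * eH) - q * dH * dV - dV ^+ 2 / 2|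
  <= dl * (Q * D + D) + Q * D * B + D * (B + Q * B) + Q * D * D + D * D.
Proof.
move=> qQ dHD dVD eVB eHB ddl.
have m2 (a b A B' : R) : `|a| <= A -> `|b| <= B' -> `|a * b| <= A * B'.
  by move=> *; rewrite normrM ler_pM.
have a2 (a b A B' : R) : `|a| <= A -> `|b| <= B' -> `|a + b| <= A + B'.
  by move=> *; rewrite (le_trans (ler_normD _ _))// lerD.
apply: (a2); last first.
  rewrite normrN normrM [`|2^-1|]ger0_norm ?invr_ge0// expr2.
  apply: (@le_trans _ _ `|dV * dV|); last exact: m2.
  by rewrite ler_piMr// invf_le1// ler1n.
apply: (a2); last by rewrite normrN; do 2 (apply: (m2) => //).
apply: (a2); last by apply: (m2) => //; apply: (a2) => //; exact: m2.
apply: (a2); last by do 2 (apply: (m2) => //).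
by apply: (m2) => //; apply: (a2) => //; exact: m2.
Qed.

Section Shallow.
Variables (g T l L M : R) (H V : R -> R -> R).
Hypotheses (g0 : 0 < g) (T0 : 0 < T) (l0 : 0 < l).
Hypotheses (HL : lip2 L H) (VL : lip2 L V).
Hypotheses (HM : forall t x, `|H t x| <= M) (VM : forall t x, `|V t x| <= M).
Hypothesis mass : conservation_law T l H (fun t x => H t x * V t x).
Hypothesis momentum : conservation_law T l V (fun t x => V t x ^+ 2 / 2 + g * H t x).

(** The two characteristic families, for e = 1 and e = -1. *)
Definition riemann (e : R) t x := V t x + 2 * e * Num.sqrt (g * H t x).
Definition char_speed (e : R) t x := V t x + e * Num.sqrt (g * H t x).

Definition char_const (hm Sg : R) :=
  let Q := g / Num.sqrt (g * hm) in
  L * (Q + 1) + L ^+ 2 * (1 + Sg) * (2 * Q + 1) + (Q + 1) * L ^+ 2 +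
  (g * L * (1 + Sg)) ^+ 2 / Num.sqrt (g * hm) ^+ 3.

(** Along the segment the states differ from the one at (t, x) by O(s), so the
    mismatch in [linearised_flux] over a width r is O(r (|lambda - sigma| + s)),
    and [line_transport] applies. The linearisation error made at the foot of the
    segment is quadratic in the distance, that is O(s^2). *)
Lemma weak_char (hm Sg e t s x sg : R) : 0 < hm -> e = 1 \/ e = -1 ->
  0 <= t - s -> 0 <= s -> t <= T -> 0 <= x <= l -> 0 <= x - s * sg <= l ->
  (x < l /\ x - s * sg < l) \/ (0 < x /\ 0 < x - s * sg) ->
  `|sg| <= Sg -> hm <= H t x -> 0 <= H (t - s) (x - s * sg) ->
  `|riemann e t x - riemann e (t - s) (x - s * sg)| <=
     char_const hm Sg * s * (`|char_speed e t x - sg| + s).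
Proof.
move=> hm0 he ts0 s0 tT xl zl inn sgS Hhm Hz0.
have L0 := lip2_ge0 HL.
have [->|sn0] := eqVneq s 0.
  by rewrite mul0r !subr0 subrr normr0 mulr0 mul0r.
have {sn0}s0' : 0 < s by rewrite lt_neqAle eq_sym sn0.
have H00 : 0 < H t x by exact: lt_le_trans Hhm.
set cm := Num.sqrt (g * hm); pose c0 := Num.sqrt (g * H t x).
have cm0 : 0 < cm by rewrite sqrtr_gt0 mulr_gt0.
have cm_c0 : cm <= c0 by rewrite ler_wsqrtr// ler_wpM2l// ltW.
have c00 : 0 < c0 by exact: lt_le_trans cm_c0.
have c02 : c0 ^+ 2 = g * H t x by rewrite sqr_sqrtr// mulr_ge0// ltW.
have e2 : e ^+ 2 = 1 by case: he => ->; rewrite ?sqrrN expr1n.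
have en : `|e| = 1 by case: he => ->; rewrite ?normrN normr1.
pose q := e * (g / c0).
pose Q := g / cm.
have Q0 : 0 <= Q by rewrite divr_ge0// ltW.
have qQ : `|q| <= Q.
  rewrite normrM en mul1r ger0_norm ?divr_ge0 ?(ltW g0) ?(ltW c00)//.
  by rewrite ler_wpM2l ?(ltW g0)// lef_pV2.
have qH : q * H t x = e * c0.
  have -> : H t x = c0 ^+ 2 / g by rewrite c02 mulrC mulKf// gt_eqF.
  by rewrite /q; field; rewrite !gt_eqF.
have q2H : q ^+ 2 * H t x = g.
  rewrite expr2 -mulrA qH /q (_ : _ * _ = e ^+ 2 * g); first by rewrite e2 mul1r.
  by field; rewrite gt_eqF.
set dl := `|char_speed e t x - sg|.
have dl0 : 0 <= dl by exact: normr_ge0.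
have Sg0 : 0 <= Sg by exact: le_trans sgS.
have D0 : 0 <= s * (1 + Sg) by rewrite mulr_ge0// addr_ge0.
pose C1 := L * (Q + 1) + L ^+ 2 * (1 + Sg) * (2 * Q + 1) + (Q + 1) * L ^+ 2.
pose u t x := q * H t x + V t x.
(* First for the linearised invariant, on a strip of width at most s lying on
   the side of the segment where there is room. *)
have lin : `|u t x - u (t - s) (x - s * sg)| <= (C1 * (dl + s)) * s.
  have [r0 [d [r00 r0s d1 [xr zr]]]] : exists r0 d : R, [/\ 0 < r0, r0 <= s, `|d| = 1 &
      0 <= x + d * r0 <= l /\ 0 <= x - s * sg + d * r0 <= l].
    case: inn => [[xl' zl']|[x0' z0']].
    - exists (Num.min s (Num.min (l - x) (l - (x - s * sg)))), 1; rewrite normr1.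
      rewrite !lt_min s0' !subr_gt0 xl' zl' !mul1r; split=> //.
        by rewrite ge_min lexx.
      have [m2 m3] : Num.min s (Num.min (l - x) (l - (x - s * sg))) <= l - x /\
          Num.min s (Num.min (l - x) (l - (x - s * sg))) <= l - (x - s * sg).
        by rewrite !ge_min !lexx !orbT.
      have m1 : 0 < Num.min s (Num.min (l - x) (l - (x - s * sg))).
        by rewrite !lt_min s0' !subr_gt0 xl' zl'.
      by move: xl zl => /andP[? _] /andP[? _]; split; lra.
    - exists (Num.min s (Num.min x (x - s * sg))), (- 1); rewrite normrN normr1.
      rewrite !lt_min s0' x0' z0' !mulN1r; split=> //.
        by rewrite ge_min lexx.
      have [m2 m3] : Num.min s (Num.min x (x - s * sg)) <= x /\
          Num.min s (Num.min x (x - s * sg)) <= x - s * sg.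
        by rewrite !ge_min !lexx !orbT.
      have m1 : 0 < Num.min s (Num.min x (x - s * sg)) by rewrite !lt_min s0' x0' z0'.
      by move: xl zl => /andP[_ ?] /andP[_ ?]; split; lra.
  have M0 : 0 <= M by exact: le_trans (HM 0 0).
  have half0 : (0 : R) <= 2^-1 by rewrite invr_ge0.
  have ML0 : 0 <= M * (L + L) by rewrite mulr_ge0// addr_ge0.
  have MM0 : 0 <= M * M by rewrite mulr_ge0.
  have gL0 : 0 <= g * L by rewrite mulr_ge0// ltW.
  have gM0 : 0 <= g * M by rewrite mulr_ge0// ltW.
  pose k := M * (L + L) + g * L + L.
  pose M' := M + M * M + g * M.
  have E2 : (fun t x => V t x ^+ 2 / 2 + g * H t x) =
      (fun t x => 2^-1 * (V t x * V t x) + g * H t x).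
    by apply/funext => ?; apply/funext => ?; rewrite expr2 mulrC.
  have k1 : lip2 k H by apply: lip2W HL; rewrite /k; lra.
  have k2 : lip2 k (fun t x => H t x * V t x).
    by apply: lip2W (lip2M HL VL HM VM); rewrite /k; lra.
  have k3 : lip2 k V by apply: lip2W VL; rewrite /k; lra.
  have k4 : lip2 k (fun t x => V t x ^+ 2 / 2 + g * H t x).
    rewrite E2; apply: lip2W (lip2D (lip2Z (2^-1) (lip2M VL VL VM VM)) (lip2Z g HL)).
    by rewrite /k !ger0_norm ?(ltW g0)//; lra.
  have b1 t' x' : `|H t' x'| <= M' by rewrite (le_trans (HM _ _))// /M'; lra.
  have b2 t' x' : `|H t' x' * V t' x'| <= M'.
    by rewrite normrM (@le_trans _ _ (M * M)) ?ler_pM// /M'; lra.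
  have b3 t' x' : `|V t' x'| <= M' by rewrite (le_trans (VM _ _))// /M'; lra.
  have b4 t' x' : `|V t' x' ^+ 2 / 2 + g * H t' x'| <= M'.
    rewrite (le_trans (ler_normD _ _))// !normrM (ger0_norm (ltW g0)) (ger0_norm half0).
    have h1 : `|V t' x'| * `|V t' x'| <= M * M by rewrite ler_pM.
    have h2 : g * `|H t' x'| <= g * M by rewrite ler_wpM2l// ltW.
    by rewrite /M'; lra.
  have := combined_transport (q := q) T0 l0 k1 k2 k3 k4 b1 b2 b3 b4 mass momentum
    ts0 s0 tT r00 d1 xl zl xr zr; apply.
  move=> tau r /andP[tau1 tau2] /andP[rr0 rr] y yl ydl /=.
  rewrite (linearised_flux (V t x) _ _ _ _ _ q2H).
  have near (h : R -> R -> R) : lip2 L h -> `|h t x - h tau y| <= L * (s * (1 + Sg)).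
    move=> hL; apply: (le_trans (hL _ _ _ _)); rewrite ler_wpM2l//.
    have e1 : `|t - tau| <= s by rewrite ger0_norm ?subr_ge0//; lra.
    rewrite (_ : x - y = (t - tau) * sg); last by rewrite /y; ring.
    by rewrite normrM mulrDr mulr1 lerD// ler_pM.
  have shift (h : R -> R -> R) : lip2 L h -> `|h tau (y + d * r) - h tau y| <= L * r.
    move=> hL; apply: (le_trans (hL _ _ _ _)).
    rewrite subrr normr0 add0r (_ : y + d * r - y = d * r); last by ring.
    by rewrite normrM d1 mul1r gtr0_norm.
  have dlE : `|sg - (V t x + q * H t x)| <= dl by rewrite qH distrC.
  apply: (le_trans (flux_bound qQ (shift _ HL) (shift _ VL) (near _ VL) (near _ HL) dlE)).
  have rs : r <= s by exact: le_trans r0s.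
  have q1 : 0 <= L * (Q + 1) by rewrite mulr_ge0// addr_ge0.
  have q2 : 0 <= L ^+ 2 * (1 + Sg) * (2 * Q + 1).
    by rewrite !mulr_ge0 ?sqr_ge0 ?addr_ge0// mulr_ge0.
  have q3 : 0 <= (Q + 1) * L ^+ 2 by rewrite mulr_ge0 ?sqr_ge0// addr_ge0.
  have p1 : 0 <= (L * (Q + 1) * s + L ^+ 2 * (1 + Sg) * (2 * Q + 1) * dl +
     (Q + 1) * L ^+ 2 * dl) * r.
    by rewrite mulr_ge0 ?(ltW rr0)// !addr_ge0// mulr_ge0.
  have p2 : 0 <= (Q + 1) * L ^+ 2 * (s - r) * r.
    by rewrite mulr_ge0 ?(ltW rr0)// mulr_ge0// subr_ge0.
  rewrite /C1; lra.
(* Then for the invariant itself: the error is (c0 - c1)^2 / c0, where c0 and c1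
   are the celerities at the two ends. *)
set z := x - s * sg in zl inn Hz0 lin *.
pose c1 := Num.sqrt (g * H (t - s) z).
have c10 : 0 <= c1 by exact: sqrtr_ge0.
have c12 : c1 ^+ 2 = g * H (t - s) z by rewrite sqr_sqrtr// mulr_ge0// ltW.
have Hd : `|H t x - H (t - s) z| <= L * (s * (1 + Sg)).
  apply: (le_trans (HL _ _ _ _)); rewrite ler_wpM2l//.
  rewrite (_ : t - (t - s) = s); last by ring.
  rewrite (_ : x - z = s * sg); last by rewrite /z; ring.
  by rewrite normrM ger0_norm// mulrDr mulr1 lerD2l ler_wpM2l.
have cd : `|c0 - c1| * c0 <= g * L * (1 + Sg) * s.
  have : `|c0 - c1| * (c0 + c1) <= g * (L * (s * (1 + Sg))).
    rewrite -[X in _ * X]ger0_norm ?addr_ge0 ?(ltW c00)// -normrM.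
    rewrite (_ : (c0 - c1) * (c0 + c1) = g * (H t x - H (t - s) z)).
      by rewrite normrM (gtr0_norm g0) ler_wpM2l// ltW.
    by rewrite mulrBr -c02 -c12; ring.
  have : 0 <= `|c0 - c1| * c1 by rewrite mulr_ge0.
  lra.
have quad : `|(c0 - c1) ^+ 2 / c0| <= (g * L * (1 + Sg)) ^+ 2 / cm ^+ 3 * (s * s).
  rewrite normrM normrX [`|c0^-1|]ger0_norm ?invr_ge0 ?(ltW c00)//.
  have -> : `|c0 - c1| ^+ 2 / c0 = (`|c0 - c1| * c0) ^+ 2 / c0 ^+ 3.
    by field; rewrite gt_eqF.
  rewrite (_ : _ * (s * s) = (g * L * (1 + Sg) * s) ^+ 2 / cm ^+ 3); last by ring.
  apply: ler_pM; rewrite ?sqr_ge0 ?invr_ge0 ?exprn_ge0 ?(ltW c00)//.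
    by rewrite ler_sqr ?nnegrE ?mulr_ge0 ?(ltW g0) ?(ltW c00) ?addr_ge0.
  by rewrite lef_pV2 ?posrE ?exprn_gt0// lerXn2r ?nnegrE ?(ltW cm0) ?(ltW c00).
have -> : riemann e t x - riemann e (t - s) z = (u t x - u (t - s) z) + e * ((c0 - c1) ^+ 2 / c0).
  rewrite /riemann /u -/c0 -/c1.
  have -> : H t x = c0 ^+ 2 / g by rewrite c02 mulrC mulKf// gt_eqF.
  have -> : H (t - s) z = c1 ^+ 2 / g by rewrite c12 mulrC mulKf// gt_eqF.
  by rewrite /q; field; rewrite !gt_eqF.
apply: (le_trans (ler_normD _ _)); rewrite normrM en mul1r.
apply: (le_trans (lerD lin quad)).
rewrite /char_const -/Q -/cm -/C1.
have : (g * L * (1 + Sg)) ^+ 2 / cm ^+ 3 * (s * s) <= (g * L * (1 + Sg)) ^+ 2 / cm ^+ 3 * (s * (dl + s)).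
  apply: ler_wpM2l; last by rewrite ler_wpM2l// lerDr.
  by rewrite divr_ge0 ?sqr_ge0// exprn_ge0// ltW.
rewrite -/C1; lra.
Qed.
End Shallow.
End WeakChar.

(** * Uniqueness from the characteristic estimate *)

Section Gronwall.
Context {R : realType}.

(** For the invariants of the shallow water equations, reflected so that both
    families travel to the right, this is the characteristic speed: the
    equilibrium speed plus 3/4 of the own invariant minus 1/4 of the other one. *)
Definition cspeed (kap : bool -> R) (l : R) (w : bool -> R -> R -> R) i t x :=
  kap i + (3 * w i t x - w (~~ i) t (l - x)) / 4.

(** The characteristic estimate on the time slab [ta, tb]. The slope sigma is
    arbitrary, so two families with different speeds can be compared along one
    and the same segment. *)
Definition char_on (kap : bool -> R) (l C Sg ta tb : R) (w : bool -> R -> R -> R) :=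
  forall i t s x sg, 0 <= s -> ta <= t - s -> t <= tb -> 0 < x < l ->
    0 <= x - s * sg < l -> 0 <= sg <= Sg ->
    `|w i t x - w i (t - s) (x - s * sg)| <=
      C * s * (`|cspeed kap l w i t x - sg| + s).

(** Go back from (t, x) by one time step, or up to the boundary x = 0, with the
    speed of w as slope. For w the error is O(s^2); for w' it is O(s) times the
    difference of the speeds, which is controlled by the differences of w and w'
    at x and at l - x. So the largest difference D obeys
    D(t + h) <= (1 + C h) D(t) + O(h^2), and iterating over the steps leaves
    O(h). *)
Lemma char_uniqueness (kap : bool -> R) (l C Sg c ta tb : R) (w w' : bool -> R -> R -> R) :
  0 < c -> 0 <= C -> ta <= tb ->
  char_on kap l C Sg ta tb w -> char_on kap l C Sg ta tb w' ->
  (forall i t x, ta <= t <= tb -> 0 < x < l ->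
     c <= cspeed kap l w i t x <= Sg /\ `|cspeed kap l w' i t x| <= Sg) ->
  (forall i t, ta <= t <= tb -> w i t 0 = w' i t 0) ->
  (forall i x, 0 < x < l -> w i ta x = w' i ta x) ->
  forall i t x, ta <= t <= tb -> 0 < x < l -> w i t x = w' i t x.
Proof.
move=> c0 C0 tab cw cw' sp bd ini i1 t1 x1 t1in x1in.
pose d i t x := `|w i t x - w' i t x|.
have Sg0 : 0 <= Sg.
  have [/andP[a b] _] := sp i1 _ _ t1in x1in.
  exact: le_trans (ltW c0) (le_trans a b).
pose E := 2 * (C * (Sg + 1)).
have E0 : 0 <= E by rewrite !mulr_ge0// addr_ge0.
pose B := 2 + E.
have B0 : 0 <= B by rewrite addr_ge0.
(* D bounds the differences over the whole channel, because the speed at x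
   involves the values at l - x. *)
have step (h D : R) t0 : 0 <= h -> h <= 1 -> 0 <= D -> ta <= t0 ->
    (forall i t x, ta <= t <= t0 -> t <= tb -> 0 < x < l -> d i t x <= D) ->
    forall i t x, ta <= t <= tb -> t <= t0 + h -> 0 < x < l ->
      d i t x <= (1 + C * h) * D + C * B * h ^+ 2.
  move=> h0 h1 D0 tat0 HD i t x /andP[tat ttb] tth xl.
  have [tt0|t0t] := leP t t0.
    apply: (@le_trans _ _ D); first by apply: HD => //; rewrite tat.
    by rewrite mulrDl mul1r -addrA lerDl addr_ge0// ?mulr_ge0 ?sqr_ge0.
  pose s := t - t0; have s0 : 0 <= s by rewrite subr_ge0 ltW.
  have sh : s <= h by rewrite lerBlDl.
  have tT : ta <= t <= tb by rewrite tat.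
  have t0E : t - s = t0 by rewrite /s; ring.
  (* Slope 0 in the estimates: w and w' at time t are O(h) away from their
     values at time t0. *)
  have dt j y : 0 < y < l -> d j t y <= D + E * h.
    move=> yl; have /andP[y0 yl'] := yl.
    have dd : d j t0 y <= D.
      by apply: HD => //; rewrite ?tat0 ?lexx// (le_trans (ltW t0t)).
    have [/andP[p1 p2] p3] := sp j _ _ tT yl.
    have yin : 0 <= y - s * 0 < l by rewrite mulr0 subr0 (ltW y0).
    have sg0 : 0 <= (0 : R) <= Sg by rewrite lexx.
    have ts : ta <= t - s by rewrite t0E.
    have := cw j t s y 0 s0 ts ttb yl yin sg0.
    have := cw' j t s y 0 s0 ts ttb yl yin sg0.
    rewrite mulr0 !subr0 t0E => q1 q2.
    have Cs : C * s <= C * h by rewrite ler_wpM2l.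
    have p4 : `|cspeed kap l w j t y| <= Sg by rewrite ger0_norm// (le_trans (ltW c0)).
    have q3 (a : R) : a <= Sg -> 0 <= a -> C * s * (a + s) <= C * h * (Sg + 1).
      move=> aS a0; apply: ler_pM Cs _; [exact: mulr_ge0|exact: addr_ge0|].
      by apply: lerD => //; exact: le_trans h1.
    have {q1} q1 := le_trans q1 (q3 _ p3 (normr_ge0 _)).
    have {q2} q2 := le_trans q2 (q3 _ p4 (normr_ge0 _)).
    rewrite /d (_ : w j t y - w' j t y = (w j t y - w j t0 y) +
       ((w j t0 y - w' j t0 y) - (w' j t y - w' j t0 y))); last by ring.
    apply: (le_trans (ler_normD _ _)); apply: (le_trans (lerD q2 (ler_normB _ _))).
    apply: (le_trans (lerD (lexx _) (lerD dd q1))).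
    by rewrite /E; lra.
  set sg := cspeed kap l w i t x.
  have [/andP[p1 p2] _] := sp i _ _ tT xl.
  have sg0 : 0 < sg by exact: lt_le_trans p1.
  have sgin : 0 <= sg <= Sg by rewrite (ltW sg0).
  have dsp : `|cspeed kap l w' i t x - sg| <= D + E * h.
    rewrite /sg /cspeed.
    have lx : 0 < l - x < l by lra.
    have := dt i x xl; have := dt (~~ i) (l - x) lx; rewrite /d.
    rewrite !ler_norml; lra.
  have foot s' : 0 <= s' <= s -> 0 <= x - s' * sg < l -> d i (t - s') (x - s' * sg) <= D ->
      d i t x <= (1 + C * h) * D + C * B * h ^+ 2.
    move=> /andP[s'0 s's] zl dz.
    have ts : ta <= t - s' by rewrite (le_trans tat0)// -t0E lerD2l lerN2.
    have := cw i t s' x sg s'0 ts ttb xl zl sgin.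
    have := cw' i t s' x sg s'0 ts ttb xl zl sgin.
    rewrite -/sg subrr normr0 add0r => q1 q2.
    have s'h : s' <= h by exact: le_trans sh.
    have {q1} q1 := le_trans q1 (ler_pM (mulr_ge0 C0 s'0) (addr_ge0 (normr_ge0 _) s'0)
      (ler_wpM2l C0 s'h) (lerD dsp s'h)).
    have {q2} q2 := le_trans q2 (ler_pM (mulr_ge0 C0 s'0) s'0 (ler_wpM2l C0 s'h) s'h).
    set z := x - s' * sg in dz q1 q2.
    rewrite /d (_ : w i t x - w' i t x = (w i t x - w i (t - s') z) +
       ((w i (t - s') z - w' i (t - s') z) - (w' i t x - w' i (t - s') z))); last by ring.
    apply: (le_trans (ler_normD _ _)); apply: (le_trans (lerD q2 (ler_normB _ _))).
    apply: (le_trans (lerD (lexx _) (lerD dz q1))).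
    by rewrite /B; lra.
  have /andP[x0 xl'] := xl.
  have dz0 t' : ta <= t' <= tb -> d i t' 0 <= D.
    by move=> tt; rewrite /d bd// subrr normr0.
  have [zge|zlt] := leP 0 (x - s * sg).
  - have ssg : 0 <= s * sg by rewrite mulr_ge0// ltW.
    apply: (foot s); rewrite ?s0 ?lexx//.
      by rewrite zge /=; lra.
    rewrite t0E; have [->|z0] := eqVneq (x - s * sg) 0.
      by apply: dz0; rewrite tat0 (le_trans (ltW t0t)).
    apply: HD; rewrite ?tat0 ?lexx// ?(le_trans (ltW t0t))//.
    by rewrite lt_neqAle eq_sym z0 zge/=; lra.
  - have s'E : x / sg * sg = x by rewrite divfK// gt_eqF.
    have s's : x / sg <= s by rewrite ler_pdivrMr//; lra.
    have s'0 : 0 <= x / sg by rewrite divr_ge0// ltW.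
    apply: (foot (x / sg)); rewrite ?s'E ?subrr.
    - by rewrite s'0.
    - by rewrite lexx (lt_trans x0).
    - apply: dz0; apply/andP; split; last by lra.
      by rewrite (le_trans tat0)// -t0E lerD2l lerN2.
have d_small n : (0 < n)%N -> tb - ta <= n%:R ->
    d i1 t1 x1 <= B * ((tb - ta) / n%:R) * expR (C * (tb - ta)).
  move=> n0 nT; have n0' : (0 : R) < n%:R by rewrite ltr0n.
  pose h := (tb - ta) / n%:R.
  have h0 : 0 <= h by rewrite divr_ge0 ?subr_ge0// ltW.
  have h1 : h <= 1 by rewrite ler_pdivrMr// mul1r.
  have q1 : 1 <= 1 + C * h by rewrite lerDl mulr_ge0.
  have iter m : forall i t x, ta <= t <= tb -> t <= ta + m%:R * h -> 0 < x < l ->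
      d i t x <= B * h * ((1 + C * h) ^+ m - 1).
    elim: m => [|m ih] i t x tT th xl.
      have -> : t = ta.
        by apply/eqP; rewrite eq_le; move: th tT; rewrite mul0r addr0 => -> /andP[->].
      by rewrite /d ini// subrr normr0 expr0 subrr mulr0.
    apply: le_trans (step h (B * h * ((1 + C * h) ^+ m - 1)) (ta + m%:R * h) _ _ _ _ _ i t x tT _ xl) _ => //.
    - by apply: mulr_ge0; [exact: mulr_ge0|rewrite subr_ge0 exprn_ege1].
    - by rewrite lerDl mulr_ge0// ler0n.
    - by move=> i' t' x' /andP[a b] c' xl'; apply: ih => //; rewrite a.
    - by move: th; rewrite -natr1; lra.
    - by rewrite (exprS (1 + C * h)); move: ((1 + C * h) ^+ m) => P; lra.
  have nh : n%:R * h = tb - ta by rewrite /h mulrC divfK// gt_eqF.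
  have := iter n i1 t1 x1 t1in; rewrite nh [ta + _]addrC subrK.
  have /andP[_ t1b] := t1in; move=> /(_ t1b x1in) /le_trans; apply.
  rewrite -/h; apply: ler_wpM2l; first exact: mulr_ge0.
  apply: (@le_trans _ _ ((1 + C * h) ^+ n)); first by rewrite gerBl.
  have -> : C * (tb - ta) = n%:R * (C * h) by rewrite -nh; ring.
  rewrite expRM_natl.
  by rewrite lerXn2r ?nnegrE ?expR_ge0 ?expR_ge1Dx// (le_trans _ q1).
have dz : d i1 t1 x1 <= 0.
  apply/ler_addgt0Pr => e e0; rewrite add0r.
  pose X := B * (tb - ta) * expR (C * (tb - ta)).
  have X0 : 0 <= X by rewrite !mulr_ge0 ?expR_ge0// subr_ge0.
  pose n := (Num.bound (X / e) + Num.bound (tb - ta)).+1.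
  have n1 : X / e <= n%:R.
    rewrite ltW// (lt_le_trans (archi_boundP _))// ?divr_ge0 ?(ltW e0)//.
    by rewrite ler_nat /n leqW// leq_addr.
  have n2 : tb - ta <= n%:R.
    rewrite ltW// (lt_le_trans (archi_boundP _))// ?subr_ge0//.
    by rewrite ler_nat /n leqW// leq_addl.
  apply: (le_trans (d_small n _ n2)) => //.
  have n0 : (0 : R) < n%:R by rewrite ltr0n.
  rewrite (_ : _ * _ = X / n%:R); last by rewrite /X; field; rewrite gt_eqF.
  by rewrite ler_pdivrMr// mulrC -ler_pdivrMr.
by apply/eqP; rewrite -subr_eq0 -normr_le0.
Qed.
End Gronwall.

(** * Existence for the characteristic estimate *)

Section Scheme.
Context {R : realType}.
Variables (kap : bool -> R) (l c Sg dl M0 M Lb ts T1 : R).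
Variables (al be : bool -> R -> R).
Hypotheses (l0 : 0 < l) (c0 : 0 < c) (dlc : dl <= c).
Hypotheses (kapc : forall i, 2 * c <= kap i) (kapS : forall i, kap i + c <= Sg).
Hypothesis al_dl : forall i x, 0 <= x <= l -> `|al i x| <= dl.
Hypothesis be_dl : forall i t, 0 <= t -> `|be i t| <= dl.
Hypotheses (M00 : 0 <= M0) (Lb0 : 0 <= Lb) (LbM0 : Lb <= c * M0).
Hypothesis al_lip : forall i x y, 0 <= x <= l -> 0 <= y <= l ->
  `|al i x - al i y| <= M0 * `|x - y|.
Hypothesis be_lip : forall i t s, 0 <= t -> 0 <= s -> `|be i t - be i s| <= Lb * `|t - s|.
Hypothesis compat : forall i, al i 0 = be i 0.
Hypotheses (ts0 : 0 <= ts) (be_ts : forall i t, ts <= t -> be i t = 0).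
Hypotheses (T1E : l / c + ts <= T1) (MT : M0 * expR (M * T1) <= M).

(** [cspeed] read on the profiles at one instant. *)
Definition profile_speed (w : bool -> R -> R) i x := kap i + (3 * w i x - w (~~ i) (l - x)) / 4.

(** The value carried to x at time t + h with velocity v: from the profile w at
    time t when the foot x - h v lies in the channel, otherwise from the boundary
    value at the instant t + h - x / v when the foot crossed x = 0. *)
Definition trace (w : bool -> R -> R) (h t : R) i x v :=
  if h * v <= x then w i (x - h * v) else be i (t + h - x / v).

(** The semi-Lagrangian scheme with step h: the velocity is frozen at the value
    it has at the arrival point at the beginning of the step. *)
Fixpoint scheme (h : R) (k : nat) : bool -> R -> R :=
  if k is k'.+1 then fun i x =>
    trace (scheme h k') h (k'%:R * h) i x (profile_speed (scheme h k') i x)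
  else al.

Lemma M_ge0 : 0 <= M.
Proof. by apply: le_trans MT; rewrite mulr_ge0 ?expR_ge0. Qed.

Lemma T1_ge0 : 0 <= T1.
Proof. by apply: le_trans T1E; rewrite addr_ge0// divr_ge0// ltW. Qed.

Lemma M0_le_M : M0 <= M.
Proof.
apply: le_trans MT; rewrite ler_peMr// -expR0 ler_expR.
by rewrite mulr_ge0 ?M_ge0 ?T1_ge0.
Qed.

Definition bounded_by (w : bool -> R -> R) := forall i x, 0 <= x <= l -> `|w i x| <= dl.
Definition lips (m : R) (w : bool -> R -> R) := forall i x y, 0 <= x <= l -> 0 <= y <= l ->
  `|w i x - w i y| <= m * `|x - y|.

Lemma gspeed_bounds w i x : bounded_by w -> 0 <= x <= l -> c <= profile_speed w i x <= Sg.
Proof.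
move=> bw xl; have lx : 0 <= l - x <= l by lra.
have := bw i _ xl; have := bw (~~ i) _ lx; rewrite !ler_norml => /andP[? ?] /andP[? ?].
have := kapc i; have := kapS i; have := dlc => ? ? ?.
by rewrite /profile_speed; lra.
Qed.

Lemma gspeed_lip m w i x y : lips m w -> 0 <= x <= l -> 0 <= y <= l ->
  `|profile_speed w i x - profile_speed w i y| <= m * `|x - y|.
Proof.
move=> lw xl yl.
have lx : 0 <= l - x <= l by lra.
have ly : 0 <= l - y <= l by lra.
have := lw i _ _ xl yl; have := lw (~~ i) _ _ lx ly.
rewrite (_ : l - x - (l - y) = - (x - y)) ?normrN; last by ring.
rewrite /profile_speed !ler_norml; lra.
Qed.

(** Inside the channel this is the Lipschitz continuity of w. When one foot, or
    both, fall outside, time along the boundary is converted into distance with a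
    speed at least c, and the data satisfy Lb <= c M0 <= c m. The alternative
    hypothesis on v' lets the comparison be made with an arbitrary slope as soon
    as its own foot is inside, as [scheme_step] needs. *)
Lemma trace_lip m w h t i x v x' v' : 0 <= h -> 0 <= t -> M0 <= m -> lips m w ->
  w i 0 = be i t -> c <= v -> c <= v' \/ h * v' <= x' ->
  0 <= v' -> 0 <= x <= l -> 0 <= x' <= l ->
  `|trace w h t i x v - trace w h t i x' v'| <= m * (`|x - x'| + h * `|v - v'|).
Proof.
move=> h0 t0 M0m lw wb cv cv' v'0 xl xl'.
have m0 : 0 <= m by exact: le_trans M0m.
have Lbm : Lb <= c * m by apply: (le_trans LbM0); rewrite ler_wpM2l// ltW.
have foot (y : R) u : 0 <= y <= l -> c <= u -> y < h * u ->
    0 <= h - y / u /\ `|be i (t + h - y / u) - be i t| <= m * (h * u - y).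
  move=> /andP[y0 _] cu yhu; have u0 : 0 < u by exact: lt_le_trans cu.
  have hy : 0 <= h - y / u by rewrite subr_ge0 ler_pdivrMr// ltW.
  split=> //; have th : 0 <= t + h - y / u by rewrite -addrA addr_ge0.
  apply: (le_trans (be_lip _ th t0)).
  rewrite (_ : t + h - y / u - t = h - y / u); last by ring.
  rewrite ger0_norm//.
  have -> : m * (h * u - y) = (u * m) * (h - y / u) by field; rewrite gt_eqF.
  by apply: ler_wpM2r => //; apply: (le_trans Lbm); apply: ler_wpM2r.
have hv0 : 0 <= h * v by rewrite mulr_ge0// (le_trans (ltW c0)).
have hv'0 : 0 <= h * v' by rewrite mulr_ge0.
have pd : `|(x - h * v) - (x' - h * v')| <= `|x - x'| + h * `|v - v'|.
  rewrite (_ : _ - _ - _ = (x - x') - h * (v - v')); last by ring.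
  by rewrite (le_trans (ler_normB _ _))// normrM (ger0_norm h0).
have zero : 0 <= (0 : R) <= l by rewrite lexx ltW.
have wz y : 0 <= y <= l -> `|w i y - be i t| <= m * y.
  move=> yl; rewrite -wb; apply: (le_trans (lw _ _ _ yl zero)).
  by rewrite subr0 ger0_norm//; case/andP: yl.
have big : m * `|(x - h * v) - (x' - h * v')| <= m * (`|x - x'| + h * `|v - v'|).
  exact: ler_wpM2l.
move: xl xl' => /andP[x0 xl] /andP[x0' xl'].
have xin : 0 <= x <= l by rewrite x0.
have x'in : 0 <= x' <= l by rewrite x0'.
rewrite /trace; case: (leP (h * v) x) => hx; case: (leP (h * v') x') => hx'.
- apply: le_trans big; apply: lw; lra.
- have cv'' : c <= v' by case: cv' => //; rewrite leNgt hx'.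
  have [_ f1] := foot _ _ x'in cv'' hx'.
  have f2 : `|w i (x - h * v) - be i t| <= m * (x - h * v).
    by apply: wz; lra.
  apply: le_trans big; rewrite [X in _ <= m * X]ger0_norm; last by lra.
  move: f1 f2; rewrite !ler_norml; lra.
- have [_ f1] := foot _ _ xin cv hx.
  have f2 : `|w i (x' - h * v') - be i t| <= m * (x' - h * v').
    by apply: wz; lra.
  apply: le_trans big; rewrite [X in _ <= m * X]ler0_norm; last by lra.
  move: f1 f2; rewrite !ler_norml; lra.
- have cv'' : c <= v' by case: cv' => //; rewrite leNgt hx'.
  have [f1 _] := foot _ _ xin cv hx; have [f2 _] := foot _ _ x'in cv'' hx'.
  have v0 : 0 < v by exact: lt_le_trans cv.
  have v'0' : 0 < v' by exact: lt_le_trans cv''.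
  have e1 : 0 <= t + h - x / v by rewrite -addrA addr_ge0.
  have e2 : 0 <= t + h - x' / v' by rewrite -addrA addr_ge0.
  apply: (le_trans (be_lip _ e1 e2)).
  rewrite (_ : _ - _ = - ((x - x') - x' / v' * (v - v')) / v); last by field; rewrite !gt_eqF.
  rewrite normrM normrN normfV (gtr0_norm v0) mulrA ler_pdivrMr//.
  have q1 : `|x - x' - x' / v' * (v - v')| <= `|x - x'| + h * `|v - v'|.
    rewrite (le_trans (ler_normB _ _))// lerD2l normrM ler_wpM2r//.
    by rewrite ger0_norm ?divr_ge0 ?(ltW v'0')//; lra.
  rewrite [leRHS]mulrAC; apply: ler_pM => //; apply: (le_trans Lbm).
  by rewrite mulrC; apply: ler_wpM2l.
Qed.

Lemma trace_bound w h t i x v : 0 <= h -> 0 <= t -> c <= v -> bounded_by w -> 0 <= x <= l ->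
  `|trace w h t i x v| <= dl.
Proof.
move=> h0 t0 cv bw xl; have v0 : 0 < v by exact: lt_le_trans cv.
have hv0 : 0 <= h * v by rewrite mulr_ge0// ltW.
move: xl => /andP[x0 xl]; rewrite /trace; case: (leP (h * v) x) => hx.
  by apply: (bw i); lra.
apply: be_dl; rewrite -addrA addr_ge0// subr_ge0 ler_pdivrMr//; exact: ltW.
Qed.

Section FixedStep.
Variable (h : R).
Hypotheses (h0 : 0 < h).
Local Notation w := (scheme h).

Lemma scheme_bounded k : bounded_by (w k).
Proof.
elim: k => [|k ih] i x xl /=; first exact: al_dl.
have /andP[v1 v2] := gspeed_bounds i ih xl.
by apply: trace_bound => //; rewrite ?mulr_ge0// ?ler0n ltW.
Qed.

Lemma scheme_speed k i x : 0 <= x <= l -> c <= profile_speed (w k) i x <= Sg.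
Proof. by apply: gspeed_bounds; exact: scheme_bounded. Qed.

Lemma scheme0 k i : w k i 0 = be i (k%:R * h).
Proof.
case: k => [|k]; first by rewrite mul0r /= compat.
have zero : 0 <= (0 : R) <= l by rewrite lexx ltW.
have /andP[v1 v2] := scheme_speed k i zero.
rewrite /= /trace leNgt mulr_gt0//=; last exact: lt_le_trans v1.
by rewrite mul0r subr0 -natr1; congr be; ring.
Qed.

(** The zero boundary values after time ts fill the channel at speed at least
    c. *)
Lemma scheme_vanish k i x : 0 <= x <= l -> x <= c * (k%:R * h - ts) -> w k i x = 0.
Proof.
elim: k i x => [|k ih] i x xl; have /andP[x0 x1] := xl.
  rewrite mul0r sub0r => xts.
  have ts00 : ts = 0.
    apply/eqP; rewrite eq_le ts0 andbT.
    have : 0 <= c * - ts by exact: le_trans xts.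
    by rewrite pmulr_rge0// oppr_ge0.
  have -> : x = 0 by apply/eqP; rewrite eq_le x0 andbT; move: xts; rewrite ts00 oppr0 mulr0.
  by rewrite /= compat be_ts// ts00.
move=> xk /=; have /andP[v1 v2] := scheme_speed k i xl.
set v := profile_speed _ _ _ in v1 v2 *.
have v0 : 0 < v by exact: lt_le_trans v1.
have hv : h * c <= h * v by rewrite ler_wpM2l// ltW.
have hv0 : 0 <= h * v by rewrite mulr_ge0// ltW.
move: xk; rewrite -natr1 => xk.
rewrite /trace; case: leP => hx.
  by apply: ih; [lra|lra].
apply: be_ts.
have : x / v <= k%:R * h + h - ts; last by lra.
rewrite ler_pdivrMr//; apply: (le_trans xk).
rewrite mulrC [leRHS](_ : _ = ((k%:R + 1) * h - ts) * v); last by ring.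
apply: ler_wpM2l => //.
have : 0 <= c * ((k%:R + 1) * h - ts) by exact: le_trans xk.
by rewrite pmulr_rge0.
Qed.

(** One step multiplies the Lipschitz constant m by 1 + h m, the feet of two
    points being spread by the speeds. The closing assumption on M bounds m by M
    up to time T1, so that the factor is at most 1 + h M. *)
Lemma scheme_lips_exp k : k%:R * h <= T1 -> lips (M0 * (1 + h * M) ^+ k) (w k).
Proof.
elim: k => [|k ih] kT i x y xl yl /=; first by rewrite expr0 mulr1; exact: al_lip.
have Mp := M_ge0.
have kT' : k%:R * h <= T1 by apply: le_trans kT; rewrite ler_pM2r// ler_nat.
set m := M0 * (1 + h * M) ^+ k.
have lw : lips m (w k) by exact: ih.
have q1 : 1 <= 1 + h * M by rewrite lerDl mulr_ge0// ltW.
have M0m : M0 <= m by rewrite /m ler_peMr// exprn_ege1.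
have mM : m <= M.
  apply: le_trans MT; apply: ler_wpM2l => //.
  apply: (@le_trans _ _ (expR (h * M) ^+ k)).
    by rewrite lerXn2r ?nnegrE ?expR_ge0 ?expR_ge1Dx// (le_trans _ q1).
  rewrite -expRM_natl ler_expR mulrA mulrC; exact: ler_wpM2l.
have /andP[v1 v2] := scheme_speed k i xl; have /andP[u1 u2] := scheme_speed k i yl.
have m0 : 0 <= m by exact: le_trans M0m.
apply: (le_trans (trace_lip (ltW h0) _ M0m lw (scheme0 k i) v1 (or_introl u1) _ xl yl)).
- by rewrite mulr_ge0// ltW.
- by rewrite (le_trans (ltW c0)).
have := gspeed_lip i lw xl yl => gl.
rewrite exprSr mulrA -/m -mulrA; apply: ler_wpM2l => //.
rewrite mulrDl mul1r lerD2l -mulrA; apply: ler_wpM2l; first exact: ltW.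
by apply: (le_trans gl); apply: ler_wpM2r.
Qed.

(** Up to time T1 the constant is that of [scheme_lips_exp]; afterwards the
    profiles vanish, so that M serves for all times. *)
Lemma scheme_lips k : lips M (w k).
Proof.
have [kT|kT] := leP (k%:R * h) T1.
  move=> i x y xl yl; apply: (le_trans (scheme_lips_exp kT i xl yl)); apply: ler_wpM2r => //.
  apply: le_trans MT; apply: ler_wpM2l => //.
  have Mp := M_ge0.
  apply: (@le_trans _ _ (expR (h * M) ^+ k)).
    rewrite lerXn2r ?nnegrE ?expR_ge0 ?expR_ge1Dx//.
    by rewrite addr_ge0// mulr_ge0// ltW.
  rewrite -expRM_natl ler_expR mulrA mulrC; exact: ler_wpM2l.
have wz i x : 0 <= x <= l -> w k i x = 0.
  move=> xl; apply: scheme_vanish => //; case/andP: xl => _ /le_trans; apply.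
  rewrite mulrC -ler_pdivrMr// lerBrDr (le_trans T1E)//; exact: ltW.
by move=> i x y xl yl; rewrite !wz// subrr normr0 mulr_ge0// M_ge0.
Qed.

Lemma scheme_step k i x sg : 0 <= x <= l -> 0 <= sg -> h * sg <= x ->
  `|w k.+1 i x - w k i (x - h * sg)| <= M * (h * `|profile_speed (w k) i x - sg|).
Proof.
move=> xl sg0 hsg; have /andP[v1 v2] := scheme_speed k i xl.
have k0 : 0 <= k%:R * h by rewrite mulr_ge0// ltW.
have := trace_lip (ltW h0) k0 M0_le_M (@scheme_lips k) (scheme0 k i) v1
  (or_intror hsg) sg0 xl xl.
by rewrite {2}/trace hsg subrr normr0 add0r.
Qed.

Lemma scheme_time k i x : 0 <= x <= l -> `|w k.+1 i x - w k i x| <= M * Sg * h.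
Proof.
move=> xl; have /andP[v1 v2] := scheme_speed k i xl; have /andP[x0 _] := xl.
have := @scheme_step k i x 0 xl (lexx 0); rewrite mulr0 !subr0 => /(_ x0) /le_trans; apply.
rewrite -mulrA; apply: ler_wpM2l; first exact: M_ge0.
rewrite mulrC ler_wpM2r ?(ltW h0)// ger0_norm//.
by rewrite (le_trans (ltW c0)).
Qed.

Lemma scheme_times k j i x : 0 <= x <= l -> `|w (k + j)%N i x - w k i x| <= M * Sg * (j%:R * h).
Proof.
move=> xl; elim: j => [|j ih]; first by rewrite addn0 subrr normr0 mul0r mulr0.
rewrite addnS (_ : _ - _ = (w (k + j).+1 i x - w (k + j)%N i x) + (w (k + j)%N i x - w k i x)); last by ring.
apply: (le_trans (ler_normD _ _)); apply: (le_trans (lerD (scheme_time _ _ xl) ih)).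
by rewrite -natr1; lra.
Qed.

(** Adding up [scheme_step] over m steps along the line of slope sigma. The
    speeds met on the way differ from the one at the end point by O(m h), since
    the profiles are Lipschitz in both variables. *)
Lemma scheme_char k m i x sg : (m <= k)%N -> 0 <= x <= l -> 0 <= sg <= Sg ->
  m%:R * h * sg <= x ->
  `|w k i x - w (k - m)%N i (x - m%:R * h * sg)| <=
    M * (m%:R * h) * (`|profile_speed (w k) i x - sg| + 2 * (M * Sg) * (m%:R * h)).
Proof.
move=> mk xl /andP[sg0 sgS] mx; have /andP[x0 x1] := xl; have Mp := M_ge0.
have Sg0 : 0 <= Sg by exact: le_trans sgS.
set A := `|profile_speed (w k) i x - sg|.
set B := A + 2 * (M * Sg) * (m%:R * h).
suff H j : (j <= m)%N -> `|w k i x - w (k - j)%N i (x - j%:R * h * sg)| <= M * (j%:R * h) * B.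
  exact: H.
elim: j => [_|j ih jm]; first by rewrite subn0 !mul0r subr0 subrr normr0 mulr0 mul0r.
have {ih} ih := ih (ltnW jm).
set z := x - j%:R * h * sg in ih.
have jk : (j < k)%N by exact: leq_trans mk.
have zz : x - j.+1%:R * h * sg = z - h * sg by rewrite /z -natr1; ring.
have jm' : j%:R <= m%:R :> R by rewrite ler_nat ltnW.
have jh : j%:R * h <= m%:R * h by rewrite ler_pM2r.
have j1h : j.+1%:R * h <= m%:R * h by rewrite ler_pM2r// ler_nat.
have j1s : j.+1%:R * h * sg <= m%:R * h * sg by rewrite ler_wpM2r.
have hz : h * sg <= z by rewrite -subr_ge0 -zz subr_ge0 (le_trans j1s).
have hs0 : 0 <= h * sg by rewrite mulr_ge0// ltW.
have jhs0 : 0 <= j%:R * h * sg by rewrite mulr_ge0// mulr_ge0// ltW.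
have zl : 0 <= z <= l by apply/andP; split; [exact: le_trans hz|rewrite /z; lra].
have := scheme_step (k - j.+1) i zl sg0 hz.
rewrite subnSK// => st.
have gd : `|profile_speed (w (k - j.+1)%N) i z - sg| <= B.
  have g1 : `|profile_speed (w (k - j.+1)%N) i z - profile_speed (w (k - j.+1)%N) i x| <= M * Sg * (m%:R * h).
    apply: (le_trans (gspeed_lip i (@scheme_lips _) zl xl)).
    rewrite (_ : z - x = - (j%:R * h * sg)) ?normrN ?ger0_norm//; last by rewrite /z; ring.
    rewrite -(mulrA M); apply: ler_wpM2l => //; rewrite [leLHS]mulrC.
    by apply: ler_pM => //; rewrite mulr_ge0// ltW.
  have g2 : `|profile_speed (w (k - j.+1)%N) i x - profile_speed (w k) i x| <= M * Sg * (m%:R * h).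
    have tw i' y : 0 <= y <= l -> `|w (k - j.+1)%N i' y - w k i' y| <= M * Sg * (m%:R * h).
      move=> yl; rewrite distrC -{1}(subnK jk).
      apply: (le_trans (scheme_times _ _ _ yl)).
      by rewrite ler_wpM2l// mulr_ge0.
    have lx : 0 <= l - x <= l by lra.
    have := tw i _ xl; have := tw (~~ i) _ lx.
    rewrite /profile_speed !ler_norml; lra.
  rewrite (_ : _ - sg = (profile_speed (w (k - j.+1)%N) i z - profile_speed (w (k - j.+1)%N) i x) +
    ((profile_speed (w (k - j.+1)%N) i x - profile_speed (w k) i x) + (profile_speed (w k) i x - sg))); last by ring.
  apply: (le_trans (ler_normD _ _)); apply: (le_trans (lerD g1 (ler_normD _ _))).
  by rewrite /B -/A; lra.
rewrite zz (_ : _ - _ = (w k i x - w (k - j)%N i z) + (w (k - j)%N i z - w (k - j.+1)%N i (z - h * sg))); last by ring.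
apply: (le_trans (ler_normD _ _)).
have st' := le_trans st (ler_wpM2l Mp (ler_wpM2l (ltW h0) gd)).
apply: (le_trans (lerD ih st')).
by rewrite -natr1; lra.
Qed.
End FixedStep.

Lemma ultra_fmap (X Y : Type) (F : set_system X) (f : X -> Y) :
  UltraFilter F -> UltraFilter (f @ F).
Proof.
move=> UF; split; first exact: fmap_proper_filter.
move=> G PG FG; apply/seteqP; split=> // A GA.
have [//|nA] := in_ultra_setVsetC (f @^-1` A) UF.
have GnA : G (~` A) by apply: FG.
have := @filterI _ G _ _ _ GA GnA; rewrite setICr => G0.
by exfalso; apply: (@filter_not_empty _ G PG); exact: G0.
Qed.

(** The limit of the schemes is taken along an ultrafilter: bounded values always
    converge, so no diagonal extraction is needed, and pointwise convergence is
    enough because all the properties kept are inequalities between finitely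
    many values. *)
Lemma char_existence : exists W : bool -> R -> R -> R,
  [/\ (forall i t x, 0 <= x <= l -> `|W i t x| <= dl),
   (forall i t s x y, 0 <= t -> 0 <= s -> 0 <= x <= l -> 0 <= y <= l ->
      `|W i t x - W i s y| <= M * (`|x - y| + Sg * `|t - s|)),
   (forall i x, 0 <= x <= l -> W i 0 x = al i x) /\ (forall i t, 0 <= t -> W i t 0 = be i t),
   (forall i t x, l / c + ts < t -> 0 <= x <= l -> W i t x = 0) &
   forall i t s x sg, 0 <= s -> s <= t -> 0 <= x <= l -> 0 <= x - s * sg ->
     0 <= sg <= Sg ->
     `|W i t x - W i (t - s) (x - s * sg)| <=
       M * (1 + 2 * M * Sg) * s * (`|cspeed kap l W i t x - sg| + s)].
Proof.
have [U [UU subU]] := @ultraFilterLemma nat \oo _.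
have PU : ProperFilter U := ultra_proper.
pose h (n : nat) : R := n.+1%:R^-1.
have h0 n : 0 < h n by rewrite invr_gt0.
pose st n t := Num.truncn (t / h n).
pose a i t x n := scheme (h n) (st n t) i x.
have stP n t : 0 <= t -> (st n t)%:R * h n <= t /\ t < (st n t)%:R * h n + h n.
  move=> t0; have := @Num.Theory.truncn_itv _ (t / h n).
  rewrite divr_ge0 ?(ltW (h0 n))// => /(_ isT) /andP[].
  rewrite ler_pdivlMr// ltr_pdivrMr// -/(st n t) => p1; rewrite -natr1 mulrDl mul1r => p2.
  by split.
pose W i t x := lim (a i t x @ U).
have cvW i t x : 0 <= x <= l -> a i t x @ U --> W i t x.
  move=> xl; have := @segment_compact R (- dl) dl; rewrite compact_ultra.
  move=> /(_ (a i t x @ U) (ultra_fmap _ UU)) [].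
    apply: (@filterE nat U _ (a i t x @^-1` `[- dl, dl])) => n /=.
    rewrite in_itv/= -ler_norml.
    exact: (scheme_bounded (h0 n) _ _ xl).
  by move=> p [_ /= cv]; rewrite /W (cvg_lim _ cv).
have ch : h n @[n --> U] --> (0 : R).
  by move=> A nA; apply: subU; exact: (@cvg_harmonic R).
have cvle (b : nat -> R) (e : nat -> R) (B E : R) : b @ U --> B -> e @ U --> E ->
    (\forall n \near U, `|b n| <= e n) -> `|B| <= E.
  by move=> cb ce; exact: ler_cvg_to (cvg_norm cb) ce.
have Mp := M_ge0.
have Sg0 : 0 <= Sg.
  by have := kapc true; have := kapS true; have := c0; lra.
have ltime n i t s x : 0 <= s -> s <= t -> 0 <= x <= l ->
    `|a i t x n - a i s x n| <= M * Sg * (t - s + h n).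
  move=> s0 st' xl; have t0 : 0 <= t by exact: le_trans st'.
  have [p1 p2] := stP n _ s0; have [q1 q2] := stP n _ t0.
  have kk : (st n s <= st n t)%N.
    rewrite -ltnS -(ltr_nat R) -(ltr_pM2r (h0 n)) (le_lt_trans p1)// (le_lt_trans st')//.
    by rewrite -natr1 mulrDl mul1r.
  rewrite /a -{1}(subnKC kk).
  apply: (le_trans (scheme_times (h0 n) _ _ _ xl)); apply: ler_wpM2l.
    by rewrite mulr_ge0 ?M_ge0.
  rewrite natrB// mulrBl; lra.
exists W; split.
- move=> i t x xl; apply: (cvle (a i t x) (fun=> dl)) => //; first exact: cvW.
    exact: cvg_cst.
  by apply: nearW => n; exact: (scheme_bounded (h0 n) _ _ xl).
- move=> i t s x y t0 s0 xl yl.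
  wlog st' : t s x y t0 s0 xl yl / s <= t => [hw|].
    have [st'|/ltW st'] := leP s t; first exact: hw.
    by rewrite distrC [`|x - y|]distrC [`|t - s|]distrC; exact: hw.
  apply: (cvle (fun n => a i t x n - a i s y n)
    (fun n => M * `|x - y| + M * Sg * (t - s + h n))).
  + by apply: cvgB; exact: cvW.
  + rewrite (_ : M * (_ + _) = M * `|x - y| + M * Sg * (t - s + 0)); last first.
      by rewrite addr0 [`|t - s|]ger0_norm ?subr_ge0//; ring.
    apply: cvgD; first exact: cvg_cst.
    by apply: cvgM; [exact: cvg_cst|apply: cvgD; [exact: cvg_cst|exact: ch]].
  + apply: nearW => n.
    rewrite (_ : _ - _ = (a i s x n - a i s y n) + (a i t x n - a i s x n)); last by ring.
    apply: (le_trans (ler_normD _ _)); apply: lerD; last exact: ltime.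
    have H : lips M (scheme (h n) (st n s)) by exact: scheme_lips.
    exact: H.
- split=> [i x xl|i t t0].
    rewrite /W; apply/cvg_lim => //; rewrite (_ : a i 0 x = fun=> al i x); first exact: cvg_cst.
    by apply/funext => n; rewrite /a /st mul0r Num.Theory.truncn0.
  apply/eqP; rewrite -subr_eq0 -normr_le0.
  have zl : 0 <= (0 : R) <= l by rewrite lexx ltW.
  apply: (cvle (fun n => a i t 0 n - be i t) (fun n => Lb * h n)).
  + by apply: cvgB; [exact: cvW|exact: cvg_cst].
  + by rewrite -[X in _ --> X](mulr0 Lb); apply: cvgM; [exact: cvg_cst|exact: ch].
  + apply: nearW => n; rewrite /a scheme0//.
    have [p1 p2] := stP n _ t0.
    apply: (le_trans (be_lip _ _ t0)); first by rewrite mulr_ge0// ltW.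
    by apply: ler_wpM2l => //; rewrite ler0_norm; lra.
- move=> i t x tl xl; apply/eqP; rewrite -normr_le0.
  apply: (cvle (a i t x) (fun=> 0)); [exact: cvW|exact: cvg_cst|].
  have t0 : 0 <= t.
    by rewrite (le_trans _ (ltW tl))// addr_ge0// divr_ge0// ltW.
  near=> n.
  have hn : h n < t - (l / c + ts) by near: n; apply: (cvgr_lt _ ch); rewrite subr_gt0.
  rewrite /a scheme_vanish ?normr0//.
  have [p1 p2] := stP n _ t0.
  case/andP: xl => _ /le_trans; apply.
  rewrite mulrC -ler_pdivrMr//; lra.
- move=> i t s x sg s0 st' xl xs /andP[sg0 sgS].
  have t0 : 0 <= t by exact: le_trans st'.
  have ts0' : 0 <= t - s by rewrite subr_ge0.
  have lx : 0 <= l - x <= l by lra.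
  have ssg : 0 <= s * sg by rewrite mulr_ge0.
  have zl : 0 <= x - s * sg <= l by lra.
  apply: (@le_trans _ _ (M * s * (`|cspeed kap l W i t x - sg| + 2 * (M * Sg) * s) + 3 * (M * Sg) * 0)).
    apply: (cvle (fun n => a i t x n - a i (t - s) (x - s * sg) n)
      (fun n => M * s * (`|kap i + (3 * a i t x n - a (~~ i) t (l - x) n) / 4 - sg| +
         2 * (M * Sg) * s) + 3 * (M * Sg) * h n)).
    + by apply: cvgB; exact: cvW.
    + apply: cvgD; last by apply: cvgM; [exact: cvg_cst|exact: ch].
      apply: cvgM; first exact: cvg_cst.
      apply: cvgD; last exact: cvg_cst.
      apply: cvg_norm; apply: cvgB; last exact: cvg_cst.
      apply: cvgD; first exact: cvg_cst.
      apply: cvgM; last exact: cvg_cst.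
      apply: cvgB; last exact: cvW.
      by apply: cvgM; [exact: cvg_cst|exact: cvW].
    + apply: nearW => n.
      have [p1 p2] := stP n _ s0; have [q1 q2] := stP n _ t0; have [r1 r2] := stP n _ ts0'.
      set k := st n t in q1 q2 *; set m := st n s in p1 p2 *; set k' := st n (t - s) in r1 r2 *.
      have mk : (m <= k)%N.
        rewrite -ltnS -(ltr_nat R) -(ltr_pM2r (h0 n)) (le_lt_trans p1)// (le_lt_trans st')//.
        by rewrite -natr1 mulrDl mul1r.
      have hn := ltW (h0 n).
      have mh0 : 0 <= m%:R * h n by rewrite mulr_ge0.
      have msg : m%:R * h n * sg <= s * sg by rewrite ler_wpM2r.
      have mx : m%:R * h n * sg <= x by lra.
      have msg0 : 0 <= m%:R * h n * sg by rewrite mulr_ge0.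
      have yl : 0 <= x - m%:R * h n * sg <= l by lra.
      have sgin : 0 <= sg <= Sg by rewrite sg0.
      have e1 := scheme_char (h0 n) i mk xl sgin mx.
      have e2 : `|scheme (h n) (k - m) i (x - m%:R * h n * sg) - scheme (h n) (k - m) i (x - s * sg)|
          <= M * Sg * h n.
        have H : lips M (scheme (h n) (k - m)) by exact: scheme_lips.
        apply: (le_trans (H i _ _ yl zl)).
        rewrite (_ : _ - _ - _ = (s - m%:R * h n) * sg); last by ring.
        rewrite -mulrA; apply: ler_wpM2l => //.
        rewrite normrM (ger0_norm sg0) mulrC; apply: ler_pM => //.
        by rewrite ger0_norm; lra.
      have e3 : `|scheme (h n) (k - m) i (x - s * sg) - scheme (h n) k' i (x - s * sg)|
          <= M * Sg * (2 * h n).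
        have kmE : (k - m)%:R * h n = k%:R * h n - m%:R * h n by rewrite natrB// mulrBl.
        have MS0 : 0 <= M * Sg by rewrite mulr_ge0.
        have [kk|/ltnW kk] := leqP k' (k - m).
          rewrite -{1}(subnKC kk); apply: (le_trans (scheme_times (h0 n) _ _ _ zl)).
          by apply: ler_wpM2l => //; rewrite natrB// mulrBl kmE; lra.
        rewrite distrC -{1}(subnKC kk); apply: (le_trans (scheme_times (h0 n) _ _ _ zl)).
        by apply: ler_wpM2l => //; rewrite natrB// mulrBl kmE; lra.
      have e1' : M * (m%:R * h n) * (`|profile_speed (scheme (h n) k) i x - sg| + 2 * (M * Sg) * (m%:R * h n))
         <= M * s * (`|profile_speed (scheme (h n) k) i x - sg| + 2 * (M * Sg) * s).
        have b0 : 0 <= 2 * (M * Sg) by rewrite !mulr_ge0.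
        apply: ler_pM; rewrite ?mulr_ge0 ?addr_ge0 ?mulr_ge0//; first exact: ler_wpM2l.
        by rewrite lerD2l ler_wpM2l.
      rewrite /a -/k -/k'.
      rewrite (_ : scheme (h n) k i x - _ = (scheme (h n) k i x - scheme (h n) (k - m) i (x - m%:R * h n * sg)) +
        ((scheme (h n) (k - m) i (x - m%:R * h n * sg) - scheme (h n) (k - m) i (x - s * sg)) +
         (scheme (h n) (k - m) i (x - s * sg) - scheme (h n) k' i (x - s * sg)))); last by ring.
      apply: (le_trans (ler_normD _ _)); apply: (le_trans (lerD (le_trans e1 e1') (ler_normD _ _))).
      apply: (le_trans (lerD (lexx _) (lerD e2 e3))).
      by rewrite -[kap i + _]/(profile_speed (scheme (h n) k) i x); lra.
  rewrite mulr0 addr0.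
  set A := `|_|; have A0 : 0 <= A by exact: normr_ge0.
  have : 0 <= M * s * (2 * (M * Sg) * A) by rewrite !mulr_ge0.
  have : 0 <= M * s * s by rewrite !mulr_ge0.
  lra.
Unshelve. all: by end_near. Qed.
End Scheme.

(** * Weak solutions from equations holding almost everywhere *)

Section WeakOfPointwise.
Context {R : realType}.
Local Notation mu := (@lebesgue_measure R).
Local Notation Int a b h := (\int[mu]_(x in `[a, b]) h x)%R.

(** Difference quotients are taken along the increments r/(n+1) only, which is
    what dominated convergence needs. *)
Lemma cvg_is_derive_seq (f : R -> R) (x d : R) : is_derive x (1 : R) f d ->
  forall r : R, n.+1%:R * (f (x + r / n.+1%:R) - f x) @[n --> \oo] --> r * d.
Proof.
move=> df r.
have [->|r0] := eqVneq r 0.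
  apply: cvg_near_cst; apply: nearW => n.
  by rewrite mul0r addr0 subrr mulr0 mul0r.
have cv : h^-1 *: (f (h *: 1 + x) - f x) @[h --> 0^'] --> d.
  by rewrite -(derive_val (is_derive := df)); exact: ex_derive.
have cr : r / n.+1%:R @[n --> \oo] --> (0 : R)^'.
  move=> A [e /= e0 eA].
  have cz : r / n.+1%:R @[n --> \oo] --> (0 : R).
    by rewrite -[X in _ --> X](mulr0 r); apply: cvgM; [exact: cvg_cst|exact: cvg_harmonic].
  have hb : \forall n \near \oo, ball (0 : R) e (r / n.+1%:R).
    exact: cz _ (nbhsx_ballx 0 e e0).
  suff : \forall n \near \oo, A (r / n.+1%:R) by [].
  move: hb; apply: filterS => n hn; apply: eA => //.
  by apply: mulf_neq0 => //; rewrite invr_neq0// pnatr_eq0.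
have := cvg_comp _ _ cr cv => c.
have -> : (fun n : nat => n.+1%:R * (f (x + r / n.+1%:R) - f x)) =
  (fun n : nat => r * ((r / n.+1%:R)^-1 *: (f ((r / n.+1%:R) *: 1 + x) - f x))).
  apply/funext => n; rewrite -[_ *: 1]/(_ * 1) mulr1 -[_ *: _]/(_ * _) [_ / _ + x]addrC.
  have nn0 : n.+1%:R != 0 :> R by rewrite pnatr_eq0.
  by move: (n.+1%:R) nn0 => N N0; field; rewrite r0 N0.
by apply: cvgM; [exact: cvg_cst|exact: c].
Qed.

Section TestFunction.
Variables (T l : R) (phi : R * R -> R).
Hypothesis phiT : test_function T l phi.

Lemma test_diff p : differentiable phi p.
Proof. by case: phiT => /(_ [::] p). Qed.

Lemma test_derive_continuous v : continuous (fun p => derive phi p v).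
Proof.
move=> p; apply: differentiable_continuous.
by case: phiT => /(_ [:: v] p).
Qed.

Lemma test_out p : ~ (`]0, T[ `*` `]0, l[)%classic p -> phi p = 0.
Proof.
case: phiT => _ _ sub np; apply: contrapT => /eqP phip; apply: np; apply: sub.
exact: subset_closure.
Qed.

(** A test function and its derivatives vanish off a compact set. *)
Lemma test_bounded : exists2 B : R, 0 <= B &
  forall p, [/\ `|phi p| <= B, `|derive phi p (1, 0)| <= B & `|derive phi p (0, 1)| <= B].
Proof.
have cphi : continuous phi by move=> p; exact/differentiable_continuous/test_diff.
case: phiT => _ cK _; set K := closure _ in cK.
have aux (f : R * R -> R) : continuous f -> (forall p, ~ K p -> f p = 0) ->
    exists2 B, 0 <= B & forall p, `|f p| <= B.
  move=> cf f0.
  have /compact_bounded[B [_ HB]] : compact (f @` K).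
    by apply: continuous_compact => //; exact: continuous_subspaceT.
  exists (`|B| + 1); first by rewrite addr_ge0.
  move=> p; have [Kp|nKp] := pselect (K p); last by rewrite f0// normr0 addr_ge0.
  apply: (HB (`|B| + 1)); last by exists p.
  by rewrite (le_lt_trans (ler_norm _))// ltrDl.
have near0 p : ~ K p -> \forall q \near p, phi q = 0.
  move=> nKp; have oK : open (~` K) by apply: closed_openC; exact: closed_closure.
  have := open_nbhs_nbhs (conj oK nKp); apply: filterS => q nKq.
  by apply: contrapT => /eqP h; apply: nKq; exact: subset_closure.
have d0 v p : ~ K p -> derive phi p v = 0.
  move=> /near0 h; rewrite (near_eq_derive (g := cst 0))//.
  by rewrite derive_cst.
have [B1 B10 H1] := aux phi cphi (fun p nK => nbhs_singleton (near0 p nK)).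
have [B2 B20 H2] := aux _ (test_derive_continuous (v := (1, 0))) (d0 (1, 0)).
have [B3 B30 H3] := aux _ (test_derive_continuous (v := (0, 1))) (d0 (0, 1)).
exists (B1 + B2 + B3); first by rewrite !addr_ge0.
move=> p; split.
- by rewrite (le_trans (H1 p))// -addrA lerDl addr_ge0.
- by rewrite (le_trans (H2 p))// addrAC lerDr addr_ge0.
- by rewrite (le_trans (H3 p))// lerDr addr_ge0.
Qed.
End TestFunction.

(** Let K(t) be the integral of u phi over the channel. It is Lipschitz, and
    wherever it is differentiable its derivative is the integral of
    u phi_t - f_x phi, by dominated convergence of the forward difference
    quotients; integrating by parts in x this is the integral of
    u phi_t + f phi_x. Integrating over time gives K(T) - K(0) = 0. Only forward
    quotients of u are required, at almost every x for each t. *)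
Lemma weak_of_pointwise (T l k M : R) (u f : R -> R -> R) : 0 < T -> 0 < l ->
  lip2 k u -> lip2 k f -> (forall t x, `|u t x| <= M) -> (forall t x, `|f t x| <= M) ->
  (forall t, 0 < t < T -> {ae mu, forall x, 0 < x < l ->
     exists2 d, is_derive x (1 : R) (f t) d &
       n.+1%:R * (u (t + n.+1%:R^-1) x - u t x) @[n --> \oo] --> - d}) ->
  conservation_law T l u f.
Proof.
move=> T0 l0 uk fk uM fM uf phi phiT.
have k0 := lip2_ge0 uk.
have M0 : 0 <= M by exact: le_trans (uM 0 0).
have [B B0 HB] := test_bounded phiT.
have dphi := test_diff phiT.
pose pt p := derive phi p (1, 0); pose px p := derive phi p (0, 1).
have cphi : continuous phi by move=> p; exact/differentiable_continuous.
have cpt : continuous pt := test_derive_continuous phiT (v := (1, 0)).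
have cpx : continuous px := test_derive_continuous phiT (v := (0, 1)).
have lt x t s : `|phi (t, x) - phi (s, x)| <= B * `|t - s|.
  apply: (@lipschitz_derive _ (fun t => phi (t, x)) (fun t => pt (t, x))) => r.
    exact: (is_derive_partial (dphi (r, x))).1.
  by have [_ h _] := HB (r, x); exact: h.
have lx t x y : `|phi (t, x) - phi (t, y)| <= B * `|x - y|.
  apply: (@lipschitz_derive _ (fun x => phi (t, x)) (fun x => px (t, x))) => r.
    exact: (is_derive_partial (dphi (t, r))).2.
  by have [] := HB (t, r).
have mphi t : measurable_fun [set: R] (fun x => phi (t, x)).
  by apply: continuous_measurable_fun; exact: lipschitz_continuous (lx t).
have mline (F : R * R -> R) t : continuous F -> measurable_fun [set: R] (fun x => F (t, x)).
  move=> cF; exact: (measurableT_comp (measurable_cont2 cF) (measurable_pair1 t)).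
pose K t := Int 0 l (fun x => u t x * phi (t, x)).
pose kap t := Int 0 l (fun x => u t x * pt (t, x) + f t x * px (t, x)).
have mu_ t : measurable_fun [set: R] (u t) by exact: lip2_measurable_x uk.
have mf_ t : measurable_fun [set: R] (f t) by exact: lip2_measurable_x fk.
have mK t : measurable_fun [set: R] (fun x => u t x * phi (t, x)) by exact: measurable_funM.
have bK t x : `|u t x * phi (t, x)| <= M * B.
  by rewrite normrM ler_pM//; have [] := HB (t, x).
have Kinc t s x : `|u t x * phi (t, x) - u s x * phi (s, x)| <= (M * B + k * B) * `|t - s|.
  rewrite (_ : _ - _ = u t x * (phi (t, x) - phi (s, x)) + (u t x - u s x) * phi (s, x)); last by ring.
  rewrite (le_trans (ler_normD _ _))// [leRHS]mulrDl !normrM lerD//.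
    by rewrite -mulrA ler_pM.
  rewrite mulrAC ler_pM//; last by have [] := HB (s, x).
  by have := uk t x s x; rewrite subrr normr0 addr0.
have Klip : forall t s, `|K t - K s| <= (M * B + k * B) * l * `|t - s|.
  exact: (@Int_param_lip _ l (M * B + k * B) (M * B) (fun t x => u t x * phi (t, x))).
have K0 t : ~ 0 < t < T -> K t = 0.
  move=> nt; rewrite /K (_ : (fun x => _) = cst 0); first by rewrite Rintegral_cst//= mul0r.
  apply/funext => x; rewrite (test_out phiT) ?mulr0//.
  by move=> [/= h _]; apply: nt; move: h; rewrite in_itv.
pose G (p : R * R) := u p.1 p.2 * pt p + f p.1 p.2 * px p.
have cG : continuous G.
  move=> p; apply: cvgD; apply: cvgM; [exact: (lip2_continuous k0 uk)|exact: cpt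
    |exact: (lip2_continuous k0 fk)|exact: cpx].
have bG p : `|G p| <= M * B + M * B.
  rewrite (le_trans (ler_normD _ _))// !normrM.
  by have [_ h1 h2] := HB p; rewrite lerD// ler_pM.
have MK0 : 0 <= (M * B + k * B) * l by rewrite mulr_ge0 ?addr_ge0 ?mulr_ge0// ltW.
have [g [mg gk dg _]] := lipschitz_ae_derivative T0 MK0 Klip.
have key (t : R) : 0 < t < T -> is_derive t (1 : R) K (g t) -> g t = kap t.
  move=> tT dK; have tT' := tT.
  have c1 := cvg_is_derive_seq dK (r := 1); rewrite mul1r in c1.
  have fl : forall x y, `|f t x - f t y| <= k * `|x - y|.
    by move=> x y; have := fk t x t y; rewrite subrr normr0 add0r.
  have [gf [mgf gfk dgf _]] := lipschitz_ae_derivative l0 k0 fl.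
  have c2 : n.+1%:R * (K (t + 1 / n.+1%:R) - K t) @[n --> \oo] -->
      Int 0 l (fun x => u t x * pt (t, x) - gf x * phi (t, x)).
    rewrite (_ : (fun n => _) = (fun n => Int 0 l (fun x => n.+1%:R *
       (u (t + 1 / n.+1%:R) x * phi (t + 1 / n.+1%:R, x) - u t x * phi (t, x))))); last first.
      apply/funext => n; rewrite RintegralZl//; last first.
        apply: (@bounded_integrable _ _ _ (M * B + M * B)); first exact: measurable_funB.
        by move=> x _; rewrite (le_trans (ler_normB _ _))// lerD.
      congr (_ * _); rewrite RintegralB//; exact: bounded_integrable (mK _) (fun x _ => bK _ x).
    apply: (@Int_dct _ _ _ (M * B + k * B)).
    - by move=> n; apply: measurable_funM; [exact: measurable_cst|exact: measurable_funB].
    - apply: measurable_funB; apply: measurable_funM;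
        [exact: mu_|exact: mline cpt|exact: mgf|exact: mphi].
    - move=> n x _; rewrite normrM ger0_norm// mulrC -ler_pdivlMr// (le_trans (Kinc _ _ _))//.
      rewrite ler_wpM2l ?addr_ge0 ?mulr_ge0//.
      by rewrite (_ : _ - t = n.+1%:R^-1) ?ger0_norm//; rewrite mul1r; ring.
    - apply: filterS2 (uf t tT) dgf => x h1 h2 xl.
      have [d dd cu] := h1 xl.
      have dE : d = gf x by rewrite -(derive_val (is_derive := dd)) (derive_val (is_derive := h2 xl)).
      have cp := cvg_is_derive_seq (is_derive_partial (dphi (t, x))).1 (r := 1).
      have cu1 : u (t + 1 / n.+1%:R) x @[n --> \oo] --> u t x.
        have ct : t + 1 / n.+1%:R @[n --> \oo] --> t.
          rewrite -[X in _ --> X]addr0; apply: cvgD; first exact: cvg_cst.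
          rewrite -[X in _ --> X](mulr0 1); apply: cvgM; [exact: cvg_cst|exact: cvg_harmonic].
        have cux : continuous (u ^~ x).
          apply: (@lipschitz_continuous _ _ k) => a b.
          by have := uk a x b x; rewrite subrr normr0 addr0.
        exact: cvg_comp _ _ ct (cux t).
      have c := cvgD (cvgM cu1 cp) (cvgM cu (cvg_cst (phi (t, x)))).
      rewrite (_ : u t x * pt (t, x) - gf x * phi (t, x) =
        u t x * (1 * derive phi (t, x) (1, 0)) + - d * phi (t, x)); last first.
        by rewrite dE /pt; ring.
      rewrite (_ : (fun n : nat => _) = (fun n : nat => u (t + 1 / n.+1%:R) x *
        (n.+1%:R * (phi (t + 1 / n.+1%:R, x) - phi (t, x))) +
        (n.+1%:R * (u (t + n.+1%:R^-1) x - u t x)) * phi (t, x))); first exact: c.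
      by apply/funext => n; rewrite !div1r; ring.
  have -> : g t = Int 0 l (fun x => u t x * pt (t, x) - gf x * phi (t, x)).
    by rewrite -(cvg_lim _ c1)// (cvg_lim _ c2).
  have parts : Int 0 l (fun x => gf x * phi (t, x) + f t x * px (t, x)) = 0.
    have mpar : measurable_fun [set: R] (fun x => gf x * phi (t, x) + f t x * px (t, x)).
      by apply: measurable_funD; apply: measurable_funM => //; exact: mline.
    have lpar x y : `|f t x * phi (t, x) - f t y * phi (t, y)| <= (k * B + M * B) * `|x - y|.
      rewrite (_ : _ - _ = (f t x - f t y) * phi (t, x) + f t y * (phi (t, x) - phi (t, y))); last by ring.
      rewrite (le_trans (ler_normD _ _))// [leRHS]mulrDl !normrM lerD//.
        by rewrite mulrAC ler_pM//; have [] := HB (t, x).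
      by rewrite -mulrA ler_pM.
    rewrite (Int_derive (ltW l0) lpar mpar).
      rewrite !(test_out phiT) ?mulr0 ?subrr// => -[_ /=]; rewrite in_itv/= ?ltxx//.
      by rewrite andbF.
    move: dgf; apply: filterS => x h /h df.
    apply: is_derive_eq (is_deriveM df (is_derive_partial (dphi (t, x))).2) _.
    by rewrite -![_ *: _]/(_ * _) /px; ring.
  transitivity (Int 0 l (fun x => u t x * pt (t, x) - gf x * phi (t, x)) +
      Int 0 l (fun x => gf x * phi (t, x) + f t x * px (t, x))).
    by rewrite parts addr0.
  rewrite -RintegralD//; last 2 first.
  - apply: (@bounded_integrable _ _ _ (M * B + k * B)).
      apply: measurable_funB; apply: measurable_funM;
        [exact: mu_|exact: mline cpt|exact: mgf|exact: mphi].
    move=> x _; rewrite (le_trans (ler_normB _ _))// !normrM.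
    by have [h1 h2 _] := HB (t, x); rewrite lerD// ler_pM.
  - apply: (@bounded_integrable _ _ _ (k * B + M * B)).
      by apply: measurable_funD; apply: measurable_funM => //; exact: mline.
    move=> x _; rewrite (le_trans (ler_normD _ _))// !normrM.
    by have [h1 _ h2] := HB (t, x); rewrite lerD// ler_pM.
  by rewrite /kap; apply: eq_Rintegral => x _; ring.
rewrite (@Fubini_rect _ _ _ (M * B + M * B) G)//.
congr EFin; rewrite -[LHS]/(Int 0 T kap).
have mkap : measurable_fun [set: R] kap by exact: measurable_Int2 cG bG.
rewrite (Int_derive (ltW T0) Klip mkap); last first.
  move: dg; apply: filterS => t h tT.
  by rewrite -(key t tT (h tT)); exact: h.
by rewrite !K0 ?subrr// ltxx// andbF.
Qed.
End WeakOfPointwise.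

(** * Depth and velocity recovered from the invariants *)

Section FromInvariants.
Context {R : realType}.
Local Notation mu := (@lebesgue_measure R).
Variables (g Hs Vs l dl m Sg C : R) (W : bool -> R -> R -> R).
Let S := Num.sqrt (g * Hs).
(** The speeds of the two families at equilibrium, both counted positively. *)
Definition rest_speed (g Hs Vs : R) (i : bool) : R :=
  if i then Num.sqrt (g * Hs) + Vs else Num.sqrt (g * Hs) - Vs.
Local Notation kap := (rest_speed g Hs Vs).
Hypotheses (g0 : 0 < g) (l0 : 0 < l) (m0 : 0 <= m) (C0 : 0 <= C).
Hypothesis Wdl : forall i t x, 0 <= x <= l -> `|W i t x| <= dl.
Hypothesis Wlip : forall i t s x y, 0 <= t -> 0 <= s -> 0 <= x <= l -> 0 <= y <= l ->
      `|W i t x - W i s y| <= m * (`|t - s| + `|x - y|).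
Hypothesis Wsp : forall i t x, 0 <= t -> 0 <= x <= l -> 0 < cspeed kap l W i t x <= Sg.
Hypothesis Wchar : forall i t s x sg, 0 <= s -> s <= t -> 0 <= x <= l -> 0 <= x - s * sg ->
     0 <= sg <= Sg ->
     `|W i t x - W i (t - s) (x - s * sg)| <= C * s * (`|cspeed kap l W i t x - sg| + s).

(** The invariants a and b, with the reflection undone. Negative times and points
    outside the channel are sent to 0 and to the nearest end, so that the
    functions are Lipschitz on the plane. *)
Definition invA t x := W true (Num.max 0 t) (clamp l x).
Definition invB t x := - W false (Num.max 0 t) (l - clamp l x).
Definition celerity t x := S + (invA t x - invB t x) / 4.
Definition depth t x := celerity t x * celerity t x / g.
Definition velocity t x := Vs + (invA t x + invB t x) / 2.

Lemma ppos_lip (t s : R) : `|Num.max 0 t - Num.max 0 s| <= `|t - s|.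
Proof.
wlog ts : t s / s <= t => [hw|].
  by have [/hw//|/ltW/hw] := leP s t; rewrite distrC [`|t - s|]distrC.
rewrite [`|t - s|]ger0_norm ?subr_ge0// !maxEle.
by case: (leP 0 t) => ?; case: (leP 0 s) => ?; rewrite ger0_norm; lra.
Qed.

Lemma ppos_ge0 (t : R) : 0 <= Num.max 0 t. Proof. by rewrite le_max lexx. Qed.

Lemma reflect_in x : 0 <= x <= l -> 0 <= l - x <= l.
Proof. by move=> /andP[? ?]; lra. Qed.

Let l0' : 0 <= l := ltW l0.

Lemma invA_lip : lip2 m invA.
Proof.
move=> t x s y; apply: (le_trans (Wlip _ (ppos_ge0 t) (ppos_ge0 s) (clamp_in x l0') (clamp_in y l0'))).
by apply: ler_wpM2l => //; apply: lerD; [exact: ppos_lip|exact: clamp_lip].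
Qed.

Lemma invB_lip : lip2 m invB.
Proof.
move=> t x s y; rewrite /invB -opprD normrN.
apply: (le_trans (Wlip _ (ppos_ge0 t) (ppos_ge0 s) (reflect_in (clamp_in x l0')) (reflect_in (clamp_in y l0')))).
apply: ler_wpM2l => //; apply: lerD; first exact: ppos_lip.
rewrite (_ : l - clamp l x - (l - clamp l y) = - (clamp l x - clamp l y)) ?normrN; last by ring.
exact: clamp_lip.
Qed.

Lemma invA_le t x : `|invA t x| <= dl.
Proof. exact: Wdl (clamp_in x l0'). Qed.

Lemma invB_le t x : `|invB t x| <= dl.
Proof. by rewrite /invB normrN; exact: Wdl (reflect_in (clamp_in x l0')). Qed.

Lemma celerity_lip : lip2 m celerity.
Proof.
move=> t x s y; have := invA_lip t x s y; have := invB_lip t x s y.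
have : 0 <= m * (`|t - s| + `|x - y|) by rewrite mulr_ge0// addr_ge0.
rewrite /celerity !ler_norml => ? /andP[? ?] /andP[? ?]; lra.
Qed.

Lemma velocity_lip : lip2 m velocity.
Proof.
move=> t x s y; have := invA_lip t x s y; have := invB_lip t x s y.
rewrite /velocity !ler_norml; lra.
Qed.

Let M := `|S| + `|Vs| + dl.

Lemma celerity_le t x : `|celerity t x| <= M.
Proof.
have := invA_le t x; have := invB_le t x; have := normr_ge0 Vs; have := ler_norm S.
have := ler_norm (- S); rewrite normrN /celerity /M !ler_norml.
move=> ? ? ? /andP[? ?] /andP[? ?]; lra.
Qed.

Lemma velocity_le t x : `|velocity t x| <= M.
Proof.
have := invA_le t x; have := invB_le t x; have := normr_ge0 S; have := ler_norm Vs.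
have := ler_norm (- Vs); rewrite normrN /velocity /M !ler_norml.
move=> ? ? ? /andP[? ?] /andP[? ?]; lra.
Qed.

Lemma depth_lip : lip2 (M * (m + m) / g) depth.
Proof.
move=> t x s y; rewrite /depth -mulrBl normrM normfV (gtr0_norm g0).
rewrite [leRHS](_ : _ = M * (m + m) * (`|t - s| + `|x - y|) / g); last by ring.
rewrite ler_wpM2r ?invr_ge0 ?(ltW g0)//.
exact: (lip2M celerity_lip celerity_lip celerity_le celerity_le).
Qed.

Lemma depth_le t x : `|depth t x| <= M * M / g.
Proof.
rewrite /depth normrM normfV (gtr0_norm g0) ler_wpM2r ?invr_ge0 ?(ltW g0)//.
by rewrite normrM ler_pM// celerity_le.
Qed.

(** The characteristic estimate with the slope lambda frozen at (t, y) replaces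
    W(t + h, y) by W(t, y - h lambda) up to O(h^2); the difference quotient in
    time becomes one in space. *)
Lemma char_time_derivative i t y d : 0 < t -> 0 < y < l ->
  is_derive y (1 : R) (W i t) d ->
  n.+1%:R * (W i (t + n.+1%:R^-1) y - W i t y) @[n --> \oo] -->
    - cspeed kap l W i t y * d.
Proof.
move=> t0 yl dW; have /andP[y0 yl'] := yl.
have yin : 0 <= y <= l by rewrite !ltW.
set sg := cspeed _ _ _ _ _ _.
have /andP[sg0 sgS] := Wsp i (ltW t0) yin.
have c1 := cvg_is_derive_seq dW (r := - sg).
pose e n := n.+1%:R * (W i (t + n.+1%:R^-1) y - W i t (y + - sg / n.+1%:R)).
have ce : e n @[n --> \oo] --> (0 : R).
  have ch : C * (m + 1) * n.+1%:R^-1 @[n --> \oo] --> (0 : R).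
    by rewrite -[X in _ --> X](mulr0 (C * (m + 1))); apply: cvgM; [exact: cvg_cst|exact: cvg_harmonic].
  apply/norm_cvg0P; apply: (squeeze_cvgr _ (cvg_cst 0) ch).
  near=> n; rewrite normr_ge0 /=.
  have n0 : (0 : R) < n.+1%:R by rewrite ltr0n.
  set h := n.+1%:R^-1; have h0 : 0 < h by rewrite invr_gt0.
  have hn : n.+1%:R * h = 1 by rewrite mulfV// gt_eqF.
  have hs : h * sg <= y.
    rewrite mulrC ler_pdivrMr// -ler_pdivrMl//.
    apply: (@le_trans _ _ n%:R); last by rewrite ler_nat.
    by near: n; exact: nbhs_infty_ger.
  have hsp : `|cspeed kap l W i (t + h) y - sg| <= m * h.
    have h1 := Wlip i (addr_ge0 (ltW t0) (ltW h0)) (ltW t0) yin yin.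
    have h2 := Wlip (~~ i) (addr_ge0 (ltW t0) (ltW h0)) (ltW t0) (reflect_in yin) (reflect_in yin).
    move: h1 h2; rewrite !subrr !normr0 !addr0 (_ : t + h - t = h); last by ring.
    rewrite (gtr0_norm h0) /sg /cspeed !ler_norml; lra.
  have := @Wchar i (t + h) h y sg (ltW h0) _ yin _ _.
  rewrite lerDr (ltW t0) subr_ge0 hs (ltW sg0) sgS (_ : t + h - h = t); last by ring.
  move=> /(_ isT isT isT) q.
  rewrite /e normrM ger0_norm// (_ : y + - sg / n.+1%:R = y - h * sg); last by rewrite /h; ring.
  apply: (@le_trans _ _ (n.+1%:R * (C * h * (m * h + h)))); last first.
    rewrite (_ : n.+1%:R * (C * h * (m * h + h)) = n.+1%:R * h * (C * (m + 1) * h)); last by ring.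
    by rewrite hn mul1r.
  rewrite ler_wpM2l// (le_trans q)// ler_wpM2l ?lerD2r//.
  by rewrite mulr_ge0// ltW.
have c := cvgD ce c1; rewrite add0r in c.
have -> : (fun n : nat => n.+1%:R * (W i (t + n.+1%:R^-1) y - W i t y)) =
  (fun n : nat => e n + n.+1%:R * (W i t (y + - sg / n.+1%:R) - W i t y)); last exact: c.
by apply/funext => n; rewrite /e; ring.
Unshelve. all: by end_near. Qed.

(** For each t > 0 the space derivatives exist for almost every x, and the time
    derivatives to the right follow. *)
Lemma ae_reduced_system t : 0 < t -> {ae mu, forall x, 0 < x < l -> exists ax bx : R,
  [/\ is_derive x (1 : R) (invA t) ax, is_derive x (1 : R) (invB t) bx,
   n.+1%:R * (invA (t + n.+1%:R^-1) x - invA t x) @[n --> \oo] -->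
     - (velocity t x + celerity t x) * ax &
   n.+1%:R * (invB (t + n.+1%:R^-1) x - invB t x) @[n --> \oo] -->
     - (velocity t x - celerity t x) * bx]}.
Proof.
move=> t0.
have lA x y : `|invA t x - invA t y| <= m * `|x - y|.
  by have := invA_lip t x t y; rewrite subrr normr0 add0r.
have lB x y : `|invB t x - invB t y| <= m * `|x - y|.
  by have := invB_lip t x t y; rewrite subrr normr0 add0r.
have [gA [_ _ dA _]] := lipschitz_ae_derivative l0 m0 lA.
have [gB [_ _ dB _]] := lipschitz_ae_derivative l0 m0 lB.
apply: filterS2 dA dB => x dA dB xl; exists (gA x), (gB x).
have {}dA := dA xl; have {}dB := dB xl.
have t0' := ltW t0.
have pos n : Num.max 0 (t + n.+1%:R^-1 : R) = t + n.+1%:R^-1 by rewrite max_r// addr_ge0.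
have post : Num.max 0 t = t by rewrite max_r.
have xi : x \in `]0, l[ by rewrite in_itv.
have xl' : 0 <= x <= l by case/andP: xl => ? ?; rewrite !ltW.
have nx := near_in_itvoo xi.
have ylx : 0 < l - x < l by lra.
have dWA : is_derive x (1 : R) (W true t) (gA x).
  apply: near_eq_is_derive dA; apply: (@filterS _ (nbhs x) _ _ _ _ nx) => y.
  by rewrite in_itv/= => /andP[? ?]; rewrite /invA post clamp_id// !ltW.
have dWB : is_derive (l - x) (1 : R) (W false t) (gB x).
  have yi : l - x \in `]0, l[ by rewrite in_itv.
  have d1 : is_derive (l - x) (1 : R) (fun y : R => l - y) (-1).
    rewrite (_ : (fun _ => _) = cst l - id)//.
    by apply: is_derive_eq; rewrite sub0r.
  have dB' : is_derive (l - (l - x)) (1 : R) (invB t) (gB x).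
    by rewrite (_ : l - (l - x) = x)//; ring.
  have d2 := @is_derive1_comp _ (invB t) (fun y : R => l - y) (l - x) _ _ dB' d1.
  have d3 := is_deriveN d2.
  apply: (near_eq_is_derive (f := - (invB t \o (fun y => l - y)))); last first.
    by apply: is_derive_eq d3 _; ring.
  apply: (@filterS _ (nbhs (l - x)) _ _ _ _ (near_in_itvoo yi)) => y.
  rewrite in_itv/= => /andP[? ?]; rewrite fctE /= /invB post clamp_id ?opprK; first by congr W; ring.
  by lra.
split=> //.
- have c := char_time_derivative t0 xl dWA.
  rewrite (_ : - (velocity t x + celerity t x) * gA x = - cspeed kap l W true t x * gA x); last first.
    rewrite /velocity /celerity /cspeed /invA /invB post clamp_id//=; congr (- _ * _).
    by rewrite /S; field.
  have -> : (fun n : nat => n.+1%:R * (invA (t + n.+1%:R^-1) x - invA t x)) =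
    (fun n : nat => n.+1%:R * (W true (t + n.+1%:R^-1) x - W true t x)); last exact: c.
  by apply/funext => n; rewrite /invA pos post clamp_id.
- have c := cvgN (char_time_derivative t0 ylx dWB).
  rewrite (_ : - (velocity t x - celerity t x) * gB x = - (- cspeed kap l W false t (l - x) * gB x)); last first.
    rewrite /velocity /celerity /cspeed /invA /invB post clamp_id//=.
    by rewrite (_ : l - (l - x) = x); [rewrite /S; field|ring].
  have -> : (fun n : nat => n.+1%:R * (invB (t + n.+1%:R^-1) x - invB t x)) =
    (fun n : nat => - (n.+1%:R * (W false (t + n.+1%:R^-1) (l - x) - W false t (l - x)))); last exact: c.
  by apply/funext => n; rewrite /invB pos post clamp_id//; ring.
Qed.

(** The celerity p = sqrt(gH) and the velocity v satisfy
    p_t + v p_x + p v_x / 2 = 0 and v_t + v v_x + 2 p p_x = 0 almost everywhere,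
    as combinations of the two transport equations; multiplying the first by
    2 p / g gives the conservation of mass. *)
Lemma invariants_weak (T : R) : 0 < T ->
  conservation_law T l depth (fun t x => depth t x * velocity t x) /\
  conservation_law T l velocity (fun t x => velocity t x ^+ 2 / 2 + g * depth t x).
Proof.
move=> T0.
have M0 : 0 <= M by exact: le_trans (celerity_le 0 0).
have kd0 : 0 <= M * (m + m) / g by rewrite divr_ge0 ?(ltW g0)// mulr_ge0// addr_ge0.
pose M1 := M + M * M / g.
have MM0 : 0 <= M * M / g by rewrite divr_ge0 ?(ltW g0)// mulr_ge0.
have dM1 t x : `|depth t x| <= M1 by rewrite (le_trans (depth_le _ _))// lerDr.
have vM1 t x : `|velocity t x| <= M1 by rewrite (le_trans (velocity_le _ _))// lerDl.
have M10 : 0 <= M1 by rewrite addr_ge0.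
pose k1 := M * (m + m) / g + m.
have dk : lip2 k1 depth by apply: lip2W depth_lip; rewrite lerDl.
have vk : lip2 k1 velocity by apply: lip2W velocity_lip; rewrite lerDr.
have k10 : 0 <= k1 by rewrite addr_ge0.
have f1k := lip2M dk vk dM1 vM1.
have E2 : (fun t x => velocity t x ^+ 2 / 2 + g * depth t x) =
      (fun t x => 2^-1 * (velocity t x * velocity t x) + g * depth t x).
  by apply/funext => ?; apply/funext => ?; rewrite expr2 mulrC.
have f2k := lip2D (lip2Z (2^-1) (lip2M vk vk vM1 vM1)) (lip2Z g dk).
rewrite -E2 in f2k.
have f1M t x : `|depth t x * velocity t x| <= M1 * M1 by rewrite normrM ler_pM.
have f2M t x : `|velocity t x ^+ 2 / 2 + g * depth t x| <= M1 * M1 + g * M1.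
  apply: (le_trans (ler_normD _ _)); apply: lerD; last first.
    by rewrite normrM (gtr0_norm g0) ler_wpM2l// ltW.
  rewrite normrM expr2 normrM [`|2^-1|]ger0_norm ?invr_ge0//.
  rewrite -[leRHS]mulr1; apply: ler_pM; rewrite ?mulr_ge0 ?invr_ge0 ?ler_pM//.
  by rewrite invf_le1// ler1n.
have core : forall t, 0 < t -> {ae mu, forall x, 0 < x < l -> exists px vx : R,
    [/\ is_derive x (1 : R) (celerity t) px, is_derive x (1 : R) (velocity t) vx,
     n.+1%:R * (celerity (t + n.+1%:R^-1) x - celerity t x) @[n --> \oo] -->
       - (velocity t x * px + celerity t x * vx / 2) &
     n.+1%:R * (velocity (t + n.+1%:R^-1) x - velocity t x) @[n --> \oo] -->
       - (velocity t x * vx + 2 * celerity t x * px)]}.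
  move=> t t0; move: (ae_reduced_system t0); apply: filterS => x h xl.
  have [ax [bx [dA dB cA cB]]] := h xl.
  exists ((ax - bx) / 4), ((ax + bx) / 2); split.
  - rewrite (_ : celerity t = cst S + 4^-1 *: (invA t - invB t)).
      apply: is_derive_eq (is_deriveD (is_derive_cst S x 1)
        (is_deriveZ 4^-1 (is_deriveB dA dB))) _.
      by rewrite add0r mulrC.
    by apply/funext => y; rewrite !fctE /celerity -[_ *: _]/(_ * _); ring.
  - rewrite (_ : velocity t = cst Vs + 2^-1 *: (invA t + invB t)).
      apply: is_derive_eq (is_deriveD (is_derive_cst Vs x 1)
        (is_deriveZ 2^-1 (is_deriveD dA dB))) _.
      by rewrite add0r mulrC.
    by apply/funext => y; rewrite !fctE /velocity -[_ *: _]/(_ * _); ring.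
  - have c := cvgM (cvgB cA cB) (cvg_cst (4^-1 : R)).
    rewrite [X in _ --> X](_ : _ = (- (velocity t x + celerity t x) * ax -
       - (velocity t x - celerity t x) * bx) * 4^-1); last by field.
    have -> : (fun n : nat => n.+1%:R * (celerity (t + n.+1%:R^-1) x - celerity t x)) =
      (fun n : nat => (n.+1%:R * (invA (t + n.+1%:R^-1) x - invA t x) -
      n.+1%:R * (invB (t + n.+1%:R^-1) x - invB t x)) * 4^-1); last exact: c.
    by apply/funext => n; rewrite /celerity; ring.
  - have c := cvgM (cvgD cA cB) (cvg_cst (2^-1 : R)).
    rewrite [X in _ --> X](_ : _ = (- (velocity t x + celerity t x) * ax +
       - (velocity t x - celerity t x) * bx) * 2^-1); last by field.
    have -> : (fun n : nat => n.+1%:R * (velocity (t + n.+1%:R^-1) x - velocity t x)) =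
      (fun n : nat => (n.+1%:R * (invA (t + n.+1%:R^-1) x - invA t x) +
      n.+1%:R * (invB (t + n.+1%:R^-1) x - invB t x)) * 2^-1); last exact: c.
    by apply/funext => n; rewrite /velocity; ring.
have gn0 : g != 0 by rewrite gt_eqF.
have ddepth t x px : is_derive x (1 : R) (celerity t) px ->
    is_derive x (1 : R) (depth t) (2 * celerity t x * px / g).
  move=> dp; rewrite (_ : depth t = g^-1 *: (celerity t * celerity t)).
    by apply: is_derive_eq; rewrite -![_ *: _]/(_ * _); ring.
  by apply/funext => y; rewrite !fctE /depth -[_ *: _]/(_ * _) mulrC.
split.
- apply: (weak_of_pointwise T0 l0 (lip2W _ dk) (lip2W _ f1k) (M := M1 + M1 * M1)
     (k := k1 + M1 * (k1 + k1))).
  + by rewrite lerDl mulr_ge0// addr_ge0.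
  + by rewrite lerDr.
  + by move=> t x; rewrite (le_trans (dM1 t x))// lerDl mulr_ge0.
  + by move=> t x; rewrite (le_trans (f1M t x))// lerDr.
  + move=> t /andP[t0 _]; move: (core t t0); apply: filterS => x h xl.
    have [px [vx [dp dv cp cv]]] := h xl.
    exists (2 * celerity t x * px / g * velocity t x + depth t x * vx).
      have dH := ddepth t x px dp.
      rewrite (_ : (fun x => _) = depth t * velocity t)//.
      by apply: is_derive_eq; rewrite -![_ *: _]/(_ * _); ring.
    have cc : celerity (t + n.+1%:R^-1) x @[n --> \oo] --> celerity t x.
      have ct : t + n.+1%:R^-1 @[n --> \oo] --> t.
        rewrite -[X in _ --> X]addr0; apply: cvgD; [exact: cvg_cst|exact: cvg_harmonic].
      have cux : continuous (celerity ^~ x).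
        apply: (@lipschitz_continuous _ _ m) => a b.
        by have := celerity_lip a x b x; rewrite subrr normr0 addr0.
      exact: cvg_comp _ _ ct (cux t).
    have c := cvgM (cvgM cp (cvgD cc (cvg_cst (celerity t x)))) (cvg_cst (g^-1)).
    rewrite [X in _ --> X](_ : _ = - (velocity t x * px + celerity t x * vx / 2) *
      (celerity t x + celerity t x) * g^-1); last by rewrite /depth; field.
    have -> : (fun n : nat => n.+1%:R * (depth (t + n.+1%:R^-1) x - depth t x)) =
      (fun n : nat => n.+1%:R * (celerity (t + n.+1%:R^-1) x - celerity t x) *
       (celerity (t + n.+1%:R^-1) x + celerity t x) * g^-1); last exact: c.
    by apply/funext => n; rewrite /depth; ring.
- apply: (weak_of_pointwise T0 l0 (lip2W _ vk) (lip2W _ f2k) (M := M1 + (M1 * M1 + g * M1))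
     (k := k1 + (`|2^-1| * (M1 * (k1 + k1)) + `|g| * k1))).
  + by rewrite lerDl addr_ge0 ?mulr_ge0// addr_ge0.
  + by rewrite lerDr.
  + by move=> t x; rewrite (le_trans (vM1 t x))// lerDl addr_ge0 ?mulr_ge0// ltW.
  + by move=> t x; rewrite (le_trans (f2M t x))// lerDr.
  + move=> t /andP[t0 _]; move: (core t t0); apply: filterS => x h xl.
    have [px [vx [dp dv cp cv]]] := h xl.
    exists (velocity t x * vx + 2 * celerity t x * px); last exact: cv.
    have dH := ddepth t x px dp.
    rewrite (_ : (fun x => _) = 2^-1 *: (velocity t * velocity t) + g *: depth t).
      apply: is_derive_eq (is_deriveD (is_deriveZ 2^-1 (is_deriveM dv dv)) (is_deriveZ g dH)) _.
      by rewrite -![_ *: _]/(_ * _); field.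
    by apply/funext => y; rewrite !fctE expr2 -![_ *: _]/(_ * _); ring.
Qed.
End FromInvariants.

(** * The control states *)

Section Control.
Context {R : realType}.

(** The positive part of z to the power p: of class C^1 for p > 1. *)
Definition powp (p z : R) : R := if 0 < z then z `^ p else 0.

Lemma powp_le0 (p z : R) : z <= 0 -> powp p z = 0.
Proof. by rewrite /powp leNgt => /negbTE ->. Qed.

Lemma powp_ge0 (p z : R) : 0 <= powp p z.
Proof. by rewrite /powp; case: ifP => // _; exact: powR_ge0. Qed.

Lemma powp_le (p a b : R) : 0 <= p -> a <= b -> powp p a <= powp p b.
Proof.
move=> p0 ab; have [a0|a0] := leP a 0; first by rewrite powp_le0// powp_ge0.
have b0 : 0 < b by exact: lt_le_trans ab.
by rewrite /powp a0 b0 ge0_ler_powR// nnegrE ltW.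
Qed.

Lemma is_derive_powp (p z : R) : 1 < p ->
  is_derive z (1 : R) (powp p) (p * powp (p - 1) z).
Proof.
move=> p1; have [z0|z0|->] := ltgtP z 0.
- rewrite powp_le0 ?ltW// mulr0.
  apply: (@near_eq_is_derive _ _ _ (cst 0)).
  near=> y; rewrite powp_le0//; near: y; exact: lt_le_nbhsl.
- have -> : powp (p - 1) z = z `^ (p - 1) by rewrite /powp z0.
  apply: (@near_eq_is_derive R R R (fun y : R => y `^ p) (powp p) z 1 (p * z `^ (p - 1))).
    near=> y; have y0 : 0 < y by near: y; exact: lt_nbhsr.
    by rewrite /powp y0.
  exact: is_derive1_powR.
- rewrite powp_le0// mulr0.
  have cv : h^-1 *: (powp p (h *: 1 + 0) - powp p 0) @[h --> 0^'] --> (0 : R).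
    apply/cvgr0Pnorm_le => e e0; near=> h.
    have h0 : h != 0 by near: h; exact: nbhs_dnbhs_neq.
    rewrite addr0 -[h *: 1]/(h * 1) mulr1 (powp_le0 _ (lexx 0)) subr0 normrZ normfV.
    rewrite mulrC ler_pdivrMr ?normr_gt0// ger0_norm ?powp_ge0//.
    have [hn|hp] := leP h 0; first by rewrite powp_le0// mulr_ge0// ltW.
    rewrite /powp hp (gtr0_norm hp) mulrC -{1}(mulr_powRB1 (ltW hp)); last by lra.
    rewrite ler_wpM2l ?(ltW hp)//.
    have q0 : 0 < p - 1 by lra.
    have eE : e = (e `^ (p - 1)^-1) `^ (p - 1).
      by rewrite -powRrM mulVf ?gt_eqF// powRr1// ltW.
    rewrite eE ge0_ler_powR// ?nnegrE ?powR_ge0 ?(ltW hp) ?(ltW q0)//.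
    rewrite -(gtr0_norm hp); near: h; apply: dnbhs0_le; exact: powR_gt0.
  apply: DeriveDef; first by apply/cvg_ex; exists 0.
  exact: cvg_lim cv.
Unshelve. all: by end_near. Qed.

Variables (K gamma : R).
Hypotheses (K0 : 0 < K) (gamma01 : 0 < gamma < 1).

Let g0 : 0 < gamma. Proof. by case/andP: gamma01. Qed.
Let g1 : 0 < 1 - gamma. Proof. by case/andP: gamma01 => ? ?; lra. Qed.

(** Along y' = - K sgn(y) |y|^gamma the quantity |y|^(1 - gamma) decreases at the
    constant rate K (1 - gamma) until it reaches 0. *)
Definition decay (y0 t : R) : R :=
  Num.sg y0 * powp (1 - gamma)^-1 (`|y0| `^ (1 - gamma) - K * (1 - gamma) * t).

Definition extinction (y0 : R) : R := `|y0| `^ (1 - gamma) / (K * (1 - gamma)).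

Let p := (1 - gamma)^-1.
Let p1 : 1 < p.
Proof. by rewrite /p -[X in X < _]invr1 ltf_pV2 ?posrE//; have := g0; lra. Qed.
Let pg : p * gamma = p - 1.
Proof. by rewrite /p; field; rewrite gt_eqF. Qed.

Lemma powp_root (y0 : R) : powp p (`|y0| `^ (1 - gamma)) = `|y0|.
Proof.
have [->|yn0] := eqVneq y0 0.
  by rewrite normr0 powR0 ?gt_eqF// powp_le0.
have y0' : 0 < `|y0| by rewrite normr_gt0.
by rewrite /powp powR_gt0// -powRrM mulfV ?gt_eqF// powRr1.
Qed.

Lemma decayN y0 t : decay (- y0) t = - decay y0 t.
Proof. by rewrite /decay sgrN normrN mulNr. Qed.

Lemma decay0 y0 : decay y0 0 = y0.
Proof. by rewrite /decay mulr0 subr0 powp_root mulr_sg_norm. Qed.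

Lemma decay_le y0 t : 0 <= t -> `|decay y0 t| <= `|y0|.
Proof.
move=> t0; rewrite normrM (ger0_norm (powp_ge0 _ _)).
have h : powp p (`|y0| `^ (1 - gamma) - K * (1 - gamma) * t) <= `|y0|.
  rewrite -[leRHS]powp_root; apply: powp_le; first by have := p1; lra.
  by rewrite gerBl mulr_ge0// mulr_ge0// ltW.
rewrite -[leRHS]mul1r; apply: ler_pM => //; first exact: powp_ge0.
by rewrite normr_sg; case: (y0 != 0).
Qed.

Lemma decay_extinct y0 t : extinction y0 <= t -> decay y0 t = 0.
Proof.
rewrite /extinction ler_pdivrMr ?mulr_gt0// => h.
by rewrite /decay powp_le0 ?mulr0// subr_le0 mulrC.
Qed.

Lemma is_derive_decay y0 t :
  is_derive t (1 : R) (decay y0) (- K * Num.sg (decay y0 t) * `|decay y0 t| `^ gamma).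
Proof.
set A := `|y0| `^ (1 - gamma).
have d1 : is_derive t (1 : R) (fun t : R => A - K * (1 - gamma) * t) (- (K * (1 - gamma))).
  rewrite (_ : (fun _ => _) = cst A - (K * (1 - gamma)) *: id)//.
  by apply: is_derive_eq; rewrite -[_ *: _]/(_ * _); ring.
have d2 := @is_derive1_comp _ (powp p) (fun t => A - K * (1 - gamma) * t) t _ _
  (is_derive_powp (A - K * (1 - gamma) * t) p1) d1.
have -> : decay y0 = Num.sg y0 *: (powp p \o (fun t => A - K * (1 - gamma) * t)).
  by apply/funext => s.
apply: is_derive_eq; rewrite !fctE /=.
set z := A - K * (1 - gamma) * t.
rewrite -![_ *: _]/(_ * _).
have [z0|z0] := leP z 0.
  by rewrite !powp_le0// !(mulr0, mul0r) sgr0 !(mulr0, mul0r).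
have [y00|yn0] := eqVneq y0 0; first by rewrite y00 sgr0 !mul0r sgr0 !(mulr0, mul0r).
rewrite normrM (ger0_norm (powp_ge0 _ _)) normr_sg yn0 mul1r.
have pz : 0 < powp p z by rewrite /powp z0 powR_gt0.
rewrite sgrM sgr_id (gtr0_sg pz) mulr1.
rewrite {2}/powp z0 -powRrM pg /powp z0.
by rewrite /p; field; rewrite gt_eqF.
Qed.

Lemma decay_continuous y0 : continuous (decay y0).
Proof.
move=> t; apply/differentiable_continuous/derivable1_diffP.
by have h := is_derive_decay y0 t; exact: ex_derive.
Qed.

Lemma decay_lip y0 t s : 0 <= t -> 0 <= s ->
  `|decay y0 t - decay y0 s| <= K * `|y0| `^ gamma * `|t - s|.
Proof.
move=> t0 s0; wlog ts : t s t0 s0 / s <= t => [hw|].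
  by have [h|/ltW h] := leP s t; [exact: hw|rewrite distrC [`|t - s|]distrC; exact: hw].
have [z zin ->] := MVT_segment ts (fun z _ => is_derive_decay y0 z)
  (continuous_subspaceT (@decay_continuous y0)).
have z0 : 0 <= z by move: zin; rewrite in_itv/= => /andP[? _]; exact: le_trans s0 _.
rewrite normrM; apply: ler_wpM2r => //.
rewrite !normrM normrN (gtr0_norm K0) -mulrA; apply: ler_wpM2l; first exact: ltW.
rewrite [`|_ `^ _|]ger0_norm ?powR_ge0// -[leRHS]mul1r; apply: ler_pM => //.
- by rewrite normr_sg; case: (_ != 0).
- apply: ge0_ler_powR; rewrite ?nnegrE ?(ltW g0)//; rewrite -normrM; exact: decay_le.
Qed.

Lemma decay_control T y0 : control_state K gamma T y0 (decay y0).
Proof.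
split; last by move=> t _; exact: is_derive_decay.
  exact/continuous_subspaceT/decay_continuous.
exact: decay0.
Qed.

(** The feedback is monotone, so the distance between two control states
    decreases. This gives uniqueness although the feedback is not Lipschitz
    at 0. *)
Lemma feedback_mono (a b : R) :
  0 <= (a - b) * (Num.sg a * `|a| `^ gamma - Num.sg b * `|b| `^ gamma).
Proof.
wlog ab : a b / b <= a => [hw|].
  have [h|/ltW h] := leP b a; first exact: hw.
  by have := hw b a h; lra.
rewrite mulr_ge0 ?subr_ge0//.
have [b0|b0|b0] := ltgtP b 0.
- rewrite (ltr0_sg b0) mulN1r; have [a0|a0|->] := ltgtP a 0.
  + rewrite (ltr0_sg a0) mulN1r lerN2 ge0_ler_powR ?nnegrE ?(ltW g0)//.
    by rewrite !ltr0_norm// lerN2.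
  + rewrite (gtr0_sg a0) mul1r; apply: (@le_trans _ _ 0); last exact: powR_ge0.
    by rewrite oppr_le0 powR_ge0.
  + by rewrite sgr0 mul0r oppr_le0 powR_ge0.
- have a0 : 0 < a by exact: lt_le_trans ab.
  rewrite (gtr0_sg a0) (gtr0_sg b0) !mul1r ge0_ler_powR ?nnegrE ?(ltW g0)//.
  by rewrite !gtr0_norm.
- rewrite b0 in ab *; rewrite sgr0 mul0r; have [a0|a0|->] := ltgtP a 0.
  + by exfalso; move: (a0) (ab); lra.
  + by rewrite mulr_ge0 ?sgr_ge0 ?powR_ge0// ltW.
  + by rewrite sgr0 mul0r.
Qed.

Lemma control_state_unique (T y0 : R) (y1 y2 : R -> R) :
  control_state K gamma T y0 y1 -> control_state K gamma T y0 y2 ->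
  forall t, 0 <= t <= T -> y1 t = y2 t.
Proof.
move=> [c1 i1 d1] [c2 i2 d2] t /andP[t0 tT].
pose z s := (y1 s - y2 s) * (y1 s - y2 s).
have dz s : 0 < s < T -> is_derive s (1 : R) z (2 * (y1 s - y2 s) *
    (- K * (Num.sg (y1 s) * `|y1 s| `^ gamma - Num.sg (y2 s) * `|y2 s| `^ gamma))).
  move=> sT; have h1 := d1 s sT; have h2 := d2 s sT.
  rewrite (_ : z = (y1 - y2) * (y1 - y2))//.
  by apply: is_derive_eq; rewrite !fctE -![_ *: _]/(_ * _); ring.
have T0 : 0 <= T by exact: le_trans tT.
have zz : z t <= z 0.
  apply: (@ler0_derive1_le_cc R z 0 T) => //; rewrite ?in_itv/= ?lexx ?t0 ?T0//.
  - by move=> s; rewrite in_itv/= => sT; have h := dz s sT; exact: ex_derive.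
  - move=> s; rewrite in_itv/= => sT; have h := dz s sT.
    rewrite derive1E derive_val.
    have := feedback_mono (y1 s) (y2 s); set X := _ - _ * _; set Y := y1 s - y2 s => XY.
    have : 0 <= K * (Y * X) by rewrite mulr_ge0// ltW.
    lra.
  - by move=> s; apply: cvgM; apply: cvgB; [exact: c1|exact: c2|exact: c1|exact: c2].
move: zz; rewrite /z i1 i2 subrr mulr0 -expr2 => zz.
apply/eqP; rewrite -subr_eq0 -sqrf_eq0 eq_le zz; exact: sqr_ge0.
Qed.
End Control.

(** * Uniqueness of the closed-loop solution *)

Section Uniqueness.
Context {R : realType}.

Lemma conservation_law_eq (T l : R) (u f u' f' : R -> R -> R) :
  (forall t x, 0 < t < T -> 0 < x < l -> u t x = u' t x /\ f t x = f' t x) ->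
  conservation_law T l u f -> conservation_law T l u' f'.
Proof.
move=> eqf uf phi tphi; rewrite -[RHS](uf phi tphi); apply: eq_integral => -[t x].
rewrite inE => -[/=]; rewrite !in_itv/= => tT xl.
by have [-> ->] := eqf t x tT xl.
Qed.

(** A solution matters on the rectangle only; extending it to the plane as a
    Lipschitz function makes the estimates above applicable, with the same
    conservation laws. *)
Lemma Lip_rect_clamp (T l : R) (u : R -> R -> R) : 0 <= T -> 0 <= l ->
  Lip_rect T l u -> exists L, lip2 L (fun t x => u (clamp T t) (clamp l x)).
Proof.
move=> T0 l0 [M [_ HM]]; exists (`|M| + 1) => t x s y.
have M1 : M < `|M| + 1 by have := ler_norm M; lra.
apply: le_trans (HM _ M1 ((clamp T t, clamp l x), (clamp T s, clamp l y)) _) _.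
  by split; split; rewrite /= in_itv/= clamp_in.
 apply: ler_wpM2l; first by rewrite addr_ge0.
rewrite prod_normE/= ge_max; have h1 := clamp_lip T t s; have h2 := clamp_lip l x y.
by rewrite (le_trans h1) ?(le_trans h2) ?lerDl ?lerDr.
Qed.

Lemma lip2_Lip_rect (T l L : R) (u : R -> R -> R) : lip2 L u -> Lip_rect T l u.
Proof.
move=> uL; have L0 := lip2_ge0 uL.
exists (L * 2); split; first exact: num_real.
move=> k Lk [[t x] [s y]] _ /=; apply: le_trans (uL _ _ _ _) _.
rewrite prod_normE/=; set m := Order.max _ _.
have h1 : `|t - s| <= m by rewrite le_max lexx.
have h2 : `|x - y| <= m by rewrite le_max lexx orbT.
apply: (@le_trans _ _ (L * (m + m))); first by apply: ler_wpM2l => //; exact: lerD.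
have m0 : 0 <= m by exact: le_trans h1.
by rewrite -mulr2n -(mulr_natl m) mulrA; apply: ler_wpM2r => //; exact: ltW.
Qed.

Lemma lip2_bounded (T l L : R) (u : R -> R -> R) : 0 <= T -> 0 <= l ->
  lip2 L (fun t x => u (clamp T t) (clamp l x)) ->
  forall t x, `|u (clamp T t) (clamp l x)| <= `|u 0 0| + L * (T + l).
Proof.
move=> T0 l0 uL t x; have L0 := lip2_ge0 uL.
have cc (a b : R) : 0 <= a -> clamp a (clamp a b) = clamp a b.
  by move=> a0; rewrite clamp_id// clamp_in.
have c0 (a : R) : 0 <= a -> clamp a 0 = 0 by move=> a0; rewrite clamp_id// lexx.
have := uL (clamp T t) (clamp l x) 0 0; rewrite !cc// !c0// !subr0.
have /andP[h1 h2] := clamp_in t T0; have /andP[h3 h4] := clamp_in x l0.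
rewrite (ger0_norm h1) (ger0_norm h3) => h.
have : L * (clamp T t + clamp l x) <= L * (T + l) by apply: ler_wpM2l => //; exact: lerD.
have := ler_normD (u (clamp T t) (clamp l x) - u 0 0) (u 0 0); rewrite subrK; lra.
Qed.

Section Invariants.
Variables (g l Hs Vs : R).
Local Notation S := (Num.sqrt (g * Hs)).

(** The invariants measured from the equilibrium, the second one reflected. *)
Definition invariants (H V : R -> R -> R) (i : bool) t x : R :=
  if i then riemann g H V 1 t x - (Vs + 2 * S)
  else - riemann g H V (-1) t (l - x) + (Vs - 2 * S).

Lemma cspeed_invariants H V i t x :
  cspeed (rest_speed g Hs Vs) l (invariants H V) i t x =
  if i then char_speed g H V 1 t x else - char_speed g H V (-1) t (l - x).
Proof.
rewrite /cspeed /invariants /rest_speed /char_speed /riemann; by case: i => /=; rewrite ?subKr; field.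
Qed.

Lemma solution_char_on (T L M hm Sg ta tb : R) (H V : R -> R -> R) :
  0 < g -> 0 < T -> 0 < l -> lip2 L H -> lip2 L V ->
  (forall t x, `|H t x| <= M) -> (forall t x, `|V t x| <= M) ->
  conservation_law T l H (fun t x => H t x * V t x) ->
  conservation_law T l V (fun t x => V t x ^+ 2 / 2 + g * H t x) ->
  0 < hm -> 0 <= ta -> tb <= T ->
  (forall t x, ta <= t <= tb -> 0 <= x <= l -> hm <= H t x) ->
  char_on (rest_speed g Hs Vs) l (char_const g L hm Sg) Sg ta tb (invariants H V).
Proof.
move=> g0 T0 l0 HL VL HM VM mass mom hm0 ta0 tbT Hhm i t s x sg s0 tas ttb.
move=> /andP[x0 xl] /andP[y0 yl] /andP[sg0 sgS].
have Ht z : 0 <= z <= l -> hm <= H t z by apply: Hhm; lra.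
have Hts z : 0 <= z <= l -> 0 <= H (t - s) z.
  by move=> zl; apply: (le_trans (ltW hm0)); apply: Hhm => //; lra.
rewrite cspeed_invariants; case: i; rewrite /invariants.
- rewrite opprB addrA subrK.
  apply: (weak_char g0 T0 l0 HL VL HM VM mass mom hm0 (or_introl erefl)) => //.
  + lra.
  + lra.
  + by rewrite !ltW.
  + by rewrite y0 ltW.
  + by left.
  + by rewrite ger0_norm.
  + by apply: Ht; rewrite !ltW.
  + by apply: Hts; rewrite y0 ltW.
- have e1 : l - (x - s * sg) = (l - x) - s * (- sg) by ring.
  rewrite e1.
  have -> : `|- riemann g H V (-1) t (l - x) + (Vs - 2 * S) -
    (- riemann g H V (-1) (t - s) (l - x - s * - sg) + (Vs - 2 * S))| =
    `|riemann g H V (-1) t (l - x) - riemann g H V (-1) (t - s) (l - x - s * - sg)|.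
    by rewrite -normrN; congr (`|_|); ring.
  have -> : `|- char_speed g H V (-1) t (l - x) - sg| = `|char_speed g H V (-1) t (l - x) - (- sg)|.
    by rewrite -normrN; congr (`|_|); ring.
  apply: (weak_char g0 T0 l0 HL VL HM VM mass mom hm0 (or_intror erefl)) => //.
  + lra.
  + lra.
  + lra.
  + by rewrite -e1; lra.
  + by right; rewrite -e1; lra.
  + by rewrite normrN ger0_norm.
  + by apply: Ht; lra.
  + by apply: Hts; rewrite -e1; lra.
Qed.

Lemma invariants_inj (H V H' V' : R -> R -> R) (t x : R) : 0 < g -> 0 <= H t x -> 0 <= H' t x ->
  invariants H V true t x = invariants H' V' true t x ->
  invariants H V false t (l - x) = invariants H' V' false t (l - x) ->
  H t x = H' t x /\ V t x = V' t x.
Proof.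
move=> g0 h0 h0'; rewrite /invariants /riemann !subKr => e1 e2.
have eV : V t x = V' t x by lra.
have eS : Num.sqrt (g * H t x) = Num.sqrt (g * H' t x) by lra.
split=> //; have := congr1 (fun z => z ^+ 2) eS.
rewrite !sqr_sqrtr ?mulr_ge0 ?(ltW g0)//; apply: mulfI; exact: lt0r_neq0.
Qed.
End Invariants.

Lemma lip_on_eq0 (l k : R) (u : R -> R) : 0 < l -> lip_on l k u ->
  (forall x, 0 < x < l -> u x = 0) -> forall x, 0 <= x <= l -> u x = 0.
Proof.
move=> l0 uk u0 x /andP[x0 xl]; have k0 := lip_on_ge0 l0 uk.
apply/eqP; rewrite -normr_le0; apply/ler_addgt0Pr => e e0; rewrite add0r.
pose q : R := Num.min 1 (e / (k * l + 1)).
have kl0 : 0 < k * l + 1 by have := mulr_ge0 k0 (ltW l0); lra.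
have q0 : 0 < q by rewrite lt_min ltr01 divr_gt0.
have q1 : q <= 1 by rewrite ge_min lexx.
have qe : q * (k * l + 1) <= e by rewrite -ler_pdivlMr// ge_min lexx orbT.
have yl : 0 < x + q * (l / 2 - x) < l.
  have -> : x + q * (l / 2 - x) = (1 - q) * x + q * (l / 2) by ring.
  have h1 : 0 <= (1 - q) * x by rewrite mulr_ge0// subr_ge0.
  have h2 : 0 < q * (l / 2) by rewrite mulr_gt0//; lra.
  have h3 : (1 - q) * x <= (1 - q) * l by rewrite ler_wpM2l// subr_ge0.
  lra.
have := uk x (x + q * (l / 2 - x)); rewrite (u0 _ yl) subr0 opprD addNKr normrN.
rewrite normrM (gtr0_norm q0) => /(_ _ _)/le_trans; apply.
- by rewrite x0.
- by move/andP: yl => [/ltW -> /ltW ->].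
have hd : `|l / 2 - x| <= l by rewrite ler_norml; lra.
have h4 : k * (q * `|l / 2 - x|) <= k * (q * l).
  by apply: ler_wpM2l => //; apply: ler_wpM2l => //; exact: ltW.
lra.
Qed.

Lemma char_const_ge0 (g L hm Sg : R) : 0 <= g -> 0 <= L -> 0 <= Sg ->
  0 <= char_const g L hm Sg.
Proof.
move=> g0 L0 Sg0; have L20 : 0 <= L ^+ 2 by exact: sqr_ge0.
have Q0 : 0 <= g / Num.sqrt (g * hm) by rewrite divr_ge0 ?sqrtr_ge0.
rewrite /char_const; set Q := g / _ in Q0 *.
have t1 : 0 <= L * (Q + 1) by rewrite mulr_ge0 ?addr_ge0.
have t2 : 0 <= L ^+ 2 * (1 + Sg) * (2 * Q + 1).
  by apply: mulr_ge0; [apply: mulr_ge0 => //; lra|lra].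
have t3 : 0 <= (Q + 1) * L ^+ 2 by rewrite mulr_ge0 ?addr_ge0.
have t4 : 0 <= (g * L * (1 + Sg)) ^+ 2 / Num.sqrt (g * hm) ^+ 3.
  by rewrite divr_ge0 ?sqr_ge0 ?exprn_ge0 ?sqrtr_ge0.
by rewrite !addr_ge0.
Qed.

Section TwoSolutions.
Variables (g l K gamma Hs Vs T hm c : R) (H0 V0 : R -> R).
Hypotheses (g0 : 0 < g) (l0 : 0 < l) (K0 : 0 < K) (gamma01 : 0 < gamma < 1).
Hypotheses (T0 : 0 < T) (hm0 : 0 < hm) (c0 : 0 < c).

Let ext (u : R -> R -> R) t x := u (clamp T t) (clamp l x).

Lemma closed_loop_regular H V : closed_loop_solution g l K gamma Hs Vs H0 V0 T H V ->
  exists L M, [/\ lip2 L (ext H), lip2 L (ext V),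
    (forall t x, `|ext H t x| <= M) /\ (forall t x, `|ext V t x| <= M),
    conservation_law T l (ext H) (fun t x => ext H t x * ext V t x) &
    conservation_law T l (ext V) (fun t x => ext V t x ^+ 2 / 2 + g * ext H t x)].
Proof.
move=> [[HL VL] mass mom _ _].
have [L1 h1] := Lip_rect_clamp (ltW T0) (ltW l0) HL.
have [L2 h2] := Lip_rect_clamp (ltW T0) (ltW l0) VL.
exists (Num.max L1 L2).
exists (Num.max (`|H 0 0| + L1 * (T + l)) (`|V 0 0| + L2 * (T + l))); split.
- by apply: lip2W h1; rewrite le_max lexx.
- by apply: lip2W h2; rewrite le_max lexx orbT.
- split=> t x; rewrite le_max.
    by rewrite (lip2_bounded (ltW T0) (ltW l0) h1).
  by rewrite (lip2_bounded (ltW T0) (ltW l0) h2) orbT.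
- apply: conservation_law_eq mass => t x /andP[t0 tT] /andP[x0 xl].
  by rewrite /ext !clamp_id ?ltW// (ltW t0) ltW.
- apply: conservation_law_eq mom => t x /andP[t0 tT] /andP[x0 xl].
  by rewrite /ext !clamp_id ?ltW// (ltW t0) ltW.
Qed.

(** The depth H' has no lower bound to start with, whereas [weak_char] and the
    passage from the boundary conditions to the invariants require one. It is
    obtained step by step: as long as the solutions agree up to time ta, the depth H'
    stays above hm during a further time hm / (L + 1), and on that slab
    [char_uniqueness] applies. *)
Lemma closed_loop_unique H V H' V' :
  closed_loop_solution g l K gamma Hs Vs H0 V0 T H V ->
  closed_loop_solution g l K gamma Hs Vs H0 V0 T H' V' ->
  (forall t x, 0 <= t <= T -> 0 <= x <= l ->
    [/\ 2 * hm <= H t x, c <= V t x + Num.sqrt (g * H t x) &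
        c <= Num.sqrt (g * H t x) - V t x]) ->
  forall t x, 0 <= t <= T -> 0 <= x <= l -> H' t x = H t x /\ V' t x = V t x.
Proof.
move=> sol sol' sub.
have [L1 [M1 [HL1 VL1 [HM1 VM1] mass mom]]] := closed_loop_regular sol.
have [L2 [M2 [HL2 VL2 [HM2 VM2] mass' mom']]] := closed_loop_regular sol'.
have [_ _ _ init [v [u [vs us bl b0]]]] := sol.
have [_ _ _ init' [v' [u' [vs' us' bl' b0']]]] := sol'.
have vE := control_state_unique K0 gamma01 vs vs'.
have uE := control_state_unique K0 gamma01 us us'.
pose L := Num.max L1 L2; pose M := Num.max M1 M2.
have ML1 : L1 <= L by rewrite le_max lexx.
have ML2 : L2 <= L by rewrite le_max lexx orbT.
have {HL1} HL := lip2W ML1 HL1; have {VL1} VL := lip2W ML1 VL1.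
have {HL2} HL' := lip2W ML2 HL2; have {VL2} VL' := lip2W ML2 VL2.
have MM1 : M1 <= M by rewrite le_max lexx.
have MM2 : M2 <= M by rewrite le_max lexx orbT.
have HM t x := le_trans (HM1 t x) MM1; have VM t x := le_trans (VM1 t x) MM1.
have HM' t x := le_trans (HM2 t x) MM2; have VM' t x := le_trans (VM2 t x) MM2.
have L0 : 0 <= L by exact: lip2_ge0 HL.
have M0 : 0 <= M by exact: le_trans (HM 0 0).
have extE w t x : 0 <= t <= T -> 0 <= x <= l -> ext w t x = w t x.
  by move=> tT xl; rewrite /ext !clamp_id.
suff main : forall t x, 0 <= t <= T -> 0 <= x <= l ->
    ext H t x = ext H' t x /\ ext V t x = ext V' t x.
  by move=> t x tT xl; have := main t x tT xl; rewrite !extE// => -[-> ->].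
pose Sg := M + Num.sqrt (g * M).
have speedSg (P Q : R -> R -> R) t x : (forall t x, `|P t x| <= M) ->
    (forall t x, `|Q t x| <= M) -> `|Q t x| + Num.sqrt (g * P t x) <= Sg.
  move=> PM QM; apply: lerD => //; apply: ler_wsqrtr.
  by apply: ler_wpM2l; [exact: ltW|exact: le_trans (ler_norm _) (PM t x)].
pose h := hm / (L + 1).
have h0 : 0 < h by rewrite divr_gt0//; lra.
have Lh : L * h <= hm.
  have : (L + 1) * h = hm by rewrite /h; field; lra.
  lra.
(* Induction on the number of time slabs of length h. *)
suff step : forall n : nat, forall t x, 0 <= t <= T -> t <= n%:R * h -> 0 <= x <= l ->
    ext H t x = ext H' t x /\ ext V t x = ext V' t x.
  move=> t x tT xl; apply: (step (Num.bound (T / h))) => //.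
  have := archi_boundP (divr_ge0 (ltW T0) (ltW h0)).
  rewrite ltr_pdivrMr// => /ltW; apply: le_trans; lra.
elim=> [|n IH] t x tT tn xl.
  have -> : t = 0 by lra.
  rewrite !extE ?lexx ?(ltW T0)//.
  by have [-> ->] := init x xl; have [-> ->] := init' x xl.
have [tn'|ntn] := leP t (n%:R * h); first exact: IH.
pose ta := n%:R * h; pose tb := Num.min T (n.+1%:R * h).
have ta0 : 0 <= ta by rewrite mulr_ge0// ltW.
have taT : ta <= T by rewrite /ta; lra.
have ttab : ta <= t <= tb by rewrite (ltW ntn) le_min tn andbT; lra.
have tbT : tb <= T by rewrite ge_min lexx.
have tba : tb <= ta + h by rewrite ge_min orbC /ta -[n.+1]addn1 natrD mulrDl mul1r lexx.
have low : forall s y, 0 <= s <= T -> 0 <= y <= l -> 2 * hm <= ext H s y.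
  by move=> s y sT yl; rewrite extE//; have [] := sub s y sT yl.
have low' : forall s y, ta <= s <= tb -> 0 <= y <= l -> hm <= ext H' s y.
  move=> s y /andP[s1 s2] yl.
  have [e1 _] : ext H ta y = ext H' ta y /\ ext V ta y = ext V' ta y.
    by apply: IH => //; rewrite ?ta0 ?lexx.
  have := low ta y; rewrite ta0 taT e1 => /(_ isT yl) h1.
  have := HL' ta y s y; rewrite subrr normr0 addr0 => h2.
  have h3 : `|ta - s| <= h by rewrite ler_norml; lra.
  have h4 : L * `|ta - s| <= hm by apply: le_trans Lh; exact: ler_wpM2l.
  have := ler_norm (ext H' ta y - ext H' s y); lra.
have in0T s : ta <= s <= tb -> 0 <= s <= T by move=> ?; lra.
pose w := invariants g l Hs Vs (ext H) (ext V).
pose w' := invariants g l Hs Vs (ext H') (ext V').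
have cw : char_on (rest_speed g Hs Vs) l (char_const g L hm Sg) Sg ta tb w.
  apply: (solution_char_on Hs Vs (Sg := Sg) g0 T0 l0 HL VL HM VM mass mom hm0 ta0 tbT) => s y sab yl.
  by have := low s y (in0T s sab) yl; have := hm0; lra.
have cw' : char_on (rest_speed g Hs Vs) l (char_const g L hm Sg) Sg ta tb w'.
  apply: (solution_char_on Hs Vs (Sg := Sg) g0 T0 l0 HL' VL' HM' VM' mass' mom' hm0 ta0 tbT low').
have C0 : 0 <= char_const g L hm Sg.
  by apply: char_const_ge0 => //; [exact: ltW|rewrite addr_ge0// sqrtr_ge0].
have l00 : 0 <= (0 : R) <= l by rewrite lexx ltW.
have l0l : 0 <= l <= l by rewrite lexx ltW.
have bdry : forall i s, ta <= s <= tb -> w i s 0 = w' i s 0.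
  move=> i s sab; have sT := in0T s sab.
  have [_ +] := b0 s sT; have [_ +] := b0' s sT; have [_ +] := bl s sT; have [_ +] := bl' s sT.
  have H1 := low' s 0 sab l00; have H2 := low s 0 sT l00.
  have H3 := low' s l sab l0l; have H4 := low s l sT l0l.
  rewrite !extE// in H1 H2 H3 H4.
  have nz (z : R) : hm <= z \/ 2 * hm <= z -> z != 0.
    by case=> h1; apply: lt0r_neq0; apply: lt_le_trans h1; rewrite ?mulr_gt0.
  move=> /(mulfI (nz _ (or_introl H3))) e1 /(mulfI (nz _ (or_intror H4))) e2.
  move=> /(mulfI (nz _ (or_introl H1))) e3 /(mulfI (nz _ (or_intror H2))) e4.
  rewrite /w /w' /invariants /riemann; case: i; rewrite ?subr0 !extE//.
    rewrite e3 e4 (uE s sT); ring.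
  rewrite e1 e2 (vE s sT); ring.
have initab : forall i y, 0 < y < l -> w i ta y = w' i ta y.
  move=> i y /andP[y0 yl].
  have e z : 0 <= z <= l -> ext H ta z = ext H' ta z /\ ext V ta z = ext V' ta z.
    by move=> zl; apply: IH => //; rewrite ?ta0 ?lexx.
  rewrite /w /w' /invariants /riemann; case: i.
    by have [|-> ->] := e y; first by rewrite !ltW.
  by have [|-> ->] := e (l - y); first lra.
have speeds : forall i s y, ta <= s <= tb -> 0 < y < l ->
    c <= cspeed (rest_speed g Hs Vs) l w i s y <= Sg /\ `|cspeed (rest_speed g Hs Vs) l w' i s y| <= Sg.
  move=> i s y sab /andP[y0 yl]; have sT := in0T s sab.
  rewrite !cspeed_invariants /char_speed; case: i.
    have yl' : 0 <= y <= l by rewrite !ltW.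
    have [_ h1 _] := sub s y sT yl'; rewrite -(extE H)// -(extE V)// in h1.
    have h2 := speedSg _ _ s y HM VM; have h3 := speedSg _ _ s y HM' VM'.
    have h4 := ler_norm (ext V s y); rewrite !mul1r; split; first lra.
    have := ler_normD (ext V' s y) (Num.sqrt (g * ext H' s y)).
    by rewrite (ger0_norm (sqrtr_ge0 _)); lra.
  have yl' : 0 <= l - y <= l by lra.
  have [_ _ h1] := sub s (l - y) sT yl'; rewrite -(extE H)// -(extE V)// in h1.
  have h2 := speedSg _ _ s (l - y) HM VM; have h3 := speedSg _ _ s (l - y) HM' VM'.
  have h4 := ler_norm (- ext V s (l - y)); rewrite normrN in h4; rewrite !mulN1r; split; first lra.
  have := ler_normB (ext V' s (l - y)) (Num.sqrt (g * ext H' s (l - y))).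
  by rewrite normrN (ger0_norm (sqrtr_ge0 _)); lra.
have tatb : ta <= tb by case/andP: ttab => a b; exact: le_trans b.
have wE i y := char_uniqueness c0 C0 tatb cw cw' speeds bdry initab i ttab (x := y).
have inner y : 0 < y < l -> ext H t y = ext H' t y /\ ext V t y = ext V' t y.
  move=> yl; apply: (invariants_inj (l := l) (Hs := Hs) (Vs := Vs) g0).
  - by apply: le_trans (low t y tT _); [rewrite mulr_ge0// ltW|lra].
  - by apply: le_trans (low' t y ttab _); [rewrite ltW|lra].
  - exact: (wE true y yl).
  - by apply: (wE false (l - y)); lra.
have closing (P Q : R -> R -> R) : lip2 L P -> lip2 L Q ->
    (forall y, 0 < y < l -> P t y = Q t y) -> P t x = Q t x.
  move=> PL QL PQ; apply/eqP; rewrite -subr_eq0; apply/eqP.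
  apply: (@lip_on_eq0 l (L + L) (fun y => P t y - Q t y) l0) => //.
    move=> y z _ _; have := PL t y t z; have := QL t y t z.
    rewrite subrr normr0 add0r => h1 h2.
    have -> : P t y - Q t y - (P t z - Q t z) = (P t y - P t z) - (Q t y - Q t z) by ring.
    by apply: le_trans (ler_normB _ _) _; lra.
  by move=> y yl; rewrite PQ// subrr.
by split; apply: closing => // y yl; have [] := inner y yl.
Qed.
End TwoSolutions.
End Uniqueness.

(** * Small data *)

Section SmallData.
Context {R : realType}.
Variables (g l K gamma Hs Vs c : R).
Hypotheses (g0 : 0 < g) (l0 : 0 < l) (K0 : 0 < K) (gamma01 : 0 < gamma < 1).
Hypotheses (Hs0 : 0 < Hs) (Vs0 : 0 < Vs) (c0 : 0 < c).
Local Notation S := (Num.sqrt (g * Hs)).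
Hypothesis subcritical : 2 * c < S - Vs.

(** The bound on the initial invariants, and on their Lipschitz constants, when
    the data are delta-close to the equilibrium. *)
Definition invariant_size (delta : R) : R := (1 + 2 * g / S) * delta.
Definition extinction_bound (D : R) : R := D `^ (1 - gamma) / (K * (1 - gamma)).
(** The initial profiles contribute the Lipschitz constant D; a boundary value of
    slope at most K D^gamma in time, entering at speed at least c, contributes
    K D^gamma / c in space. *)
Definition data_slope (D : R) : R := D + K * D `^ gamma / c.
(** M = M0 exp(l/c + 1) satisfies M0 exp(M T1) <= M, for T1 = l/c + 1, as soon as
    M <= 1. *)
Definition slope_bound (D : R) : R := data_slope D * expR (l / c + 1).

Let S0 : 0 < S. Proof. by rewrite sqrtr_gt0 mulr_gt0. Qed.
Let SS : S * S = g * Hs. Proof. by rewrite -expr2 sqr_sqrtr// mulr_ge0// ltW. Qed.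

Section NearEquilibrium.
Variable delta : R.
Hypotheses (d0 : 0 < delta) (dHs : delta <= Hs / 2).

Lemma sqrt_depth_bounds h : `|h - Hs| <= delta ->
  S / 2 <= Num.sqrt (g * h) /\ `|Num.sqrt (g * h) - S| <= g / S * delta.
Proof.
move=> hd; have h0 : 0 < h by move: hd; rewrite ler_norml; have := Hs0; have := dHs; lra.
set q := Num.sqrt (g * h).
have q0 : 0 <= q by exact: sqrtr_ge0.
have qq : q * q = g * h by rewrite -expr2 sqr_sqrtr// mulr_ge0// ltW.
have e : `|q - S| * (q + S) = g * `|h - Hs|.
  rewrite -[q + S]ger0_norm ?addr_ge0// ?(ltW S0)// -normrM -[g in RHS]gtr0_norm// -normrM.
  congr (`|_|); have := SS; lra.
have dS : `|q - S| * S <= g * delta.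
  have := ler_wpM2l (ltW g0) hd; have := mulr_ge0 (normr_ge0 (q - S)) q0; lra.
have dS' : `|q - S| <= g / S * delta by rewrite mulrAC ler_pdivlMr.
split=> //.
have : g / S * delta <= S / 2.
  rewrite mulrAC ler_pdivrMr//; have := SS; have := ler_wpM2l (ltW g0) dHs; lra.
have := ler_norm (- (q - S)); rewrite normrN; lra.
Qed.

Lemma sqrt_depth_lip h k : `|h - Hs| <= delta -> `|k - Hs| <= delta ->
  `|Num.sqrt (g * h) - Num.sqrt (g * k)| <= g / S * `|h - k|.
Proof.
move=> hd kd; have [h1 _] := sqrt_depth_bounds hd; have [k1 _] := sqrt_depth_bounds kd.
have h0 : 0 < h by move: hd; rewrite ler_norml; have := Hs0; have := dHs; lra.
have k0 : 0 < k by move: kd; rewrite ler_norml; have := Hs0; have := dHs; lra.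
move: h1 k1; set p := Num.sqrt (g * h); set q := Num.sqrt (g * k) => h1 k1.
have pp : p * p = g * h by rewrite -expr2 sqr_sqrtr// mulr_ge0// ltW.
have qq : q * q = g * k by rewrite -expr2 sqr_sqrtr// mulr_ge0// ltW.
have pq : 0 <= p + q by have := S0; lra.
have e : `|p - q| * (p + q) = g * `|h - k|.
  rewrite -[p + q]ger0_norm// -normrM -[g in RHS]gtr0_norm// -normrM.
  congr (`|_|); lra.
rewrite mulrAC ler_pdivlMr// -e; apply: ler_wpM2l => //; have := S0; lra.
Qed.

Variables (H0 V0 : R -> R).
Hypotheses (H0d : forall x, 0 <= x <= l -> `|H0 x - Hs| <= delta)
           (V0d : forall x, 0 <= x <= l -> `|V0 x - Vs| <= delta)
           (H0l : lip_on l delta H0) (V0l : lip_on l delta V0).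
Local Notation D := (invariant_size delta).

(** The initial values of a for e = 1 and of b for e = -1. *)
Definition datum (e x : R) : R :=
  V0 x + 2 * e * Num.sqrt (g * H0 x) - (Vs + 2 * e * S).

Let unit_sign e : e = 1 \/ e = -1 -> `|2 * e| = 2 :> R.
Proof. by case=> ->; rewrite normrM ?normrN normr1 mulr1 ger0_norm. Qed.

Lemma datum_le e x : e = 1 \/ e = -1 -> 0 <= x <= l -> `|datum e x| <= D.
Proof.
move=> e1 xl; have h1 := V0d xl; have [_ h2] := sqrt_depth_bounds (H0d xl).
have -> : datum e x = (V0 x - Vs) + 2 * e * (Num.sqrt (g * H0 x) - S).
  by rewrite /datum; ring.
apply: le_trans (ler_normD _ _) _; rewrite normrM unit_sign// /invariant_size.
have -> : (1 + 2 * g / S) * delta = delta + 2 * (g / S * delta) by ring.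
lra.
Qed.

Lemma datum_lip e : e = 1 \/ e = -1 -> lip_on l D (datum e).
Proof.
move=> e1 x y xl yl; have h1 := V0l xl yl.
have h2 := sqrt_depth_lip (H0d xl) (H0d yl).
have -> : datum e x - datum e y =
    (V0 x - V0 y) + 2 * e * (Num.sqrt (g * H0 x) - Num.sqrt (g * H0 y)).
  by rewrite /datum; ring.
apply: le_trans (ler_normD _ _) _; rewrite normrM unit_sign// /invariant_size.
have -> : (1 + 2 * g / S) * delta * `|x - y| =
   delta * `|x - y| + 2 * (g / S * (delta * `|x - y|)) by ring.
have h3 : g / S * `|H0 x - H0 y| <= g / S * (delta * `|x - y|).
  by apply: ler_wpM2l; [rewrite divr_ge0// ltW|exact: H0l].
lra.
Qed.

Hypotheses (Dc : D <= c) (DS : D <= S) (tsD : extinction_bound D <= 1)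
  (MD : slope_bound D <= 1).

Let D0 : 0 < D.
Proof. by rewrite mulr_gt0// addr_gt0// divr_gt0// mulr_gt0. Qed.

Definition initial_trace (i : bool) (x : R) : R :=
  if i then datum 1 x else - datum (-1) (l - x).
Definition boundary_trace (i : bool) (t : R) : R := decay K gamma (initial_trace i 0) t.

Lemma initial_trace_le i x : 0 <= x <= l -> `|initial_trace i x| <= D.
Proof.
move=> xl; rewrite /initial_trace; case: i; first by apply: datum_le => //; left.
by rewrite normrN; apply: datum_le; [right|lra].
Qed.

Lemma initial_trace_lip i : lip_on l D (initial_trace i).
Proof.
move=> x y xl yl; rewrite /initial_trace; case: i; first by apply: datum_lip => //; left.
have -> : - datum (-1) (l - x) - - datum (-1) (l - y) =
  datum (-1) (l - y) - datum (-1) (l - x) by ring.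
have -> : x - y = (l - y) - (l - x) by ring.
by apply: datum_lip; [right|lra|lra].
Qed.

Let gam0 : 0 <= gamma. Proof. by case/andP: gamma01 => /ltW. Qed.
Let gam1 : 0 < 1 - gamma. Proof. by case/andP: gamma01 => ? ?; rewrite subr_gt0. Qed.
Let x0l : 0 <= (0 : R) <= l. Proof. by rewrite lexx ltW. Qed.

Let kap2 i : 2 * c <= rest_speed g Hs Vs i.
Proof. by rewrite /rest_speed; have := subcritical; have := Vs0; case: i; lra. Qed.
Local Notation Sg := (S + Vs + c).
Let kapS i : rest_speed g Hs Vs i + c <= Sg.
Proof. by rewrite /rest_speed; have := Vs0; case: i; lra. Qed.

Lemma small_invariants : exists W : bool -> R -> R -> R,
  [/\ forall i t x, 0 <= x <= l -> `|W i t x| <= D,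
      forall i t s x y, 0 <= t -> 0 <= s -> 0 <= x <= l -> 0 <= y <= l ->
        `|W i t x - W i s y| <= slope_bound D * (`|x - y| + Sg * `|t - s|),
      (forall i x, 0 <= x <= l -> W i 0 x = initial_trace i x) /\
      (forall i t, 0 <= t -> W i t 0 = boundary_trace i t),
      forall i t x, l / c + extinction_bound D < t -> 0 <= x <= l -> W i t x = 0 &
      forall i t s x sg, 0 <= s -> s <= t -> 0 <= x <= l -> 0 <= x - s * sg -> 0 <= sg <= Sg ->
        `|W i t x - W i (t - s) (x - s * sg)| <=
        slope_bound D * (1 + 2 * slope_bound D * Sg) * s *
          (`|cspeed (rest_speed g Hs Vs) l W i t x - sg| + s)].
Proof.
have Dg0 : 0 <= D `^ gamma by exact: powR_ge0.
have Lb0 : 0 <= K * D `^ gamma by rewrite mulr_ge0// ltW.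
have Lbc0 : 0 <= K * D `^ gamma / c by rewrite divr_ge0// ltW.
have powD p : 0 <= p -> forall i, `|initial_trace i 0| `^ p <= D `^ p.
  move=> p0 i; apply: ge0_ler_powR; rewrite ?nnegrE ?(ltW D0)//.
  exact: initial_trace_le.
apply: (char_existence (T1 := l / c + 1) (M0 := data_slope D) (Lb := K * D `^ gamma)
  (ts := extinction_bound D) l0 c0 Dc kap2 kapS) => //.
- exact: initial_trace_le.
- move=> i t t0; apply: le_trans (decay_le _ _ _ t0) _ => //; exact: initial_trace_le.
- by rewrite /data_slope addr_ge0// ltW.
- have -> : c * data_slope D = c * D + K * D `^ gamma by rewrite /data_slope; field; rewrite gt_eqF.
  by rewrite lerDr; exact: mulr_ge0 (ltW c0) (ltW D0).
- move=> i x y xl yl; apply: le_trans (initial_trace_lip _ xl yl) _.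
  by apply: ler_wpM2r => //; rewrite /data_slope lerDl.
- move=> i t s t0 s0; apply: le_trans (decay_lip _ _ _ t0 s0) _ => //.
  by apply: ler_wpM2r => //; apply: ler_wpM2l; [exact: ltW|exact: powD].
- by move=> i; rewrite /boundary_trace decay0.
- by rewrite /extinction_bound divr_ge0 ?powR_ge0// mulr_ge0 ?ltW.
- move=> i t tst; apply: decay_extinct => //; apply: le_trans tst.
  rewrite /extinction /extinction_bound ler_pM2r; last by rewrite invr_gt0 mulr_gt0.
  exact: powD (ltW gam1) i.
- by rewrite lerD2l.
- rewrite {2}/slope_bound; apply: ler_wpM2l; first by rewrite /data_slope addr_ge0// ltW.
  rewrite ler_expR -[leRHS]mul1r; apply: ler_wpM2r => //.
  by rewrite addr_ge0// divr_ge0// ltW.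
Qed.
(** The celerity stays between S/2 and 3S/2, where S = sqrt(g Hs); being
    nonnegative, it is the square root of g times the depth. The bounds on the depth and the speeds are the ones that
    [closed_loop_unique] requires. *)
Lemma small_data_solution : exists H V : R -> R -> R,
  [/\ global_solution g l K gamma Hs Vs H0 V0 H V,
      forall t x, 0 <= t -> 0 <= x <= l -> [/\ Hs / 4 <= H t x,
        c <= V t x + Num.sqrt (g * H t x) & c <= Num.sqrt (g * H t x) - V t x],
      forall t x, l / c + extinction_bound D < t -> 0 <= x <= l -> H t x = Hs /\ V t x = Vs,
      forall t x, 0 <= t -> 0 <= x <= l ->
        `|H t x - Hs| <= 2 * S / g * D /\ `|V t x - Vs| <= D &
      forall t, 0 <= t ->
        lip_on l (2 * S / g * slope_bound D) (H t) /\ lip_on l (slope_bound D) (V t)].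
Proof.
have [W [Wle Wlip [W0 Wb] Wx Wc]] := small_invariants.
have M0 : 0 <= slope_bound D.
  rewrite /slope_bound mulr_ge0 ?expR_ge0// /data_slope addr_ge0 ?(ltW D0)//.
  by rewrite !mulr_ge0 ?powR_ge0 ?invr_ge0 ?(ltW K0) ?(ltW c0).
set M := slope_bound D in M0 Wlip Wc *.
have Sg0 : 0 <= Sg by have := S0; have := Vs0; have := c0; lra.
have flip (x : R) : 0 <= x <= l -> 0 <= l - x <= l by lra.
have Wlip' : forall i t s x y, 0 <= t -> 0 <= s -> 0 <= x <= l -> 0 <= y <= l ->
    `|W i t x - W i s y| <= M * (1 + Sg) * (`|t - s| + `|x - y|).
  move=> i t s x y t0 s0 xl yl; apply: le_trans (Wlip i t s x y t0 s0 xl yl) _.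
  rewrite -mulrA; apply: ler_wpM2l => //.
  have := mulr_ge0 Sg0 (normr_ge0 (x - y)); have := normr_ge0 (t - s); lra.
have Wsp : forall i t x, 0 <= t -> 0 <= x <= l ->
    0 < cspeed (rest_speed g Hs Vs) l W i t x <= Sg.
  move=> i t x t0 xl; rewrite /cspeed.
  have := Wle i t x xl; have := Wle (~~ i) t (l - x) (flip x xl).
  rewrite !ler_norml; have := kap2 i; have := kapS i; have := Dc; have := c0; lra.
pose H := depth g Hs l W; pose V := velocity Vs l W.
pose q t x := S + (W true t x + W false t (l - x)) / 4.
have qE t x : 0 <= t -> 0 <= x <= l -> celerity g Hs l W t x = q t x.
  move=> t0 xl; rewrite /celerity /invA /invB /q clamp_id// max_r// opprK//.
have VE t x : 0 <= t -> 0 <= x <= l -> V t x = Vs + (W true t x - W false t (l - x)) / 2.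
  by move=> t0 xl; rewrite /V /velocity /invA /invB clamp_id// max_r.
have HE t x : 0 <= t -> 0 <= x <= l -> H t x = q t x * q t x / g.
  by move=> t0 xl; rewrite /H /depth qE.
have qS t x : 0 <= x <= l -> `|q t x - S| <= D / 2.
  move=> xl; rewrite /q; have := Wle true t x xl; have := Wle false t (l - x) (flip x xl).
  by rewrite !ler_norml; lra.
have q_in t x : 0 <= x <= l -> S / 2 <= q t x <= 3 * S / 2.
  by move=> xl; have := qS t x xl; rewrite ler_norml; have := DS; lra.
have q_ge0 t x : 0 <= x <= l -> 0 <= q t x.
  by move=> xl; have := q_in t x xl; have := S0; lra.
have sqrtE t x : 0 <= t -> 0 <= x <= l -> Num.sqrt (g * H t x) = q t x.
  move=> t0 xl; rewrite HE//.
  have -> : g * (q t x * q t x / g) = q t x ^+ 2 by field; rewrite gt_eqF.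
  by rewrite sqrtr_sqr ger0_norm// q_ge0.
have Hge t x : 0 <= t -> 0 <= x <= l -> Hs / 4 <= H t x.
  move=> t0 xl; rewrite HE// ler_pdivlMr//.
  have h := q_in t x xl; have h2 : S / 2 * (S / 2) <= q t x * q t x.
    by apply: ler_pM; have := S0; lra.
  have := SS; lra.
have Hge0 t x : 0 <= t -> 0 <= x <= l -> 0 <= H t x.
  by move=> t0 xl; apply: le_trans (Hge t x t0 xl); rewrite divr_ge0// ltW.
have init x : 0 <= x <= l -> H 0 x = H0 x /\ V 0 x = V0 x.
  move=> xl; have [h1 _] := sqrt_depth_bounds (H0d xl).
  have h0 : 0 < H0 x by have := H0d xl; rewrite ler_norml; have := Hs0; have := dHs; lra.
  have e : q 0 x = Num.sqrt (g * H0 x).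
    by rewrite /q !W0 ?flip// /initial_trace subKr /datum; field.
  rewrite HE// VE// e -expr2 sqr_sqrtr ?mulr_ge0 ?(ltW g0) ?(ltW h0)//; split.
    by field; rewrite gt_eqF.
  by rewrite !W0 ?flip// /initial_trace subKr /datum; field.
have x0l' : 0 <= l <= l by rewrite lexx ltW.
exists H, V; split.
- move=> T T0; have [mass mom] := invariants_weak g0 l0 (mulr_ge0 M0 (addr_ge0 ler01 Sg0))
    (mulr_ge0 M0 (addr_ge0 ler01 (mulr_ge0 (mulr_ge0 (ler0n R 2) M0) Sg0))) Wle Wlip' Wsp Wc T0.
  have m0 := mulr_ge0 M0 (addr_ge0 ler01 Sg0).
  split => //.
    split; first exact: lip2_Lip_rect (depth_lip Hs Vs g0 l0 m0 Wle Wlip').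
    exact: lip2_Lip_rect (velocity_lip Vs l0 m0 Wlip').
  exists (decay K gamma (datum (-1) l)), (decay K gamma (datum 1 0)); split.
  + by rewrite (_ : _ - _ - _ + _ = datum (-1) l); [exact: decay_control|rewrite /datum; ring].
  + by rewrite (_ : _ + _ - _ - _ = datum 1 0); [exact: decay_control|rewrite /datum; ring].
  + move=> t /andP[t0 _]; split; first exact: Hge0.
    congr (_ * _); rewrite sqrtE// VE// /q subrr Wb// /boundary_trace /initial_trace subr0 decayN.
    by field.
  + move=> t /andP[t0 _]; split; first exact: Hge0.
    congr (_ * _); rewrite sqrtE// VE// /q Wb// /boundary_trace /initial_trace.
    by field.
- move=> t x t0 xl; split; first exact: Hge.
  + rewrite sqrtE// VE// /q.
    have := Wle true t x xl; have := Wle false t (l - x) (flip x xl).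
    by rewrite !ler_norml; have := kap2 true; have := Dc; rewrite /rest_speed; lra.
  + rewrite sqrtE// VE// /q.
    have := Wle true t x xl; have := Wle false t (l - x) (flip x xl).
    by rewrite !ler_norml; have := kap2 false; have := Dc; rewrite /rest_speed; lra.
- move=> t x tx xl; have t0 : 0 <= t.
    apply: ltW; apply: le_lt_trans tx; rewrite addr_ge0// ?divr_ge0 ?powR_ge0 ?mulr_ge0// ltW//.
  rewrite HE// VE// /q !Wx ?flip//; split; last by field.
  by rewrite addr0 mul0r addr0 SS; field; rewrite gt_eqF.
- move=> t x t0 xl; split.
    have -> : H t x - Hs = (q t x - S) * (q t x + S) / g.
      by rewrite HE//; apply: (canRL (mulfK (lt0r_neq0 g0))); rewrite mulrBl divfK ?gt_eqF//; have := SS; lra.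
    rewrite !normrM normfV (gtr0_norm g0).
    have -> : 2 * S / g * D = 2 * S * D / g by ring.
    apply: ler_wpM2r.
      by rewrite invr_ge0 ltW.
    have := q_in t x xl => /andP[q1 q2]; rewrite (ger0_norm (addr_ge0 (q_ge0 t x xl) (ltW S0))).
    have h1 : `|q t x - S| * (q t x + S) <= D / 2 * (5 * S / 2).
      by apply: ler_pM => //; [exact: addr_ge0 (q_ge0 t x xl) (ltW S0)|exact: qS|lra].
    have := mulr_ge0 (ltW S0) (ltW D0); lra.
  rewrite VE//; have := Wle true t x xl; have := Wle false t (l - x) (flip x xl).
  by rewrite !ler_norml; lra.
- move=> t t0; split=> x y xl yl.
    have qlip : `|q t x - q t y| <= M / 2 * `|x - y|.
      have h1 := Wlip true t t x y t0 t0 xl yl.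
      have h2 := Wlip false t t (l - x) (l - y) t0 t0 (flip x xl) (flip y yl).
      rewrite subrr normr0 mulr0 addr0 in h1; rewrite subrr normr0 mulr0 addr0 in h2.
      have e : `|l - x - (l - y)| = `|x - y| by rewrite -normrN; congr (`|_|); ring.
      rewrite e in h2; rewrite /q; move: h1 h2; rewrite !ler_norml; lra.
    have -> : H t x - H t y = (q t x - q t y) * (q t x + q t y) / g by rewrite !HE//; ring.
    rewrite !normrM normfV (gtr0_norm g0).
    have -> : 2 * S / g * M * `|x - y| = 2 * S * M * `|x - y| / g by ring.
    apply: ler_wpM2r; first by rewrite invr_ge0 ltW.
    have /andP[_ q1] := q_in t x xl; have /andP[_ q2] := q_in t y yl.
    rewrite (ger0_norm (addr_ge0 (q_ge0 t x xl) (q_ge0 t y yl))).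
    have h1 : `|q t x - q t y| * (q t x + q t y) <= M / 2 * `|x - y| * (3 * S).
      by apply: ler_pM => //; [exact: addr_ge0 (q_ge0 t x xl) (q_ge0 t y yl)|lra].
    have := mulr_ge0 (mulr_ge0 M0 (normr_ge0 (x - y))) (ltW S0); lra.
  rewrite !VE//.
  have h1 := Wlip true t t x y t0 t0 xl yl.
  have h2 := Wlip false t t (l - x) (l - y) t0 t0 (flip x xl) (flip y yl).
  rewrite subrr normr0 mulr0 addr0 in h1; rewrite subrr normr0 mulr0 addr0 in h2.
  have e : `|l - x - (l - y)| = `|x - y| by rewrite -normrN; congr (`|_|); ring.
  by rewrite e in h2; move: h1 h2; rewrite !ler_norml; lra.
Qed.
End NearEquilibrium.
End SmallData.

(** * Finite-time convergence and stability *)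

Section ClosedLoopTheorem.
Context {R : realType}.
Local Notation mu := (@lebesgue_measure R).

Lemma powR_scale_cvg0 (k p : R) : 0 <= k -> 0 < p -> (k * d) `^ p @[d --> 0^'+] --> 0.
Proof.
move=> k0 p0; have h : k `^ p * d `^ p @[d --> 0^'+] --> k `^ p * 0.
  by apply: cvgMr; exact: powR_cvg0.
rewrite mulr0 in h; apply: cvg_trans h; apply: near_eq_cvg.
near=> d; have d0 : 0 < d by near: d; exact: nbhs_right_gt.
by rewrite powRM// ltW.
Unshelve. all: by end_near. Qed.

Variables (g l K gamma Hs Vs c : R).
Hypotheses (g0 : 0 < g) (l0 : 0 < l) (K0 : 0 < K) (gamma01 : 0 < gamma < 1).
Hypotheses (Hs0 : 0 < Hs) (Vs0 : 0 < Vs) (c0 : 0 < c).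
Local Notation S := (Num.sqrt (g * Hs)).
Hypothesis subcritical : 2 * c < S - Vs.
Local Notation D := (invariant_size g Hs).

Let k0 : 0 <= 1 + 2 * g / S.
Proof. by rewrite addr_ge0// divr_ge0 ?sqrtr_ge0// mulr_ge0// ltW. Qed.

Lemma invariant_size_cvg0 : D d @[d --> 0^'+] --> 0.
Proof.
have h : D d @[d --> 0^'+] --> (1 + 2 * g / S) * 0.
  by apply: cvgMr; exact: cvg_at_right_filter.
by rewrite mulr0 in h.
Qed.

Lemma extinction_bound_cvg0 : extinction_bound K gamma (D d) @[d --> 0^'+] --> 0.
Proof.
have h : extinction_bound K gamma (D d) @[d --> 0^'+] --> 0 / (K * (1 - gamma)).
  apply: cvgMl; apply: (powR_scale_cvg0 k0).
  by case/andP: gamma01 => ? ?; rewrite subr_gt0.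
by rewrite mul0r in h.
Qed.

Lemma slope_bound_cvg0 : slope_bound l K gamma c (D d) @[d --> 0^'+] --> 0.
Proof.
have h : slope_bound l K gamma c (D d) @[d --> 0^'+] --> (0 + K * 0 / c) * expR (l / c + 1).
  apply: cvgMl; apply: cvgD; first exact: invariant_size_cvg0.
  apply: cvgMl; apply: cvgMr; apply: (powR_scale_cvg0 k0); by case/andP: gamma01.
by rewrite mulr0 mul0r addr0 mul0r in h.
Qed.

(** All the smallness conditions are upper bounds on quantities that tend to 0
    with delta. *)
Lemma small_perturbation eps : 0 < eps -> exists2 delta1, 0 < delta1 &
  forall delta, 0 < delta <= delta1 -> forall H0 V0 : R -> R,
  (forall x, 0 <= x <= l -> `|H0 x - Hs| <= delta) ->
  (forall x, 0 <= x <= l -> `|V0 x - Vs| <= delta) ->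
  lip_on l delta H0 -> lip_on l delta V0 ->
  exists H V : R -> R -> R,
  [/\ global_solution g l K gamma Hs Vs H0 V0 H V,
      forall T, 0 < T -> forall H' V' : R -> R -> R,
        closed_loop_solution g l K gamma Hs Vs H0 V0 T H' V' ->
        forall t x, 0 <= t <= T -> 0 <= x <= l -> H' t x = H t x /\ V' t x = V t x,
      forall t x, l / c + extinction_bound K gamma (D delta) < t -> 0 <= x <= l ->
        H t x = Hs /\ V t x = Vs,
      forall t x, 0 <= t -> 0 <= x <= l -> `|H t x - Hs| <= eps /\ `|V t x - Vs| <= eps &
      forall t, 0 <= t -> lip_on l eps (H t) /\ lip_on l eps (V t)].
Proof.
move=> eps0.
have S0 : 0 < S by rewrite sqrtr_gt0 mulr_gt0.
pose q := 2 * S / g.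
have q0 : 0 < q by rewrite divr_gt0// mulr_gt0.
have small (f : R -> R) (e : R) : 0 < e -> f d @[d --> 0^'+] --> 0 ->
    \forall d \near 0^'+, f d <= e.
  move=> e0 /cvgr0_norm_le /(_ e e0); apply: filterS => d; exact: le_trans (ler_norm _).
have : \forall d \near (0 : R)^'+, [/\ d <= Hs / 2, D d <= c /\ D d <= S,
    extinction_bound K gamma (D d) <= 1, slope_bound l K gamma c (D d) <= Num.min 1 (Num.min eps (eps / q)) &
    D d <= Num.min eps (eps / q)].
  near=> d; split; [|split| | |].
  - by near: d; apply: small; [rewrite divr_gt0|exact: cvg_at_right_filter].
  - by near: d; apply: small; [|exact: invariant_size_cvg0].
  - by near: d; apply: small; [|exact: invariant_size_cvg0].
  - by near: d; apply: small; [|exact: extinction_bound_cvg0].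
  - by near: d; apply: small; [rewrite !lt_min ltr01 eps0 divr_gt0|exact: slope_bound_cvg0].
  - by near: d; apply: small; [rewrite !lt_min eps0 divr_gt0|exact: invariant_size_cvg0].
move=> [e /= e0 he]; exists (e / 2); first by rewrite divr_gt0.
move=> d /andP[d0 de] H0 V0 H0d V0d H0l V0l.
have [] := he d _ d0; first by rewrite /= sub0r normrN gtr0_norm//; lra.
move=> dHs [Dc DS] tsD; rewrite !le_min => /and3P[M1 Me Mq] /andP[De Dq].
have [H [V [glob lower ext bd lip]]] := small_data_solution g0 l0 K0 gamma01 Hs0 Vs0 c0
  subcritical d0 dHs H0d V0d H0l V0l Dc DS tsD M1.
rewrite !ler_pdivlMr// -/q in Mq Dq.
exists H, V; split => //.
- move=> T T0 H' V' sol'.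
  apply: (closed_loop_unique (hm := Hs / 8) (c := c) g0 l0 K0 gamma01 T0 _ c0 (glob T T0) sol').
    by rewrite divr_gt0.
  move=> t x /andP[t0 _] xl; have [h1 h2 h3] := lower t x t0 xl; split=> //; lra.
- move=> t x t0 xl; have [h1 h2] := bd t x t0 xl; split; last exact: le_trans h2 De.
  by apply: le_trans h1 _; rewrite mulrC.
- move=> t t0; have [h1 h2] := lip t t0; split=> x y xl yl.
    by apply: le_trans (h1 x y xl yl) _; apply: ler_wpM2r => //; rewrite mulrC.
  by apply: le_trans (h2 x y xl yl) _; exact: ler_wpM2r.
Unshelve. all: by end_near. Qed.

Lemma W1oo_norm_near (h : R) (u : R -> R) delta : Lip_interval l u ->
  (W1oo_norm l (fun x => u x - h)%R < delta%:E)%E ->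
  (forall x, 0 <= x <= l -> `|u x - h| <= delta) /\ lip_on l delta u.
Proof.
move=> ul un; have [|h1 h2] := W1oo_norm_lt l0 _ un; last first.
  by split=> // x y xl yl; have := h2 x y xl yl; rewrite opprB addrA subrK.
move: ul => [M [Mr HM]]; exists M; split=> // k Mk [x y] xy /=.
by have := HM k Mk (x, y) xy; rewrite /= opprB addrA subrK.
Qed.

(** The solution constructed satisfies the bound with eps / 2 for the values and
    eps / 2 for the slopes; any other global solution coincides with it on every
    time interval. *)
Lemma stable_near_equilibrium : stable_equilibrium g l K gamma Hs Vs.
Proof.
move=> eps eps0; have e20 : 0 < eps / 2 by rewrite divr_gt0.
have [eta eta0 Heta] := small_perturbation e20.
exists eta => // H0 V0 H0L V0L; rewrite /pair_norm gt_max => /andP[H0n V0n].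
have [H0d H0l] := W1oo_norm_near H0L H0n; have [V0d V0l] := W1oo_norm_near V0L V0n.
have [|H [V [glob uniq _ bd lip]]] := Heta eta _ H0 V0 H0d V0d H0l V0l.
  by rewrite eta0 lexx.
split; first by exists H, V.
move=> H' V' glob'.
have norm_le (u u' : R -> R) (h : R) : (forall x, 0 <= x <= l -> u' x = u x) ->
    (forall x, 0 <= x <= l -> `|u x - h| <= eps / 2) -> lip_on l (eps / 2) u ->
    (W1oo_norm l (fun x => u' x - h)%R <= eps%:E)%E.
  move=> uu ud ul; have := @W1oo_norm_le _ l (eps / 2) (fun x => u' x - h) l0.
  rewrite -splitr; apply; first by move=> x xl; rewrite uu// ud.
  by move=> x y xl yl; rewrite !uu// opprB addrA subrK ul.
have pn (t : R) : 0 <= t -> (pair_norm l (fun x => H' t x - Hs)%R (fun x => V' t x - Vs)%R <= eps%:E)%E.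
  move=> t0; have T0 : 0 < t + 1 by lra.
    have tT : 0 <= t <= t + 1 by lra.
  have eqs x := uniq _ T0 H' V' (glob' _ T0) t x tT.
  have [HLt VLt] := lip t t0; rewrite /pair_norm ge_max; apply/andP; split.
    apply: (norm_le (H t)) => // x xl; first by have [] := eqs x xl.
    by have [] := bd t x t0 xl.
  apply: (norm_le (V t)) => // x xl; first by have [] := eqs x xl.
  by have [] := bd t x t0 xl.
rewrite /Loo_pair_norm unlock /= lebesgue_measure_gt0; apply/ess_supP.
apply: aeW => t /=; rewrite patchE; case: ifPn => [|_]; last first.
  by rewrite abse0 lee_fin ltW.
rewrite inE/= in_itv/= andbT => t0; rewrite gee0_abs; first exact: pn (ltW t0).
by rewrite /pair_norm le_max /W1oo_norm adde_ge0// Lnorm_ge0.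
Qed.
End ClosedLoopTheorem.

Theorem theorem3 (R : realType) (g l1 K gamma Hs Vs c : R)
  (hg : 0 < g) (hl1 : 0 < l1) (hK : 0 < K) (hgamma : 0 < gamma < 1)
  (hHs : 0 < Hs) (hVs : 0 < Vs < Num.sqrt (g * Hs))
  (hc : 0 < c) (hc2 : 2 * c < Num.sqrt (g * Hs) - Vs) :
  (exists (delta0 : R) (tstar : R -> R),
    [/\ 0 < delta0,
        tstar d @[d --> 0^'+] --> 0 &
        forall delta, 0 < delta <= delta0 ->
        forall H0 V0 : R -> R, Lip_interval l1 H0 -> Lip_interval l1 V0 ->
        (Order.max (W1oo_norm l1 (fun x => H0 x - Hs)%R)
                   (W1oo_norm l1 (fun x => V0 x - Vs)%R) < delta%:E)%E ->
        forall T, 0 < T ->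
        exists H V : R -> R -> R,
        [/\ closed_loop_solution g l1 K gamma Hs Vs H0 V0 T H V,
            forall H' V' : R -> R -> R,
              closed_loop_solution g l1 K gamma Hs Vs H0 V0 T H' V' ->
              forall t x, 0 <= t <= T -> 0 <= x <= l1 ->
                H' t x = H t x /\ V' t x = V t x &
            forall t x, l1 / c + tstar delta <= t <= T -> 0 < x < l1 ->
              H t x = Hs /\ V t x = Vs]])
  /\ stable_equilibrium g l1 K gamma Hs Vs.
Proof.
have [Vs0 _] := andP hVs.
split; last exact: stable_near_equilibrium hc2.
have [delta0 delta00 small] := small_perturbation hg hl1 hK hgamma hHs Vs0 hc hc2 ltr01.
exists delta0, (fun d => extinction_bound K gamma (invariant_size g Hs d) + d); split=> //.
  have h : extinction_bound K gamma (invariant_size g Hs d) + d @[d --> 0^'+] --> 0 + 0.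
    by apply: cvgD; [exact: extinction_bound_cvg0|exact: cvg_at_right_filter].
  by rewrite addr0 in h.
move=> delta dd H0 V0 H0L V0L; rewrite gt_max => /andP[H0n V0n] T T0.
have [H0d H0l] := W1oo_norm_near hl1 H0L H0n.
have [V0d V0l] := W1oo_norm_near hl1 V0L V0n.
have [H [V [glob uniq rest _ _]]] := small delta dd H0 V0 H0d V0d H0l V0l.
exists H, V; split; [exact: glob|exact: uniq|].
move=> t x /andP[tl _] /andP[x0 xl]; apply: rest; last by rewrite !ltW.
by apply: lt_le_trans tl; case/andP: dd => d0 _; rewrite addrA ltrDl.
Qed.
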